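(* Let $\mathcal{N}=(\mathcal{V},\mathcal{S})$ be a network, $r>0$, and $\mathcal{C}_r^{\mathcal{N}}$ the associated $r$-collapsed network with weights $\phi_{b}\ge 0$, $b\in\mathcal{C}_r^{\mathcal{N}}$. Let $f:[0,\infty)\to\mathbb{R}$ be non-increasing and continuously differentiable, and let $\mathcal{H}:\mathcal{N}^m\to\mathbb{R}$ be $$\mathcal{H}(\mathcal{P})=\sum_{i=1}^{m}\ \sum_{b\in V_i^{\mathcal{C}_r^{\mathcal{N}}}(\mathcal{P})} f(\|b-p_i\|)\,\phi_b ,$$ where $V_i^{\mathcal{C}_r^{\mathcal{N}}}(\mathcal{P})$ are the lexicographic Voronoi cells. Consider the discrete-time evolution of the sensors' positions on the network $$\mathcal{P}^{(k+1)}=\mathcal{P}^{(k)}+\delta_k\,\widetilde{D}\mathcal{H}(\mathcal{P}^{(k)}),\qquad k=0,1,2,\dots,$$ where the $h$-th component of $\widetilde{D}\mathcal{H}$ is the directional derivative $\widetilde{D}_h\mathcal{H}$ along the network defined in the context. If $f$ has locally bounded second derivatives, then, for suitable step-sizes $\delta_k>0$, the sequence $\mathcal{P}^{(k)}$ lies in a bounded set and (i) $\mathcal{H}(\mathcal{P}^{(k)})$ is monotonically nondecreasing in $k$; (ii) $\mathcal{P}^{(k)}$ converges to the set of critical points of $\mathcal{H}$.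
   Context: $\|\cdot\|$ is the Euclidean norm. For $p_1\ne p_2$ in $\mathbb{R}^2$, $[p_1,p_2]$ is the segment joining them and $(p_1,p_2)$ the open segment; its length is $\ell([p_1,p_2])=\|p_2-p_1\|$ and its barycenter is $b([p_1,p_2])=\frac12(p_1+p_2)$. The partition of $[p_1,p_2]$ in $k$ sub-segments is $s_i=[p_1+(i-1)\frac{p_2-p_1}{k},\,p_1+i\frac{p_2-p_1}{k}]$, $i=1,\dots,k$. A network $\mathcal{N}=(\mathcal{V},\mathcal{S})$ is a subset of $\mathbb{R}^2$ consisting of a finite set of distinct points $\mathcal{V}=\{v_1,\dots,v_n\}$ and a set $\mathcal{S}$ of segments $s_{ij}=[v_i,v_j]$, $i\ne j$, such that every vertex is an endpoint of some segment of $\mathcal{S}$ and the open segments of distinct elements of $\mathcal{S}$ are disjoint. For $r>0$, the $r$-collapsed network $\mathcal{C}_r^{\mathcal{N}}$ is the finite set of points obtained by partitioning each $s\in\mathcal{S}$ in $k_s=\lceil \ell(s)/r\rceil$ sub-segments and collecting the barycenters of all the sub-segments so obtained. Each $b\in\mathcal{C}_r^{\mathcal{N}}$ carries a (density) weight $\phi_b\ge0$. A configuration of $m$ sensors is $\mathcal{P}=(p_1,\dots,p_m)\in\mathcal{N}^m$. Degenerate configurations, in which $p_i=p_j$ for some $i\neq j$, are not considered. The lexicographic Voronoi cells are $$V_i^{\mathcal{C}_r^{\mathcal{N}}}(\mathcal{P})=\{b\in\mathcal{C}_r^{\mathcal{N}} : \|b-p_i\|\le\|b-p_j\|\ \text{for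 all } j,\ \text{and } \|b-p_i\|<\|b-p_j\| \text{ for all } j<i\}.$$ The generalized gradient has components $\frac{\partial_l\mathcal{H}}{\partial p_h}(\mathcal{P})=\sum_{b\in V_h^{\mathcal{C}_r^{\mathcal{N}}}(\mathcal{P})}\frac{\partial}{\partial p_h}f(\|b-p_h\|)\,\phi_b$. For $s_{ij}\in\mathcal{S}$ let $w_{ij}$ be the unit vector in the direction of $s_{ij}$, and for $p_h\in s_{ij}$ put $$D_{w_{ij}}\mathcal{H}(\mathcal{P})[p_h]=\Big(\frac{\partial_l\mathcal{H}}{\partial p_h}(\mathcal{P})\cdot w_{ij}\Big)w_{ij}.$$ For a vertex $v_i$ let $S_{v_i}$ be the set of segments $s\in\mathcal{S}$ having $v_i$ as an endpoint, $s=[v_i,v_j]$ or $s=[v_j,v_i]$, for which there is $\bar\delta>0$ with $v_i+\delta D_{w_{ij}}\mathcal{H}(\mathcal{P})[v_i]\in\mathcal{N}$ for all $\delta\in[0,\bar\delta]$. Then the directional derivative along the network is $$\widetilde{D}_h\mathcal{H}(\mathcal{P})=\begin{cases} D_{w_{ij}}\mathcal{H}(\mathcal{P})[p_h] & \text{if } p_h\in\mathcal{N}\setminus\mathcal{V},\ p_h \text{ in the open segment of } s_{ij},\\ \max_{s_{ij}\in S_{v_i}}D_{w_{ij}}\mathcal{H}(\mathcal{P})[p_h] & \text{if } p_h=v_i\in\mathcal{V},\ S_{v_i}\neq\emptyset,\\ 0 & \text{if } p_h=v_i\in\mathcal{V},\ S_{v_i}=\emptyset,\end{cases}$$ where the maximum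 selects a vector of largest Euclidean norm (with a fixed choice rule in case of ties). A configuration $\mathcal{P}$ is a critical point of $\mathcal{H}$ (for motion on the network) when all components of $\widetilde{D}\mathcal{H}(\mathcal{P})$ vanish. Convergence to a set means that the distance from $\mathcal{P}^{(k)}$ to the set tends to $0$.
   Formalization: It is also assumed that p ↦ f(‖b−p‖) is differentiable on the network (so f′(0)=0), without which the gradient is undefined at p_h=b; only the initial configuration is assumed nondegenerate, while later iterates and critical points may have p_i=p_j. *)

(* Defs.v *)
From HB Require Import structures.
From mathcomp Require Import all_boot all_order all_algebra.
From mathcomp Require Import all_classical all_reals all_analysis.

Set Implicit Arguments.
Unset Strict Implicit.
Unset Printing Implicit Defensive.

Import Order.TTheory GRing.Theory Num.Theory.
Import numFieldNormedType.Exports.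

Local Open Scope classical_set_scope.
Local Open Scope ring_scope.

(* Points of the plane are row vectors.  The library norm on ['rV[R]_2] is the
   sup norm, hence a separate Euclidean one. *)
Definition dot {R : realType} (u v : 'rV[R]_2) : R := \sum_(i < 2) u 0 i * v 0 i.

Definition enorm {R : realType} (u : 'rV[R]_2) : R := Num.sqrt (dot u u).

Definition segm {R : realType} (p1 p2 : 'rV[R]_2) : set 'rV[R]_2 :=
  [set p | exists t : R, 0 <= t <= 1 /\ p = p1 + t *: (p2 - p1)].

Definition open_segm {R : realType} (p1 p2 : 'rV[R]_2) : set 'rV[R]_2 :=
  [set p | exists t : R, 0 < t < 1 /\ p = p1 + t *: (p2 - p1)].

(* A segment is recorded as an ordered pair of vertex indices, the orientation
   being arbitrary; [edges_disjoint] rules out listing both orientations. *)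
Record network (R : realType) := Network {
  nverts : nat;
  vertex : 'I_nverts -> 'rV[R]_2;
  edges : {set 'I_nverts * 'I_nverts};
  vertex_inj : injective vertex;
  edges_neq : forall e, e \in edges -> e.1 != e.2;
  vertex_covered : forall i, exists e, e \in edges /\ (i = e.1 \/ i = e.2);
  edges_disjoint : forall e e', e \in edges -> e' \in edges -> e != e' ->
    open_segm (vertex e.1) (vertex e.2)
      `&` open_segm (vertex e'.1) (vertex e'.2) = set0 }.

Section Network.
Context {R : realType} (N : network R).

Definition vertices : set 'rV[R]_2 := range (@vertex R N).

Definition edge_segm (e : 'I_(nverts N) * 'I_(nverts N)) : set 'rV[R]_2 :=
  segm (vertex e.1) (vertex e.2).

Definition edge_open_segm (e : 'I_(nverts N) * 'I_(nverts N)) : set 'rV[R]_2 :=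
  open_segm (vertex e.1) (vertex e.2).

Definition edge_length (e : 'I_(nverts N) * 'I_(nverts N)) : R :=
  enorm (vertex e.2 - vertex e.1).

Definition edge_dir (e : 'I_(nverts N) * 'I_(nverts N)) : 'rV[R]_2 :=
  (edge_length e)^-1 *: (vertex e.2 - vertex e.1).

Definition on_network : set 'rV[R]_2 :=
  vertices `|` \bigcup_(e in [set e | e \in edges N]) edge_segm e.

End Network.

Definition barycenter {R : realType} (s : 'rV[R]_2 * 'rV[R]_2) : 'rV[R]_2 :=
  2^-1 *: (s.1 + s.2).

(* End points of the [i]-th sub-segment, [1 <= i <= k]. *)
Definition subsegm {R : realType} (p1 p2 : 'rV[R]_2) (k i : nat) :
    'rV[R]_2 * 'rV[R]_2 :=
  (p1 + (i%:R - 1) *: (k%:R^-1 *: (p2 - p1)),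
   p1 + i%:R *: (k%:R^-1 *: (p2 - p1))).

Section Coverage.
Context {R : realType} (N : network R) (r : R).

Definition edge_parts (e : 'I_(nverts N) * 'I_(nverts N)) : nat :=
  `|Num.ceil (edge_length e / r)|%N.

(* A duplicate-free list, so that sums over it are sums over a finite set. *)
Definition collapsed : seq 'rV[R]_2 :=
  undup [seq barycenter (subsegm (vertex e.1) (vertex e.2) (edge_parts e) i)
        | e <- enum (edges N), i <- iota 1 (edge_parts e)].

Context {m : nat}.

Definition on_network_conf (P : 'I_m -> 'rV[R]_2) : Prop :=
  forall h, on_network N (P h).

Definition voronoi (P : 'I_m -> 'rV[R]_2) (i : 'I_m) : seq 'rV[R]_2 :=
  [seq b <- collapsed |
    [forall j : 'I_m, enorm (b - P i) <= enorm (b - P j)] &&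
    [forall j : 'I_m, (j < i)%N ==> (enorm (b - P i) < enorm (b - P j))]].

Context (phi : 'rV[R]_2 -> R) (f : R -> R).

Definition coverage (P : 'I_m -> 'rV[R]_2) : R :=
  \sum_(i < m) \sum_(b <- voronoi P i) f (enorm (b - P i)) * phi b.

(* The vector of the partial derivatives of [p |-> f `|b - p|]. *)
Definition perf_grad (b p : 'rV[R]_2) : 'rV[R]_2 :=
  \row_(j < 2) 'D_(delta_mx 0 j) (fun q : 'rV[R]_2 => f (enorm (b - q)) : R^o) p.

Definition coverage_grad (P : 'I_m -> 'rV[R]_2) (h : 'I_m) : 'rV[R]_2 :=
  \sum_(b <- voronoi P h) phi b *: perf_grad b (P h).

Definition edge_deriv (P : 'I_m -> 'rV[R]_2) (h : 'I_m)
    (e : 'I_(nverts N) * 'I_(nverts N)) : 'rV[R]_2 :=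
  dot (coverage_grad P h) (edge_dir e) *: edge_dir e.

(* The set S_v for [v = P h]. *)
Definition feasible_edges (P : 'I_m -> 'rV[R]_2) (h : 'I_m) :
    set ('I_(nverts N) * 'I_(nverts N)) :=
  [set e | [/\ e \in edges N, P h = vertex e.1 \/ P h = vertex e.2 &
    exists dbar : R, 0 < dbar /\
      forall delta, 0 <= delta <= dbar ->
        on_network N (P h + delta *: edge_deriv P h e)]].

(* [d] is an admissible value of the directional derivative along the network;
   it is unique except for ties between longest vectors at a vertex. *)
Definition is_network_deriv (P : 'I_m -> 'rV[R]_2) (h : 'I_m)
    (d : 'rV[R]_2) : Prop :=
  [/\ forall e, e \in edges N -> ~ vertices N (P h) -> edge_open_segm e (P h) ->
        d = edge_deriv P h e,
      vertices N (P h) -> feasible_edges P h !=set0 ->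
        exists e, [/\ feasible_edges P h e, d = edge_deriv P h e &
          forall e', feasible_edges P h e' ->
            enorm (edge_deriv P h e') <= enorm (edge_deriv P h e)] &
      vertices N (P h) -> feasible_edges P h = set0 -> d = 0].

(* A directional derivative operator, with some fixed rule to break ties. *)
Definition network_deriv
    (Dt : ('I_m -> 'rV[R]_2) -> 'I_m -> 'rV[R]_2) : Prop :=
  forall P h, on_network_conf P -> is_network_deriv P h (Dt P h).

Definition critical (Dt : ('I_m -> 'rV[R]_2) -> 'I_m -> 'rV[R]_2) :
    set ('I_m -> 'rV[R]_2) :=
  [set P | on_network_conf P /\ forall h, Dt P h = 0].

End Coverage.

Definition conf_dist {R : realType} {m : nat} (P Q : 'I_m -> 'rV[R]_2) : R :=
  Num.sqrt (\sum_(h < m) enorm (P h - Q h) ^+ 2).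

(* Extended-real valued, so that the distance to the empty set is [+oo]. *)
Definition dist_to {R : realType} {m : nat} (A : set ('I_m -> 'rV[R]_2))
    (P : 'I_m -> 'rV[R]_2) : \bar R :=
  ereal_inf [set (conf_dist P Q)%:E | Q in A].

(* Derivatives relative to [0, +oo[, hence one-sided at 0: the values of the
   functions at negative reals are irrelevant. *)
Definition halfline_deriv {R : realType} (f f' : R -> R) : Prop :=
  forall x : R, 0 <= x ->
    (fun y : R => (f y - f x) / (y - x)) @ within [set y | 0 <= y] (dnbhs x)
      --> f' x.

Definition C1_halfline {R : realType} (f : R -> R) : Prop :=
  exists f1 : R -> R, halfline_deriv f f1 /\
    {within [set x : R | 0 <= x], continuous f1}.

Definition locally_bounded_deriv2 {R : realType} (f : R -> R) : Prop :=
  exists f1 f2 : R -> R, [/\ halfline_deriv f f1, halfline_deriv f1 f2 &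
    forall x : R, 0 <= x -> exists M : R,
      \forall y \near within [set y | 0 <= y] (nbhs x), `|f2 y| <= M].

(* Main.v *)
Require Import Defs.
From HB Require Import structures.
From mathcomp Require Import all_boot all_order all_algebra.
From mathcomp Require Import all_classical all_reals all_analysis.
From mathcomp Require Import ring lra.

Set Implicit Arguments.
Unset Strict Implicit.
Unset Printing Implicit Defensive.

Import Order.TTheory GRing.Theory Num.Theory.
Import numFieldNormedType.Exports.

Local Open Scope classical_set_scope.
Local Open Scope ring_scope.

(** Serving each barycenter from its cell means serving it from a closest
    sensor. As [f] is nonincreasing and the weights are nonnegative, the
    coverage is therefore [H P = \sum_b max_h u_b (P h)] with
    [u_b p = f `|b - p| * phi b]. From every configuration a critical one is
    reached after finitely many steps of suitable sizes that never decrease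
    [H]; the sequence then stays there, and its distance to the critical set is
    eventually [0].

    Short steps raise [H]. If every sensor keeps its cell, the value obtained is
    a lower bound of [H] that is a sum of functions of the single sensors, and
    the slopes of these functions along the edges are Lipschitz: the derivative
    of [f] is Lipschitz on bounded intervals because the second derivative is
    locally bounded, and it vanishes at [0] because [b] lies on the network and
    [u_b] is differentiable there. Hence a step of at most [tau] that stops at
    the first vertex met gains at least half of its first-order increase
    ([safe_objective]). Such steps alone need not approach the critical set:
    the velocity is discontinuous at the vertices and where cells change, so
    the velocities can tend to zero along a sequence with a limit that is
    not critical. Some sensors have to land exactly on their limits, which
    takes longer steps. A step is boxed if [H] does not fall below its initial
    value anywhere in the box that the step spans, a box with one dimension for
    each sensor.

    Suppose that no critical configuration is reachable. A sequence that gains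
    almost as much as possible after each full step, and whose boxed steps have
    total length at most a multiple of the gain ([terminal]), cannot drift away
    from a cluster point [Q] ([confined], [terminal_cvg]). Near [Q] each sensor
    moves on rays that leave its place in [Q], each [u_b] is monotone along
    these rays, and therefore [H] is submodular in the distances to [Q]
    ([submodular]). Call excess the amount by which [H P] exceeds [H Y] for
    some [Y] obtained from [P] by moving sensors towards [Q]. Submodularity
    makes an excess persist along the steps ([excess_safe], [excess_boxed]),
    while continuity of [H] forces it to vanish at [Q]; and a safe step that
    moves a sensor away from its place in [Q], or through it, creates one. So
    either a boxed step carries a sensor through its place in [Q], where it can
    be stopped, or there is no excess: then all motions are directed towards
    [Q], moving towards [Q] never decreases [H], and the step at the end of
    which the first sensor arrives at its place is boxed ([landing]). A landed
    sensor stays: its speed there would be one of the finitely many slopes at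
    [Q], hence at least a constant [c]; some outward motion of speed [c / 2]
    would persist along all the later full steps ([fast_next]), whereas the
    velocities along full steps have arbitrarily small values
    ([full_velo_small]). Induction on the number of the sensors that have not
    landed ends in a contradiction ([no_terminal]).

    This argument only uses the properties of the network and of the utilities
    that are collected in [ascent_system]; [network_system] establishes them. *)

(** * Finite families of real functions *)

Section Finite.
Context {R : realType}.

Lemma norm_sum_filter_le (T : eqType) (C : seq T) (a : pred T) (x : T -> R) M :
  0 <= M -> (forall b, b \in C -> `|x b| <= M) ->
  `|\sum_(b <- C | a b) x b| <= (size C)%:R * M.
Proof.
move=> M0; elim: C => [|b C IH] xM; first by rewrite big_nil normr0 mul0r.
have /IH {}IH b' : b' \in C -> `|x b'| <= M.
  by move=> bC; apply: xM; rewrite inE bC orbT.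
have xb : `|x b| <= M by apply: xM; rewrite mem_head.
rewrite big_cons /= -natr1 mulrDl mul1r; case: (a b); last by lra.
by apply: (le_trans (ler_normD _ _)); lra.
Qed.

Lemma min_pos_seq (s : seq R) :
  exists2 c : R, 0 < c & forall x, x \in s -> 0 < x -> c <= x.
Proof.
elim: s => [|x s [c c0 IH]]; first by exists 1.
have [x0|x0] := ltP 0 x; last first.
  by exists c => // y; rewrite inE => /predU1P[->|/IH//]; rewrite ltNge x0.
exists (Num.min c x); first by rewrite lt_min c0.
move=> y; rewrite inE => /predU1P[-> _|ys y0]; first by rewrite ge_min lexx orbT.
by rewrite ge_min IH.
Qed.

Lemma small_forall_seq (T : eqType) (s : seq T) (A : T -> R -> Prop) :
  (forall x e e', 0 < e' -> e' <= e -> A x e -> A x e') ->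
  (forall x, x \in s -> exists2 e, 0 < e & A x e) ->
  exists2 e, 0 < e & forall x, x \in s -> A x e.
Proof.
move=> Amono; elim: s => [|x s IH] h; first by exists 1.
have [e e0 Ae] : exists2 e, 0 < e & A x e by apply: h; rewrite mem_head.
have [y ys|e' e'0 Ae'] := IH; first by apply: h; rewrite inE ys orbT.
have m0 : 0 < Num.min e e' by rewrite lt_min e0.
exists (Num.min e e') => // y; rewrite inE => /predU1P[->|ys].
  by apply: Amono Ae => //; rewrite ge_min lexx.
by apply: Amono (Ae' _ ys) => //; rewrite ge_min lexx orbT.
Qed.

(** A function that does not vanish identically is bounded away from zero near
    some point; shrink the interval in this way once for each function. *)
Lemma zero_or_bounded_subinterval (T : eqType) (s : seq T) (k : T -> R -> R)
    (K a b : R) : a < b ->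
  (forall i x y, i \in s -> a <= x -> x <= y -> y <= b ->
     `|k i y - k i x| <= K * (y - x)) ->
  exists c l r : R, [/\ 0 < c, a <= l, l < r, r <= b &
    forall i, i \in s -> (forall x, l <= x <= r -> k i x = 0) \/
                         (forall x, l <= x <= r -> c <= `|k i x|)].
Proof.
move=> ab; elim: s => [|i s IH] lip; first by exists 1, a, b; split.
have [j x y js|c [l [r [c0 al lr rb h]]]] := IH.
  by apply: lip; rewrite inE js orbT.
have [all0|/existsNP[x /not_implyP[xlr /eqP kx]]] :=
    pselect (forall x, l <= x <= r -> k i x = 0).
  exists c, l, r; split=> // j; rewrite inE => /predU1P[->|/h//]; by left.
have d0 : 0 < `|k i x| by rewrite normr_gt0.
have K1 : 0 < `|K| + 1 by rewrite ltr_wpDl.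
pose e := Num.min ((r - l) / 2) (`|k i x| / 2 / (`|K| + 1)).
have e0 : 0 < e by rewrite lt_min !divr_gt0 // subr_gt0.
have e1 : e <= (r - l) / 2 by rewrite ge_min lexx.
have e2 : e * (`|K| + 1) <= `|k i x| / 2.
  by rewrite -ler_pdivlMr // ge_min lexx orbT.
have [l' [r' [ll' l'r' r'r close]]] : exists l' r', [/\ l <= l', l' < r', r' <= r &
    forall y, l' <= y <= r' -> `|y - x| <= e].
  have [xm|xm] := leP x ((l + r) / 2).
    exists x, (x + e); split; [lra|lra|lra|].
    by move=> y yx; rewrite ger0_norm; lra.
  exists (x - e), x; split; [lra|lra|lra|].
  by move=> y yx; rewrite ler0_norm; lra.
have big y : l' <= y <= r' -> `|k i x| / 2 <= `|k i y|.
  move=> yl; have ye := close _ yl.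
  have : `|k i y - k i x| <= K * `|y - x|.
    have [xy|yx] := leP x y.
      by rewrite (@ger0_norm _ (y - x)) ?subr_ge0// lip ?mem_head//; lra.
    rewrite (@ltr0_norm _ (y - x)) ?subr_lt0// opprB distrC lip ?mem_head//; lra.
  have Ke : K * `|y - x| <= (`|K| + 1) * e.
    apply: le_trans (_ : (`|K| + 1) * `|y - x| <= _).
      by apply: ler_wpM2r => //; rewrite ler_wpDr// ler_norm.
    by apply: ler_wpM2l => //; exact: ltW.
  have : `|k i x| <= `|k i y| + `|k i y - k i x|.
    by rewrite (distrC (k i y)) -{1}(subrKC (k i y) (k i x)) ler_normD.
  by lra.
exists (Num.min c (`|k i x| / 2)), l', r'; split => //; try lra.
  by rewrite lt_min c0; lra.
move=> j; rewrite inE => /predU1P[->|/h[]h0].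
- by right=> y /big; rewrite ge_min => ->; rewrite orbT.
- by left=> y yl; apply: h0; lra.
- by right=> y yl; rewrite ge_min h0//; lra.
Qed.

End Finite.

(** * Ascent systems *)

Definition path_in {R : realType} {E : lmodType R} (N : set E) (p w : E) (T : R) :=
  forall t, 0 <= t <= T -> N (p + t *: w).

Definition ingoing {R : realType} {E : lmodType R} (N : set E) (p w : E) :=
  exists2 e, 0 < e & path_in N p w e.

(** [pts] is a locally finite union of rays: near each of its points [q] it
    consists of finitely many rays that leave [q] in directions taken from
    [dirs], and contains no other stop than possibly [q] ([star]). The labels
    are the places to be served, [util b p] is the benefit of [b] from a sensor
    at [p], and [dutil b p w] its derivative at [p] in the direction [w].
    [util_incr] is the mean value inequality for sums of utilities; it replaces
    any reference to derivatives as limits. [velo_spec] and [velo_inside] say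
    that the velocity of a sensor is the slope of its own cell along an ingoing
    direction, with no choice of the direction outside [stops]. *)
Record ascent_system (R : realType) (m : nat) := AscentSystem {
  space : lmodType R;
  nrm : space -> R;
  pts : set space;
  stops : seq space;
  dirs : seq space;
  label : eqType;
  labels : seq label;
  util : label -> space -> R;
  dutil : label -> space -> space -> R;
  owner : ('I_m -> space) -> label -> 'I_m;
  velo : ('I_m -> space) -> 'I_m -> space;
  lip : R;
  spd : R;
  labels_uniq : uniq labels;
  nrmD : forall x y, nrm (x + y) <= nrm x + nrm y;
  nrmZ : forall t x, nrm (t *: x) = `|t| * nrm x;
  nrm_eq0 : forall x, nrm x = 0 -> x = 0;
  dirs_unit : forall w, w \in dirs -> nrm w = 1;
  dirsN : forall w, w \in dirs -> - w \in dirs;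
  star : forall q, pts q -> exists2 rho, 0 < rho &
    (forall p, pts p -> nrm (p - q) <= rho -> exists w,
       [/\ w \in dirs, p = q + nrm (p - q) *: w & path_in pts q w rho]) /\
    (forall v, v \in stops -> nrm (v - q) <= rho -> v = q);
  run_to_stop : forall p w, pts p -> w \in dirs -> ingoing pts p w ->
    exists T, [/\ 0 < T, p + T *: w \in stops & path_in pts p w T];
  pts_seq_cluster : forall y : nat -> 'I_m -> space, (forall n h, pts (y n h)) ->
    exists q : 'I_m -> space, (forall h, pts (q h)) /\
      forall e n0, 0 < e -> exists2 n, (n0 <= n)%N & forall h, nrm (y n h - q h) < e;
  lip_gt0 : 0 < lip;
  spd_gt0 : 0 < spd;
  dutil_lip : forall b p w T, b \in labels -> w \in dirs -> 0 <= T ->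
    path_in pts p w T -> `|dutil b (p + T *: w) w - dutil b p w| <= lip * T;
  dutilN : forall b p w, dutil b p (- w) = - dutil b p w;
  dutil_le : forall b p w, b \in labels -> pts p -> w \in dirs -> `|dutil b p w| <= spd;
  util_incr : forall (a : pred label) p w T c, w \in dirs -> 0 <= T ->
    path_in pts p w T ->
    (forall t, 0 <= t <= T -> c <= \sum_(b <- labels | a b) dutil b (p + t *: w) w) ->
    c * T <= \sum_(b <- labels | a b) util b (p + T *: w)
           - \sum_(b <- labels | a b) util b p;
  util_bounded : exists B, forall b p, b \in labels -> pts p -> util b p <= B;
  util_quasiconcave : forall b p q t, b \in labels -> 0 <= t <= 1 ->
    Num.min (util b p) (util b q) <= util b (p + t *: (q - p));
  util_monotone : forall b q w, b \in labels -> w \in dirs -> exists2 rho, 0 < rho &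
    (forall s t, 0 <= s -> s <= t -> t <= rho -> util b (q + s *: w) <= util b (q + t *: w)) \/
    (forall s t, 0 <= s -> s <= t -> t <= rho -> util b (q + t *: w) <= util b (q + s *: w));
  owner_best : forall (P : 'I_m -> space) b i, b \in labels ->
    util b (P i) <= util b (P (owner P b));
  velo_spec : forall (P : 'I_m -> space) h, (forall i, pts (P i)) -> velo P h = 0 \/
    exists w v, [/\ w \in dirs, 0 < v, ingoing pts (P h) w, velo P h = v *: w &
      v = \sum_(b <- labels | owner P b == h) dutil b (P h) w];
  velo_inside : forall (P : 'I_m -> space) h w, (forall i, pts (P i)) ->
    P h \notin stops -> w \in dirs -> ingoing pts (P h) w ->
    velo P h = (\sum_(b <- labels | owner P b == h) dutil b (P h) w) *: w
}.

Arguments pts {R m}.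
Arguments stops {R m}.
Arguments dirs {R m}.
Arguments labels {R m}.
Arguments nrm {R m _}.
Arguments util {R m _}.
Arguments dutil {R m _}.
Arguments owner {R m _}.
Arguments velo {R m _}.

Section Basic.
Context {R : realType} {m : nat} (S : ascent_system R m).
Notation E := (space S).
Notation conf := ('I_m -> E).
Notation N := (pts S).
Notation C := (labels S).
Notation W := (dirs S).
Implicit Types (P X Y Z Q : conf) (p q w : E) (a : pred (label S)) (c d s t v e r : R).

Definition on P := forall h, N (P h).
Definition slope a p w := \sum_(b <- C | a b) dutil b p w.
Definition gain a p := \sum_(b <- C | a b) util b p.
Definition cell P h : pred (label S) := fun b => owner P b == h.
Definition objective P := \sum_(b <- C) util b (P (owner P b)).
Notation H := objective.
(** A common Lipschitz constant of the slopes of all the sets of labels, made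
    positive. *)
Definition K := (size C)%:R * lip S + 1.
(** In this time a slope changes by at most half of the initial speed. *)
Definition tau := (2 * K)^-1.

Lemma K_gt0 : 0 < K.
Proof. by rewrite ltr_wpDl// mulr_ge0// ltW// lip_gt0. Qed.

Lemma K_ge_lip : (size C)%:R * lip S <= K.
Proof. by rewrite lerDl. Qed.

Lemma tau_gt0 : 0 < tau.
Proof. by rewrite invr_gt0 mulr_gt0// K_gt0. Qed.

Lemma K_tau : K * tau = 2^-1.
Proof. by rewrite /tau invfM mulrCA mulfV ?mulr1// gt_eqF// K_gt0. Qed.

Lemma nrm0 : nrm (0 : E) = 0.
Proof. by rewrite -(scale0r 0) nrmZ normr0 mul0r. Qed.

Lemma nrmN (x : E) : nrm (- x) = nrm x.
Proof. by rewrite -scaleN1r nrmZ normrN1 mul1r. Qed.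

Lemma nrm_ge0 (x : E) : 0 <= nrm x.
Proof.
have := nrmD x (- x); rewrite subrr nrm0 nrmN => h.
by rewrite -(@pmulr_rge0 _ 2)// mulr_natl mulr2n.
Qed.

Lemma nrmB_sym (x y : E) : nrm (x - y) = nrm (y - x).
Proof. by rewrite -nrmN opprB. Qed.

Lemma nrm_dir w t : w \in W -> nrm (t *: w) = `|t|.
Proof. by move=> wW; rewrite nrmZ dirs_unit// mulr1. Qed.

Lemma nrm_ray q w t : w \in W -> nrm (q + t *: w - q) = `|t|.
Proof. by move=> wW; rewrite addrC addKr nrm_dir. Qed.

Lemma dir_inj w w' t : 0 < t -> t *: w = t *: w' -> w = w'.
Proof. by move=> t0; apply: scalerI; rewrite gt_eqF. Qed.

Lemma slopeN a p w : slope a p (- w) = - slope a p w.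
Proof. by rewrite /slope -sumrN; apply: eq_bigr => b _; rewrite dutilN. Qed.

Lemma slope_lip a p w t : w \in W -> 0 <= t -> path_in N p w t ->
  `|slope a (p + t *: w) w - slope a p w| <= K * t.
Proof.
move=> wW t0 pw; rewrite /slope -sumrB.
apply: (@le_trans _ _ ((size C)%:R * (lip S * t))).
  apply: norm_sum_filter_le; first by rewrite mulr_ge0// ltW// lip_gt0.
  by move=> b bC; exact: dutil_lip.
by rewrite mulrA ler_wpM2r// K_ge_lip.
Qed.

Lemma slope_le a p w : N p -> w \in W -> `|slope a p w| <= (size C)%:R * spd S.
Proof.
move=> Np wW; apply: norm_sum_filter_le; first by rewrite ltW// spd_gt0.
by move=> b bC; exact: dutil_le.
Qed.

Lemma gain_ge a p w t c : w \in W -> 0 <= t -> path_in N p w t ->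
  (forall s, 0 <= s <= t -> c <= slope a (p + s *: w) w) ->
  c * t <= gain a (p + t *: w) - gain a p.
Proof. by move=> *; exact: util_incr. Qed.

Lemma path_in_rev p w t : path_in N p w t -> path_in N (p + t *: w) (- w) t.
Proof.
by move=> pw s st; rewrite scalerN -addrA -scalerBl; apply: pw; lra.
Qed.

Lemma path_in_sub p w t s : path_in N p w t -> s <= t -> path_in N p w s.
Proof. by move=> pw st r rs; apply: pw; lra. Qed.

Lemma path_in_shift p w t s : path_in N p w t -> 0 <= s ->
  path_in N (p + s *: w) w (t - s).
Proof. by move=> pw s0 r rs; rewrite -addrA -scalerDl; apply: pw; lra. Qed.

Lemma gain_le a p w t c : w \in W -> 0 <= t -> path_in N p w t ->
  (forall s, 0 <= s <= t -> slope a (p + s *: w) w <= c) ->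
  gain a (p + t *: w) - gain a p <= c * t.
Proof.
move=> wW t0 pw sl.
have := @gain_ge a (p + t *: w) (- w) t (- c) (dirsN wW) t0 (path_in_rev pw).
rewrite scalerN addrK mulNr lerNl opprB; apply=> s st.
by rewrite slopeN lerN2 scalerN -addrA -scalerBl sl//; lra.
Qed.

Lemma gain1 b p : b \in C -> gain (pred1 b) p = util b p.
Proof.
move=> bC; rewrite /gain (big_rem b)//= eqxx big_seq_cond big1 ?addr0// => c.
by rewrite mem_rem_uniq ?labels_uniq// !inE => /andP[/andP[/negPf->]].
Qed.

Lemma slope1 b p w : b \in C -> slope (pred1 b) p w = dutil b p w.
Proof.
move=> bC; rewrite /slope (big_rem b)//= eqxx big_seq_cond big1 ?addr0// => c.
by rewrite mem_rem_uniq ?labels_uniq// !inE => /andP[/andP[/negPf->]].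
Qed.

(* First-order bound with the Lipschitz constant as remainder. *)
Lemma gain_taylor a p w t : w \in W -> 0 <= t -> path_in N p w t ->
  `|gain a (p + t *: w) - gain a p - t * slope a p w| <= K * t ^+ 2.
Proof.
move=> wW t0 pw.
have K0 := K_gt0.
have sl s : 0 <= s <= t -> `|slope a (p + s *: w) w - slope a p w| <= K * t.
  move=> st; apply: (le_trans (slope_lip _ wW _ _)).
  - by lra.
  - by apply: (path_in_sub pw); lra.
  - by rewrite ler_pM2l//; lra.
have lo := @gain_ge a p w t (slope a p w - K * t) wW t0 pw.
have up := @gain_le a p w t (slope a p w + K * t) wW t0 pw.
have {}lo : (slope a p w - K * t) * t <= gain a (p + t *: w) - gain a p.
  by apply: lo => s /sl; rewrite ler_norml; lra.
have {}up : gain a (p + t *: w) - gain a p <= (slope a p w + K * t) * t.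
  by apply: up => s /sl; rewrite ler_norml; lra.
by rewrite ler_norml expr2 mulrA; lra.
Qed.

Lemma util_taylor b p w t : b \in C -> w \in W -> 0 <= t -> path_in N p w t ->
  `|util b (p + t *: w) - util b p - t * dutil b p w| <= K * t ^+ 2.
Proof.
by move=> bC wW t0 pw; rewrite -!(gain1 _ bC) -(slope1 _ _ bC) gain_taylor.
Qed.

Lemma util_lip b p w t : b \in C -> w \in W -> 0 <= t -> path_in N p w t ->
  `|util b (p + t *: w) - util b p| <= spd S * t.
Proof.
move=> bC wW t0 pw; rewrite -!(gain1 _ bC).
have sl s : 0 <= s <= t -> `|slope (pred1 b) (p + s *: w) w| <= spd S.
  by move=> st; rewrite slope1// dutil_le//; apply: pw; lra.
rewrite ler_norml; apply/andP; split.
  by rewrite -mulNr; apply: gain_ge => // s /sl; rewrite ler_norml => /andP[].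
by apply: gain_le => // s /sl; rewrite ler_norml => /andP[].
Qed.

Lemma partition_owner P (F : label S -> 'I_m -> R) :
  \sum_(b <- C) F b (owner P b) = \sum_h \sum_(b <- C | cell P h b) F b h.
Proof.
rewrite (exchange_big_dep predT)//=; apply: eq_bigr => b _.
by rewrite big_pred1_eq || (rewrite (big_pred1 (owner P b))// => h; rewrite /= /cell eq_sym).
Qed.

Lemma objectiveE P : H P = \sum_h gain (cell P h) (P h).
Proof. exact: (partition_owner P (fun b h => util b (P h))). Qed.

(** With the cells of another configuration the labels are served no better, and
    the objective becomes a sum of functions of the single sensors. *)
Lemma objective_ge P X : \sum_h gain (cell P h) (X h) <= H X.
Proof.
rewrite -(partition_owner P (fun b h => util b (X h))) /H big_seq [leRHS]big_seq.
by apply: ler_sum => b bC; exact: owner_best.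
Qed.

Lemma objective_bounded : exists B, forall P, on P -> H P <= B.
Proof.
have [B uB] := util_bounded S.
exists (\sum_(b <- C) B) => P Pon; rewrite /H big_seq [leRHS]big_seq.
by apply: ler_sum => b bC; exact: uB.
Qed.

End Basic.

(** * Steps *)

Section Moves.
Context {R : realType} {m : nat} {S : ascent_system R m}.
Notation E := (space S).
Notation conf := ('I_m -> E).
Notation N := (pts S).
Notation W := (dirs S).
Notation H := (@objective R m S).
Implicit Types (P X Y Z Q : conf) (p q w : E) (a : pred (label S)) (c d s t v e r : R).

Definition advance P (t : 'I_m -> R) : conf := fun h => P h + t h *: velo P h.
Definition next P (d : R) : conf := advance P (fun=> d).

(** Stops are allowed at both ends of the move, but not inside it. *)
Definition clear P h d := path_in N (P h) (velo P h) d /\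
  forall t, 0 < t < d -> velo P h != 0 -> P h + t *: velo P h \notin stops S.

Definition safe P d := 0 < d <= tau S /\ forall h, clear P h d.

Definition hits P h d := velo P h != 0 /\ next P d h \in stops S.

Definition full P d := safe P d /\ (d = tau S \/ exists h, hits P h d).

Lemma path_in_scale p w v d : 0 < v -> path_in N p (v *: w) d -> path_in N p w (v * d).
Proof.
move=> v0 pw t /andP[t0 td]; have := pw (t / v).
rewrite scalerA divfK ?gt_eqF//; apply; rewrite divr_ge0 ?(ltW v0)//=.
by rewrite ler_pdivrMr// mulrC.
Qed.

(** The choice of [tau]: the cell of [P] keeps at least half of its slope during
    the step. *)
Lemma safe_slope P d h w v t : on P -> safe P d -> w \in W ->
    velo P h = v *: w -> 0 <= t <= d ->
  `|slope (cell P h) (P h + t *: velo P h) w - slope (cell P h) (P h) w| <= `|v| / 2.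
Proof.
move=> Pon [/andP[d0 dt] /(_ h)[pth _]] wW Dv /andP[t0 td].
have K0 := K_gt0 S.
have [v0|v0] := eqVneq v 0; first by rewrite Dv v0 scale0r scaler0 addr0 subrr normr0 mul0r.
wlog vgt : w v wW Dv v0 / 0 < v => [wl|].
  have [vgt|vle] := ltP 0 v; first exact: wl.
  have := wl (- w) (- v) (dirsN wW); rewrite !slopeN -opprD normrN normrN scalerN scaleNr opprK.
  by apply=> //; rewrite ?oppr_eq0// oppr_gt0 lt_neqAle v0.
have pw : path_in N (P h) w (v * t).
  by apply: path_in_scale => //; rewrite -Dv; exact: path_in_sub pth td.
rewrite Dv scalerA mulrC; apply: (le_trans (slope_lip _ wW _ pw)).
  by rewrite mulr_ge0// ltW.
rewrite gtr0_norm// mulrCA ler_wpM2l ?(ltW vgt)// -(K_tau S) ler_pM2l//.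
exact: le_trans dt.
Qed.

Lemma safe_gain P d h t1 t2 : on P -> safe P d -> 0 <= t1 -> t1 <= t2 -> t2 <= d ->
  (t2 - t1) / 2 * nrm (velo P h) ^+ 2 <=
  gain (cell P h) (P h + t2 *: velo P h) - gain (cell P h) (P h + t1 *: velo P h).
Proof.
move=> Pon sf t10 t12 t2d.
have [->|[w [v [wW v0 _ Dv sl]]]] := velo_spec h Pon.
  by rewrite nrm0 expr0n mulr0 !scaler0 subrr.
have {}sl : slope (cell P h) (P h) w = v by rewrite [RHS]sl.
have pth : path_in N (P h) (velo P h) d by case: sf => _ /(_ h)[].
have pw : path_in N (P h) w (v * d).
  by apply: path_in_scale => //; rewrite -Dv.
have e : P h + t2 *: velo P h = P h + t1 *: velo P h + (v * (t2 - t1)) *: w.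
  by rewrite Dv !scalerA -addrA -scalerDl; congr (_ + _ *: _); lra.
rewrite e Dv nrm_dir// gtr0_norm//.
have -> : (t2 - t1) / 2 * v ^+ 2 = v / 2 * (v * (t2 - t1)) by rewrite expr2; lra.
apply: gain_ge => //.
- by apply: mulr_ge0; lra.
- rewrite scalerA; apply: (path_in_sub (path_in_shift pw _)).
    by rewrite mulr_ge0// ltW.
  by rewrite [t1 * v]mulrC -mulrBr ler_pM2l//; lra.
move=> s /andP[s0 st].
have := @safe_slope P d h w v (t1 + s / v) Pon sf wW Dv.
rewrite Dv (gtr0_norm v0) sl scalerDl scalerA (scalerA (s / v)) divfK ?gt_eqF// addrA.
have : 0 <= s / v <= t2 - t1.
  by rewrite divr_ge0 ?(ltW v0)//= ler_pdivrMr// mulrC.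
move=> sv; move=> /(_ _)/wrap[]; first by lra.
by rewrite ler_norml; lra.
Qed.

Lemma safe_objective P d (t : 'I_m -> R) : on P -> safe P d -> (forall h, 0 <= t h <= d) ->
  H P + \sum_h t h / 2 * nrm (velo P h) ^+ 2 <= H (advance P t).
Proof.
move=> Pon sf td; apply: le_trans (objective_ge P _); rewrite objectiveE -big_split/=.
apply: ler_sum => h _; have /andP[t0 t1] := td h.
by have := safe_gain h Pon sf (lexx 0) t0 t1; rewrite scale0r addr0 subr0 /advance; lra.
Qed.

Lemma min_of_seq (x : R) (s : seq R) : exists2 y, y \in x :: s &
  forall z, z \in x :: s -> y <= z.
Proof.
elim: s x => [|x' s IH] x.
  by exists x; rewrite ?mem_head// => z; rewrite inE => /eqP->.
have [y ys ymin] := IH x'; have [xy|/ltW yx] := leP x y.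
  exists x; rewrite ?mem_head// => z; rewrite inE => /predU1P[->//|/ymin].
  exact: le_trans.
exists y; first by rewrite inE ys orbT.
by move=> z; rewrite inE => /predU1P[->//|/ymin].
Qed.

(** A sensor that moves meets a stop, because its ray reaches one inside the
    network; take the first one. *)
Lemma clear_ex P h : on P -> exists2 d, 0 < d & clear P h d /\ (velo P h = 0 \/ hits P h d).
Proof.
move=> Pon; have [D0|[w [v [wW v0 ing Dv _]]]] := velo_spec h Pon.
  exists 1 => //; split; last by left.
  by split=> t; rewrite D0 ?eqxx// scaler0 addr0.
have [T [T0 Tst pT]] := run_to_stop (Pon h) wW ing.
pose time (x : E) := nrm (x - P h).
pose s := [seq time x | x <- stops S & (0 < time x) && (x == P h + time x *: w)].
have timeE t : 0 < t -> time (P h + t *: w) = t.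
  by move=> t0; rewrite /time nrm_ray// gtr0_norm.
have Ts : T \in s.
  apply/mapP; exists (P h + T *: w : E); last by rewrite timeE.
  by rewrite mem_filter timeE// T0 eqxx.
case: {-1}s (erefl s) => [|x0 s' es]; first by move=> es; move: Ts; rewrite es.
have [d] := min_of_seq x0 s'; rewrite -es => /mapP[x].
rewrite mem_filter => /andP[/andP[x_gt0 /eqP xE] xst] dE dmin.
have d0 : 0 < d by rewrite dE.
have pd : path_in N (P h) w d by apply: path_in_sub pT _; exact: dmin.
exists (d / v); first by rewrite divr_gt0.
have Dn0 : velo P h != 0.
  by apply/eqP => D0; move: (v0); rewrite -(gtr0_norm v0) -(nrm_dir v wW) -Dv D0 nrm0 ltxx.
split; last by right; split=> //; rewrite /next /advance Dv scalerA divfK ?gt_eqF// dE -xE.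
split=> [t /andP[t0 td]|t /andP[t0 td] _].
  rewrite Dv scalerA; apply: pd; rewrite mulr_ge0 ?(ltW v0)//=.
  by rewrite -ler_pdivlMr.
rewrite Dv scalerA; apply/negP => tst.
have tv0 : 0 < t * v by rewrite mulr_gt0.
have : d <= t * v.
  by apply: dmin; apply/mapP; exists (P h + (t * v) *: w); rewrite ?timeE// mem_filter timeE// tv0 eqxx.
by apply/negP; rewrite -ltNge -ltr_pdivlMr.
Qed.

Lemma clear_sub P h d d' : clear P h d -> d' <= d -> clear P h d'.
Proof.
move=> [pth nst] dd; split; first exact: path_in_sub pth dd.
by move=> t td; apply: nst; lra.
Qed.

(** The smallest of [tau] and of the times at which the sensors meet a stop. *)
Lemma full_ex P : on P -> exists d, full P d.
Proof.
move=> Pon.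
suff [d d0 [dc dh]] : exists2 d, 0 < d <= tau S &
    (forall h, h \in enum 'I_m -> clear P h d) /\ (d = tau S \/ exists h, hits P h d).
  exists d; split=> //; split=> // h; apply: dc; exact: mem_enum.
elim: (enum 'I_m) => [|h s [d dt [dc dh]]].
  by exists (tau S); rewrite ?tau_gt0 ?lexx//; split=> //; left.
have [e e0 [ec eh]] := clear_ex h Pon.
have [de|ed] := leP d e.
  exists d => //; split=> // h'; rewrite inE => /predU1P[->|/dc//].
  exact: clear_sub de.
have [D0|D0] := eqVneq (velo P h) 0.
  exists d => //; split=> // h'; rewrite inE => /predU1P[->|/dc//].
  by split=> t; rewrite D0 ?eqxx// scaler0 addr0.
case: eh => [/eqP|eh]; first by rewrite (negPf D0).
exists e; first by lra.
split; last by right; exists h.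
by move=> h'; rewrite inE => /predU1P[->//|/dc c]; apply: clear_sub c _; exact: ltW.
Qed.

(** Unlike a safe step it may be long, and it can be cut short at any time. *)
Definition boxed P d := [/\ 0 < d, forall h, path_in N (P h) (velo P h) d &
  forall t : 'I_m -> R, (forall h, 0 <= t h <= d) -> H P <= H (advance P t)].

Lemma safe_boxed P d : on P -> safe P d -> boxed P d.
Proof.
move=> Pon sf; have [/andP[d0 _] cl] := sf; split=> // [h|t td]; first by case: (cl h).
apply: le_trans (safe_objective Pon sf td); rewrite lerDl sumr_ge0// => h _.
by rewrite mulr_ge0 ?exprn_ge0 ?nrm_ge0// divr_ge0//; have /andP[] := td h.
Qed.

Definition length P d := d * \sum_h nrm (velo P h).

(** The real index is the total length of the boxed steps. Safe steps are not
    counted, since what they cover is paid by their gain, see [confined]. *)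
Inductive reach P : R -> conf -> Prop :=
| reach_refl : reach P 0 P
| reach_safe c X d : reach P c X -> safe X d -> reach P c (next X d)
| reach_boxed c X d : reach P c X -> boxed X d -> reach P (c + length X d) (next X d).

Lemma boxed_on P d : on P -> boxed P d -> on (next P d).
Proof. by move=> Pon [d0 pth _] h; apply: pth; rewrite lexx ltW. Qed.

Lemma boxed_le P d : boxed P d -> H P <= H (next P d).
Proof. by case=> d0 _; apply=> h; rewrite lexx ltW. Qed.

Lemma length_ge0 P d : 0 <= d -> 0 <= length P d.
Proof. by move=> d0; rewrite mulr_ge0// sumr_ge0// => h _; exact: nrm_ge0. Qed.

Lemma reach_facts P c X : on P -> reach P c X -> [/\ on X, 0 <= c & H P <= H X].
Proof.
move=> Pon; elim=> {c X} [|c X d _ [Xon c0 PX] sf|c X d _ [Xon c0 PX] bx]; first by split.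
  have bx := safe_boxed Xon sf; split=> //; first exact: boxed_on bx.
  exact: le_trans (boxed_le bx).
split; [exact: boxed_on bx| |exact: le_trans (boxed_le bx)].
by rewrite addr_ge0// length_ge0//; case: bx => /ltW.
Qed.

Lemma reach_trans P c X c' Y : reach P c X -> reach X c' Y -> reach P (c + c') Y.
Proof.
move=> PX; elim=> {c' Y} [|c' Y d _ IH sf|c' Y d _ IH bx]; first by rewrite addr0.
  exact: reach_safe.
by rewrite addrA; exact: reach_boxed.
Qed.

End Moves.

(** * Rays and confinement *)

Section Confinement.
Context {R : realType} {m : nat} {S : ascent_system R m}.
Notation E := (space S).
Notation conf := ('I_m -> E).
Notation N := (pts S).
Notation C := (labels S).
Notation W := (dirs S).
Notation H := (@objective R m S).
Implicit Types (P X Y Z Q : conf) (p q w : E) (a : pred (label S)) (c d s t v e r rho : R).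

(** The property of [star], with the radius as a parameter. *)
Definition is_star q rho :=
  (forall p, N p -> nrm (p - q) <= rho -> exists w,
     [/\ w \in W, p = q + nrm (p - q) *: w & path_in N q w rho]) /\
  (forall p, p \in stops S -> nrm (p - q) <= rho -> p = q).

Lemma is_star_sub q rho e : is_star q rho -> e <= rho -> is_star q e.
Proof.
move=> [st vx] er; split=> [p Np pe|v vS ve]; last by apply: vx => //; exact: le_trans er.
have [w [wW pw pth]] := st p Np (le_trans pe er).
by exists w; split=> //; exact: path_in_sub pth er.
Qed.

Lemma star_conf Q : on Q -> exists2 rho, 0 < rho & forall h, is_star (Q h) rho.
Proof.
move=> Qon.
have [x e e' _ ee st|h _|e e0 h] :=
  @small_forall_seq R _ (enum 'I_m) (fun h e => is_star (Q h) e).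
- exact: is_star_sub st ee.
- by have [rho rho0 st] := star (Qon h); exists rho.
by exists e => // i; apply: h; rewrite mem_enum.
Qed.

(** Near [Q] a sensor moves along a ray that starts at its place in [Q]; the
    coordinate on that ray is its distance to that place. *)
Lemma ray_form Q rho P h : on Q -> on P -> 0 < rho -> is_star (Q h) rho ->
  nrm (P h - Q h) < rho -> exists w v,
  [/\ w \in W, P h = Q h + nrm (P h - Q h) *: w, path_in N (Q h) w rho,
      velo P h = v *: w &
      (P h <> Q h \/ v != 0 -> slope (cell P h) (P h) w = v) /\
      (P h = Q h -> 0 <= v)].
Proof.
move=> Qon Pon rho0 [st vx] near.
have [w [wW Pw pth]] := st _ (Pon h) (ltW near).
set s := nrm (P h - Q h) in near Pw *.
have [s0|s0] := eqVneq s 0.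
  have PQ : P h = Q h by rewrite Pw s0 scale0r addr0.
  have [D0|[w' [v [w'W v0 [e e0 pe] Dv sl]]]] := velo_spec h Pon.
    exists w, 0; split=> //; first by rewrite scale0r.
    by split=> // -[/(_ PQ)|/eqP].
  have f0 : 0 < Num.min e rho by rewrite lt_min e0.
  have fe : Num.min e rho <= e by rewrite ge_min lexx.
  have fr : Num.min e rho <= rho by rewrite ge_min lexx orbT.
  have Np : N (Q h + Num.min e rho *: w') by rewrite -PQ; apply: pe; rewrite fe ltW.
  have := st _ Np; rewrite nrm_ray// gtr0_norm// => /(_ fr)[w2 [w2W /addrI ww pw2]].
  have {}ww := dir_inj f0 ww; subst w2.
  exists w', v; split=> //; first by rewrite s0 scale0r addr0.
  by split=> _; [rewrite [RHS]sl|exact: ltW].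
have sgt : 0 < s by rewrite lt_neqAle eq_sym s0 nrm_ge0.
have nst : P h \notin stops S.
  apply/negP => Pst; move: s0; rewrite /s (vx _ Pst (ltW near)) subrr nrm0.
  by rewrite eqxx.
have ing : ingoing N (P h) w.
  exists (rho - s); first by rewrite subr_gt0.
  by rewrite {1}Pw; apply: path_in_shift => //; exact: ltW.
exists w, (slope (cell P h) (P h) w); split=> //; first exact: velo_inside.
split=> // PQ; move: s0; rewrite /s PQ subrr nrm0 eqxx//.
Qed.

(** The sets of labels, indexed by a finite type. *)
Definition tpred (t : (size C).-tuple bool) : pred (label S) := mem (mask t C).

Lemma slope_tpred a : exists t : (size C).-tuple bool, forall p w, slope a p w = slope (tpred t) p w.
Proof.
exists [tuple of map a (in_tuple C)] => p w; rewrite /slope big_seq_cond [RHS]big_seq_cond.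
apply: eq_bigl => b; rewrite /tpred /= -filter_mask mem_filter.
by case: (b \in C); rewrite ?andbF// andbT.
Qed.

(** Only finitely many slopes, one for each set of labels and each ray, occur on
    an annulus around [Q], so that a thinner annulus suits all of them. *)
Lemma sparse_annulus Q rho b : on Q -> 0 < b -> b <= rho ->
  exists c l r, [/\ 0 < c, b / 2 <= l, l < r, r <= b &
    forall h w a, w \in W -> path_in N (Q h) w rho ->
      (forall t, l <= t <= r -> slope a (Q h + t *: w) w = 0) \/
      (forall t, l <= t <= r -> c <= `|slope a (Q h + t *: w) w|)].
Proof.
move=> Qon b0 brho.
pose I : eqType := ((size C).-tuple bool * E * 'I_m)%type.
pose s : seq I := [seq i <- [seq (tw, h) | tw <- [seq (k, w) | k <- enum {: (size C).-tuple bool}, w <- W],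
   h <- enum 'I_m] | `[< path_in N (Q i.2) i.1.2 rho >] ].
have inW (i : I) : i \in s -> i.1.2 \in W /\ path_in N (Q i.2) i.1.2 rho.
  rewrite mem_filter => /andP[/asboolP pth /allpairsP[[tw h] [twin _ ie]]].
  by move: twin pth; rewrite ie => /allpairsP[[k w] [_ wW ->]].
have [||c [l [r [c0 bl lr rb dich]]]] := @zero_or_bounded_subinterval R I s
  (fun i t => slope (tpred i.1.1) (Q i.2 + t *: i.1.2) i.1.2) (K S) (b / 2) b.
- by lra.
- move=> i x y /inW[iW pth] bx xy yb.
  have -> : Q i.2 + y *: i.1.2 = Q i.2 + x *: i.1.2 + (y - x) *: i.1.2.
    by rewrite -addrA -scalerDl addrCA subrr addr0.
  apply: slope_lip => //; first by lra.
  by apply: path_in_sub (path_in_shift pth _) _; lra.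
exists c, l, r; split=> // h' w a wW pth.
have [t ta] := slope_tpred a.
have : (t, w, h') \in s.
  rewrite mem_filter /=; apply/andP; split; first exact/asboolP.
  apply/allpairsP; exists ((t, w), h'); split=> //=; last by rewrite mem_enum.
  by apply/allpairsP; exists (t, w); split=> //=; rewrite mem_enum.
by case/dich => /= h0; [left|right] => x xlr; rewrite ta; exact: h0.
Qed.

Lemma next_dist P d h : 0 <= d -> nrm (next P d h - P h) = d * nrm (velo P h).
Proof. by move=> d0; rewrite /next /advance addrC addKr nrmZ ger0_norm. Qed.

(** The position of a radial coordinate relative to an annulus; it records how
    much of the annulus has been crossed. *)
Definition clip l r x : R := Num.max l (Num.min r x).

Lemma clip_le (l r x y e : R) : 0 <= e -> y <= x + e -> clip l r y <= clip l r x + e.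
Proof.
move=> e0 yx; rewrite /clip ge_max; apply/andP; split.
  by rewrite ler_wpDr// le_max lexx.
rewrite -lerBlDr le_max; apply/orP; right.
rewrite le_min !lerBlDr; apply/andP; split.
  by rewrite ge_min ler_wpDr.
by rewrite ge_min yx orbT.
Qed.

Lemma clip_ub l r (x : R) : l <= r -> clip l r x <= r.
Proof. by move=> lr; rewrite /clip ge_max lr ge_min lexx. Qed.

Lemma clip_far l r (x : R) : l <= r -> r <= x -> clip l r x = r.
Proof. by move=> lr rx; rewrite /clip (min_idPl rx) (max_idPr lr). Qed.

Lemma clip_near l r (x : R) : x <= l -> clip l r x = l.
Proof. by move=> xl; apply/max_idPl; rewrite ge_min xl orbT. Qed.

Lemma clip_dist_le (l r : R) q p p' :
  clip l r (nrm (p' - q)) <= clip l r (nrm (p - q)) + nrm (p' - p).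
Proof.
apply: clip_le; first exact: nrm_ge0.
have -> : p' - q = (p' - p) + (p - q) by rewrite addrA subrK.
by rewrite [leRHS]addrC nrmD.
Qed.

(** The radial coordinate of a sensor can only increase at a cost: where the
    slope along a ray does not vanish it is bounded below, and a sensor does
    not move where its slope vanishes. *)
Lemma safe_clip_le Q rho c l r P h d : on Q -> 0 < rho -> is_star (Q h) rho ->
    0 < c -> 0 < l -> l < r -> r <= rho ->
    (forall w a, w \in W -> path_in N (Q h) w rho ->
      (forall t, l <= t <= r -> slope a (Q h + t *: w) w = 0) \/
      (forall t, l <= t <= r -> c <= `|slope a (Q h + t *: w) w|)) ->
    on P -> safe P d ->
  c / 4 * (clip l r (nrm (next P d h - Q h)) - clip l r (nrm (P h - Q h)))
    <= H (next P d) - H P.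
Proof.
move=> Qon rho0 st c0 l0 lr rrho dich Pon sf.
have Hle := boxed_le (safe_boxed Pon sf).
have [up|up] := leP (clip l r (nrm (next P d h - Q h))) (clip l r (nrm (P h - Q h))).
  by apply: (@le_trans _ _ 0); rewrite ?subr_ge0// pmulr_rle0 ?subr_le0// divr_gt0.
have [/andP[d0 _] cl] := sf.
have near : nrm (P h - Q h) < r.
  rewrite ltNge; apply/negP => rs; move: up.
  by rewrite (clip_far (ltW lr) rs) ltNge clip_ub// ltW.
have [w [v [wW Pw pw Dv [sl _]]]] := ray_form Qon Pon rho0 st (lt_le_trans near rrho).
have {}sl : v != 0 -> slope (cell P h) (P h) w = v by move=> v0; apply: sl; right.
set s := nrm (P h - Q h) in near Pw up *.
have s0 : 0 <= s by exact: nrm_ge0.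
have v0 : v != 0.
  apply/eqP => v0; move: up; rewrite /next /advance Dv v0 scale0r scaler0 addr0.
  by rewrite ltxx.
have nE : next P d h = Q h + (s + d * v) *: w.
  by rewrite /next /advance Dv {1}Pw scalerA -addrA -scalerDl.
have nz w' t : w' \in W -> path_in N (Q h) w' rho -> l <= t <= r ->
    slope (cell P h) (Q h + t *: w') w' != 0 -> c <= `|slope (cell P h) (Q h + t *: w') w'|.
  move=> w'W pw' tlr; case: (dich w' (cell P h) w'W pw') => h0; last by move=> _; exact: h0.
  by rewrite h0// eqxx.
have ds t : 0 <= t <= d ->
    `|slope (cell P h) (Q h + (s + t * v) *: w) w - v| <= `|v| / 2.
  move=> td; have := safe_slope Pon sf wW Dv td; rewrite (sl v0).
  by rewrite Dv {1}Pw scalerA -addrA -scalerDl.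
have nv0 : 0 < `|v| by rewrite normr_gt0.
have vbig : c / 2 <= `|v|.
  have aux w' t : w' \in W -> path_in N (Q h) w' rho -> l <= t <= r ->
      `|slope (cell P h) (Q h + t *: w') w'| <= `|v| + `|v| / 2 ->
      0 < `|slope (cell P h) (Q h + t *: w') w'| -> c / 2 <= `|v|.
    by move=> w'W pw' tlr le1 gt0; have := nz w' t w'W pw' tlr; rewrite -normr_gt0 => /(_ gt0); lra.
  have [ls|sl'] := leP l s.
    have := nz w s wW pw; rewrite -Pw (sl v0) ls (ltW near) => /(_ isT v0); lra.
  have nfar : l < nrm (next P d h - Q h).
    rewrite ltNge; apply/negP => near'; move: up.
    by rewrite (clip_near _ near') clip_near ?ltxx// ltW.
  rewrite nE nrm_ray// in nfar.
  have [vgt|vle] := ltP 0 v.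
    have tl : 0 <= (l - s) / v <= d.
      rewrite divr_ge0 ?(ltW vgt)//=; last by lra.
      rewrite ler_pdivrMr//; move: nfar; rewrite ger0_norm; first lra.
      by rewrite addr_ge0// mulr_ge0// ltW.
    have := ds _ tl; rewrite divfK// subrKC => ds1; rewrite (gtr0_norm vgt) in ds1.
    apply: (aux w l) => //; [by lra| |].
      by rewrite (gtr0_norm vgt) ler_norml; move: ds1; rewrite ler_norml; lra.
    by rewrite normr_gt0 gt_eqF//; move: ds1; rewrite ler_norml; lra.
  have vlt : v < 0 by rewrite lt_neqAle v0.
  have tl : 0 <= (s + l) / (- v) <= d.
    rewrite divr_ge0//=; try lra.
    rewrite ler_pdivrMr; last by lra.
    have dv : d * v <= 0 by rewrite nmulr_lle0 ?ltW.
    by move: nfar; rewrite ltr_normr => /orP[]; lra.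
  have := ds _ tl; have -> : s + (s + l) / (- v) * v = - l.
    by rewrite invrN mulrN mulNr divfK//; lra.
  move=> ds1; rewrite (ltr0_norm vlt) in ds1.
  have Np : N (Q h + l *: (- w)).
    have [pth _] := cl h; have := pth _ tl; rewrite Dv {1}Pw scalerA -addrA -scalerDl.
    by rewrite invrN mulrN mulNr divfK// opprD addrA subrr sub0r scalerN scaleNr.
  have lrho : l <= rho by lra.
  have := st.1 _ Np; rewrite nrm_ray ?dirsN// gtr0_norm// => /(_ lrho)[w2 [w2W /addrI ww pw2]].
  have {}ww := dir_inj l0 ww; subst w2.
  apply: (aux (- w) l) => //; first by lra.
    rewrite slopeN normrN scalerN -scaleNr (ltr0_norm vlt) ler_norml.
    by move: ds1; rewrite ler_norml; lra.
  rewrite slopeN normrN scalerN -scaleNr normr_gt0 lt_eqF//.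
  by move: ds1; rewrite ler_norml; lra.
have := @safe_objective R m S P d (fun=> d) Pon sf; rewrite -/(next P d) => big.
have {}big : d / 2 * `|v| ^+ 2 <= H (next P d) - H P.
  rewrite lerBrDl; apply: le_trans (big _); last by move=> _; rewrite lexx ltW.
  rewrite lerD2l (bigD1 h)//= Dv nrm_dir// lerDl sumr_ge0// => i _.
  by rewrite mulr_ge0 ?exprn_ge0 ?nrm_ge0// divr_ge0// ltW.
have : clip l r (nrm (next P d h - Q h)) - clip l r s <= d * `|v|.
  rewrite lerBlDl; apply: le_trans (clip_dist_le _ _ _ (P h) _) _.
  by rewrite lerD2l next_dist ?(ltW d0)// Dv nrm_dir.
move=> cle; apply: le_trans big.
apply: (@le_trans _ _ (c / 4 * (d * `|v|))).
  by rewrite ler_pM2l// divr_gt0.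
have -> : c / 4 * (d * `|v|) = d / 2 * `|v| * (c / 2) by lra.
by rewrite expr2 [leRHS]mulrA ler_wpM2l// mulr_ge0// ltW// divr_gt0.
Qed.

(** Crossing the annulus of [sparse_annulus] costs a definite amount: with safe
    steps it is a gain, by [safe_clip_le], and with boxed steps it is a length. *)
Lemma confined Q (b : R) : on Q -> 0 < b -> exists e om lam : R,
  [/\ 0 < e, 0 < om, 0 < lam & forall P c X, on P -> reach P c X ->
    (forall h, nrm (P h - Q h) <= e) -> c <= lam -> H X - H P <= om ->
    forall h, nrm (X h - Q h) <= b].
Proof.
move=> Qon b0; have [rho rho0 st] := star_conf Qon.
pose b' := Num.min b rho.
have b'0 : 0 < b' by rewrite lt_min b0.
have b'b : b' <= b by rewrite ge_min lexx.
have b'r : b' <= rho by rewrite ge_min lexx orbT.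
have [k [l [r [k0 bl lr rb dich]]]] := sparse_annulus Qon b'0 b'r.
have l0 : 0 < l by lra.
exists (b' / 2), (k / 4 * ((r - l) / 4)), ((r - l) / 4).
split; try by rewrite ?mulr_gt0//; lra.
move=> P c X Pon PX Pa clam Hom h.
pose th Y := clip l r (nrm (Y h - Q h)).
have thX : k / 4 * (th X - th P) <= H X - H P + k / 4 * c.
  elim: PX {clam Hom} => {c X} [|c X d PX IH sf|c X d PX IH bx].
  - by rewrite !subrr !mulr0 addr0.
  - have [Xon _ _] := reach_facts Pon PX.
    have := safe_clip_le Qon rho0 (st h) k0 l0 lr (le_trans rb b'r)
      (fun w a => @dich h w a) Xon sf.
    by move: IH; rewrite /th; lra.
  have [Xon _ _] := reach_facts Pon PX; have Hle := boxed_le bx.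
  have : th (next X d) - th X <= length X d.
    rewrite lerBlDl; apply: le_trans (clip_dist_le _ _ _ (X h) _) _; rewrite lerD2l.
    have [d0 _ _] := bx.
    rewrite next_dist ?(ltW d0)// /length ler_pM2l//.
    by rewrite (bigD1 h)//= lerDl sumr_ge0// => i _; exact: nrm_ge0.
  rewrite -(@ler_pM2l _ (k / 4)) ?divr_gt0// => hh.
  by move: IH hh Hle; rewrite /th; lra.
rewrite leNgt; apply/negP => far.
have thXE : th X = r.
  by rewrite /th clip_far//; lra.
have thPE : th P = l.
  by rewrite /th clip_near//; apply: le_trans (Pa h) _; lra.
move: thX; rewrite thXE thPE => thX.
have : k / 4 * c <= k / 4 * ((r - l) / 4) by rewrite ler_pM2l// divr_gt0.
have : 0 < k / 4 * (r - l) by rewrite mulr_gt0 ?divr_gt0// subr_gt0.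
by lra.
Qed.

End Confinement.

(** * Submodularity near a configuration *)

Section Lattice.
Context {R : realType} {m : nat} {S : ascent_system R m}.
Notation E := (space S).
Notation conf := ('I_m -> E).
Notation N := (pts S).
Notation C := (labels S).
Notation W := (dirs S).
Notation H := (@objective R m S).
Notation K := (K S).
Implicit Types (P X Y Z Q : conf) (p q : E) (a : pred (label S)).
Implicit Types (c d s t e r rho kappa : R).

(** [A rho] holds for all small radii [rho]. *)
Definition small (A : R -> Prop) := exists2 e, 0 < e & forall rho, 0 < rho -> rho <= e -> A rho.

Lemma small_and (A B : R -> Prop) : small A -> small B -> small (fun r => A r /\ B r).
Proof.
move=> [e e0 Ae] [f f0 Bf]; exists (Num.min e f); first by rewrite lt_min e0.
by move=> r r0; rewrite le_min => /andP[re rf]; split; [exact: Ae|exact: Bf].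
Qed.

Lemma small_all (T : eqType) (s : seq T) (A : T -> R -> Prop) :
  (forall i, i \in s -> small (A i)) -> small (fun r => forall i, i \in s -> A i r).
Proof.
elim: s => [|i s IH] As; first by exists 1.
have [e e0 he] : small (A i) by apply: As; rewrite mem_head.
have [f f0 hf] : small (fun r => forall i, i \in s -> A i r).
  by apply: IH => j js; apply: As; rewrite inE js orbT.
exists (Num.min e f); first by rewrite lt_min e0.
move=> r r0; rewrite le_min => /andP[re rf] j; rewrite inE => /predU1P[->|js].
  exact: he.
exact: hf.
Qed.

Lemma small_lin (k c : R) : 0 <= k -> 0 < c -> small (fun r => k * r <= c).
Proof.
move=> k0 c0; exists (c / (k + 1)); first by rewrite divr_gt0// ltr_wpDl.
move=> r r0; rewrite ler_pdivlMr ?ltr_wpDl//; lra.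
Qed.

Lemma small_imp (A B : R -> Prop) : (forall r, 0 < r -> A r -> B r) -> small A -> small B.
Proof. by move=> AB [e e0 Ae]; exists e => // r r0 re; apply: AB => //; exact: Ae. Qed.

Definition nondecr b q w rho := forall s t, 0 <= s -> s <= t -> t <= rho ->
  util b (q + s *: w : E) <= util b (q + t *: w).
Definition nonincr b q w rho := forall s t, 0 <= s -> s <= t -> t <= rho ->
  util b (q + t *: w : E) <= util b (q + s *: w).

Definition maxspeed : R := (size C)%:R * spd S.

(** The neighbourhoods of a configuration in which the local arguments take
    place; [c] separates from [0] the positive slopes at [Q]. *)
Record good Q rho c : Prop := Good {
  good_rho : 0 < rho;
  good_c : 0 < c;
  good_star : forall h, is_star (Q h) rho;
  good_mono : forall b h w, b \in C -> w \in W ->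
    nondecr b (Q h) w rho \/ nonincr b (Q h) w rho;
  good_best : forall b X i, b \in C -> on X -> (forall h, nrm (X h - Q h) <= rho) ->
    util b (Q i) <= util b (Q (owner X b));
  good_gap : forall a h w, w \in W -> 0 < slope a (Q h) w -> c <= slope a (Q h) w;
  good_small1 : 8 * (size C)%:R * K * rho <= c;
  good_small2 : 4 * K * rho <= c;
  good_small3 : 16 * m%:R * K * maxspeed * rho <= c ^+ 2
}.

Lemma util_near Q rho X b i : on Q -> on X -> is_star (Q i) rho ->
  b \in C -> nrm (X i - Q i) <= rho ->
  `|util b (X i) - util b (Q i)| <= spd S * nrm (X i - Q i).
Proof.
move=> Qon Xon [st _] bC near; have [w [wW Xw pth]] := st _ (Xon i) near.
rewrite {1}Xw; apply: util_lip => //; first exact: nrm_ge0.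
exact: path_in_sub pth near.
Qed.

(** Each condition holds for small radii: the utilities near [Q] stay close to
    their values at [Q], which differ from each other by a definite amount if at
    all, and the positive slopes at [Q] are finitely many. *)
Lemma good_ex Q : on Q -> exists c, small (fun rho => good Q rho c).
Proof.
move=> Qon; have K0 := K_gt0 S; have sp0 := spd_gt0 S.
pose vals : seq R := [seq slope (tpred x.1.1) (Q x.2) x.1.2 |
  x <- [seq (kw, h) | kw <- [seq (k, w) | k <- enum {: (size C).-tuple bool}, w <- W],
                      h <- enum 'I_m]].
have [c c0 cmin] := min_pos_seq vals; exists c.
have gap a h w : w \in W -> 0 < slope a (Q h) w -> c <= slope a (Q h) w.
  move=> wW; have [k ->] := slope_tpred a; apply: cmin.
  apply/mapP; exists (k, w, h) => //.
  apply/allpairsP; exists ((k, w), h); split=> //=; last by rewrite mem_enum.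
  by apply/allpairsP; exists (k, w); split=> //=; rewrite mem_enum.
have [rho0 rho0_gt0 st] := star_conf Qon.
have s1 : small (fun rho => rho <= rho0) by exists rho0.
have s2 : small (fun rho => forall b, b \in C -> forall h, h \in enum 'I_m ->
    forall w, w \in W -> nondecr b (Q h) w rho \/ nonincr b (Q h) w rho).
  apply: small_all => b bC; apply: small_all => h _; apply: small_all => w wW.
  have [e e0 mono] := util_monotone (Q h) bC wW; exists e => // rho _ re.
  case: mono => mono; [left|right] => s t s0 st1 t1; apply: mono => //;
    exact: le_trans t1 re.
have s3 : small (fun rho => forall b, b \in C -> forall i, i \in enum 'I_m ->
    forall j, j \in enum 'I_m -> util b (Q i) < util b (Q j) ->
    2 * spd S * rho < util b (Q j) - util b (Q i)).
  apply: small_all => b bC; apply: small_all => i _; apply: small_all => j _.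
  have [lt|_] := ltP (util b (Q i)) (util b (Q j)); last by exists 1.
  have := @small_lin (2 * spd S) ((util b (Q j) - util b (Q i)) / 2).
  rewrite mulr_ge0 ?(ltW sp0)// divr_gt0 ?subr_gt0// => /(_ isT isT).
  by apply: small_imp => r _ rle _; lra.
have s4 := @small_lin (8 * (size C)%:R * K) c.
have s5 := @small_lin (4 * K) c.
have s6 := @small_lin (16 * m%:R * K * maxspeed) (c ^+ 2).
have {}s4 : small (fun r => 8 * (size C)%:R * K * r <= c) by apply: s4 => //; rewrite !mulr_ge0// ltW.
have {}s5 : small (fun r => 4 * K * r <= c) by apply: s5 => //; rewrite !mulr_ge0// ltW.
have {}s6 : small (fun r => 16 * m%:R * K * maxspeed * r <= c ^+ 2).
  by apply: s6; rewrite ?exprn_gt0// /maxspeed !mulr_ge0// ltW.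
apply: small_imp (small_and s1 (small_and s2 (small_and s3 (small_and s4 (small_and s5 s6))))).
move=> rho rho_gt0 [r1 [r2 [r3 [r4 [r5 r6]]]]].
have st' h : is_star (Q h) rho by exact: is_star_sub (st h) r1.
split=> // [b h w bC wW|b X i bC Xon near]; first by apply: r2; rewrite ?mem_enum.
rewrite leNgt; apply/negP => lt.
have big := r3 b bC _ (mem_enum _ _) _ (mem_enum _ _) lt.
have := util_near Qon Xon (st' i) bC (near i).
have := util_near Qon Xon (st' (owner X b)) bC (near _).
have /= best := owner_best X i bC.
have b1 : spd S * nrm (X i - Q i) <= spd S * rho by rewrite ler_pM2l.
have b2 : spd S * nrm (X (owner X b) - Q (owner X b)) <= spd S * rho by rewrite ler_pM2l.
rewrite !ler_norml; lra.
Qed.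

Definition rayc Q (w : 'I_m -> E) (x : 'I_m -> R) : conf := fun h => Q h + x h *: w h.

Lemma best_util P b i : b \in C -> util b (P i) <= util b (P (owner P b)).
Proof. exact: owner_best. Qed.

(** Near [Q] a label belongs to a sensor that serves it best at [Q]
    ([good_best]), and its utility is monotone along each ray. If it grows
    along the ray of one of these best sensors, the best sensors along whose
    rays it decreases remain below. So each label contributes the maximum of
    functions of one coordinate each that are all nondecreasing or all
    nonincreasing, and such a maximum is submodular. *)
Lemma submodular Q rho c (w : 'I_m -> E) (y z : 'I_m -> R) : good Q rho c ->
    (forall h, w h \in W) -> (forall h, path_in N (Q h) (w h) rho) ->
    (forall h, 0 <= y h <= rho) -> (forall h, 0 <= z h <= rho) ->
  H (rayc Q w (fun h => Num.min (y h) (z h))) + H (rayc Q w (fun h => Num.max (y h) (z h)))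
    <= H (rayc Q w y) + H (rayc Q w z).
Proof.
move=> gd wW pth yr zr; rewrite /H -!big_split /= big_seq [leRHS]big_seq.
apply: ler_sum => b bC.
set A := rayc Q w (fun h => Num.min _ _); set B := rayc Q w (fun h => Num.max _ _).
have Bon : on B by move=> h; apply: pth; rewrite /Num.max; case: ifP => _.
have Bnear h : nrm (B h - Q h) <= rho.
  by rewrite nrm_ray// ger0_norm /Num.max; case: ifP => _; case/andP: (yr h); case/andP: (zr h).
have Qbest i := good_best gd i bC Bon Bnear.
set i := owner A b; set j := owner B b in Qbest *.
have mono h := good_mono gd h bC (wW h).
wlog yzi : y z yr zr @A @B Bon Bnear @i @j Qbest / y i <= z i => [wl|].
  have [yz|/ltW zy] := leP (y i) (z i); first exact: (wl y z).
  have eA : A = rayc Q w (fun h => Num.min (z h) (y h)).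
    by apply/funext => h; rewrite /A /rayc minC.
  have eB : B = rayc Q w (fun h => Num.max (z h) (y h)).
    by apply/funext => h; rewrite /B /rayc maxC.
  rewrite [leRHS]addrC /i /j eA eB; apply: wl => //; rewrite -?eA -?eB//.
have eA : A i = rayc Q w y i by rewrite /A /rayc (min_idPl yzi).
have best X k := best_util X k bC.
have /andP[yi0 yi1] := yr i; have /andP[zi0 zi1] := zr i.
have /andP[yj0 yj1] := yr j; have /andP[zj0 zj1] := zr j.
have [yzj|/ltW zyj] := leP (y j) (z j).
  have -> : B j = rayc Q w z j by rewrite /B /rayc (max_idPr yzj).
  by rewrite eA lerD.
have eB : B j = rayc Q w y j by rewrite /B /rayc (max_idPl zyj).
rewrite eA eB.
have [jup|jdn] := mono j; last first.
  by apply: lerD; [exact: best|exact: le_trans (jdn _ _ zj0 zyj yj1) (best _ j)].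
rewrite addrC; apply: lerD; first exact: best.
have [iup|idn] := mono i; first exact: le_trans (iup _ _ yi0 yzi zi1) (best _ i).
apply: le_trans (best _ j); apply: (@le_trans _ _ (util b (Q j))).
  apply: le_trans (Qbest i); have := idn 0 (y i) (lexx _) yi0 yi1.
  by rewrite scale0r addr0.
by have := jup 0 (z j) (lexx _) zj0 zj1; rewrite scale0r addr0.
Qed.

End Lattice.

(** * One step near a configuration *)

Section Step.
Context {R : realType} {m : nat} {S : ascent_system R m}.
Notation E := (space S).
Notation conf := ('I_m -> E).
Notation N := (pts S).
Notation C := (labels S).
Notation W := (dirs S).
Notation H := (@objective R m S).
Notation K := (K S).
Implicit Types (P X Y Z Q : conf) (p q : E) (a : pred (label S)).
Implicit Types (c d e r rho kappa : R).

Definition near Q rho P := forall h, nrm (P h - Q h) < rho.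

(** The obstruction to moving towards [Q]. By continuity of the objective it
    disappears along a sequence that tends to [Q]. *)
Definition excess Q kappa P := exists Y : conf,
  (forall h, exists2 t : R, 0 <= t <= 1 & Y h = Q h + t *: (P h - Q h)) /\
  H Y <= H P - kappa.

(** On its ray the sensor [h] has the coordinate [s h] and the velocity [v h]. *)
Record ray_coords Q rho P (w : 'I_m -> E) (v s : 'I_m -> R) : Prop := RayCoords {
  rc_dir : forall h, w h \in W;
  rc_ge0 : forall h, 0 <= s h;
  rc_lt : forall h, s h < rho;
  rc_pos : forall h, P h = Q h + s h *: w h;
  rc_path : forall h, path_in N (Q h) (w h) rho;
  rc_velo : forall h, velo P h = v h *: w h;
  rc_slope : forall h, s h != 0 \/ v h != 0 -> slope (cell P h) (P h) (w h) = v h;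
  rc_out : forall h, s h = 0 -> 0 <= v h
}.

Lemma ray_coords_ex Q rho c P : on Q -> on P -> good Q rho c -> near Q rho P ->
  exists w v, ray_coords Q rho P w v (fun h => nrm (P h - Q h)).
Proof.
move=> Qon Pon gd nr.
have /choice[wv wvP] : forall h, exists wv : E * R,
  [/\ wv.1 \in W, P h = Q h + nrm (P h - Q h) *: wv.1, path_in N (Q h) wv.1 rho,
      velo P h = wv.2 *: wv.1 &
      (P h <> Q h \/ wv.2 != 0 -> slope (cell P h) (P h) wv.1 = wv.2) /\ (P h = Q h -> 0 <= wv.2)].
  move=> h; have [w [v]] := ray_form Qon Pon (good_rho gd) (good_star gd h) (nr h).
  by exists (w, v).
exists (fun h => (wv h).1), (fun h => (wv h).2).
have nQ h : nrm (P h - Q h) != 0 -> P h <> Q h.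
  by move=> /eqP ne e; apply: ne; rewrite e subrr nrm0.
split=> h; try by have [] := wvP h.
- exact: nrm_ge0.
- have [_ _ _ _ [sl _]] := wvP h; case=> [/nQ|] ne; apply: sl; by [left|right].
- have [_ _ _ _ [_ out]] := wvP h => /nrm_eq0/eqP; rewrite subr_eq0 => /eqP.
  exact: out.
Qed.

Lemma between_ray q w (x s : R) : 0 <= x <= s -> exists2 t : R, 0 <= t <= 1 &
  q + x *: w = q + t *: (q + s *: w - q) :> E.
Proof.
move=> /andP[x0 xs]; have [s0|s0] := eqVneq s 0.
  exists 0; rewrite ?lexx ?ler01//; have -> : x = 0 by lra.
  by rewrite !scale0r.
have sgt : 0 < s by rewrite lt_neqAle eq_sym s0; lra.
exists (x / s); first by rewrite divr_ge0//= ?ler_pdivrMr ?mul1r//; lra.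
by rewrite [q + s *: w - q]addrC addKr scalerA divfK.
Qed.

(** By the Taylor estimate, a positive derivative would make the utility grow at
    first. *)
Lemma nonincr_dutil b q w rho : b \in C -> w \in W -> 0 < rho ->
  path_in N q w rho -> nonincr b q w rho -> dutil b q w <= 0.
Proof.
move=> bC wW rho0 pth ni; rewrite leNgt; apply/negP => D0.
have K0 := K_gt0 S.
pose t : R := Num.min rho (dutil b q w / (2 * K)).
have t0 : 0 < t by rewrite lt_min rho0 divr_gt0// mulr_gt0.
have tr : t <= rho by rewrite ge_min lexx.
have tK : t * (2 * K) <= dutil b q w.
  by rewrite -ler_pdivlMr ?mulr_gt0// ge_min lexx orbT.
have := ni 0 t (lexx _) (ltW t0) tr; rewrite scale0r addr0 => dec.
have := util_taylor bC wW (ltW t0) (path_in_sub pth tr).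
rewrite ler_norml expr2 => /andP[+ _].
have : t * (t * (2 * K)) <= t * dutil b q w by rewrite ler_pM2l.
have : 0 < t * dutil b q w by rewrite mulr_gt0.
by lra.
Qed.

Definition fast Q c P := exists h w v, [/\ w \in W,
  P h = Q h + nrm (P h - Q h) *: w, velo P h = v *: w & c / 2 <= v].

Section Fixed.
Variables (Q P : conf) (rho c d : R) (w : 'I_m -> E) (v s : 'I_m -> R).
Hypotheses (Qon : on Q) (Pon : on P) (gd : good Q rho c).
Hypothesis rc : ray_coords Q rho P w v s.
Hypothesis d0 : 0 < d.
Hypothesis near' : near Q rho (next P d).

(* Coordinates after the step; a negative one means that the sensor went
   through its place in [Q]. *)
Let s' h := s h + d * v h.
Let z h := Num.max 0 (Num.min (s h) (s' h)).
Let Z := rayc Q w z.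

Let nextE h : next P d h = Q h + s' h *: w h.
Proof.
by rewrite /next /advance (rc_velo rc) {1}(rc_pos rc) scalerA -addrA -scalerDl.
Qed.

Let s'_lt h : `|s' h| < rho.
Proof. by have := near' h; rewrite nextE nrm_ray// (rc_dir rc). Qed.

Let z_ge0 h : 0 <= z h. Proof. by rewrite le_max lexx. Qed.

Let z_le h : z h <= s h.
Proof. by rewrite ge_max (rc_ge0 rc) ge_min lexx. Qed.

Let z_in h : 0 <= z h <= rho.
Proof. by rewrite z_ge0 (le_trans (z_le h))// ltW// (rc_lt rc). Qed.

Let s_in h : 0 <= s h <= rho.
Proof. by rewrite (rc_ge0 rc) ltW// (rc_lt rc). Qed.

Let z_out h : 0 < v h -> z h = s h.
Proof.
move=> v0; have : s h <= s' h by rewrite lerDl mulr_ge0// ltW.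
by move=> ss; rewrite /z (min_idPl ss) (max_idPr (rc_ge0 rc h)).
Qed.

Let z_cross h : s' h < 0 -> z h = 0.
Proof.
move=> c0; apply/max_idPl; rewrite ge_min; apply/orP; right; exact: ltW.
Qed.

Let z_in_move h : v h <= 0 -> 0 <= s' h -> z h = s' h.
Proof.
move=> v0 c0; have ss : s' h <= s h by rewrite gerDl pmulr_rle0.
by rewrite /z (min_idPr ss) (max_idPr c0).
Qed.

Let PE : P = rayc Q w s. Proof. by apply/funext => h; exact: (rc_pos rc). Qed.

Let box_point (x : 'I_m -> R) : (forall h, 0 <= x h <= rho) ->
  (forall h, 0 < v h -> x h = s h) -> (forall h, z h <= x h <= s h) ->
  exists2 t : 'I_m -> R, (forall h, 0 <= t h <= d) & rayc Q w x = advance P t.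
Proof.
move=> xr xout xz; exists (fun h => if v h < 0 then (s h - x h) / - v h else 0) => [h|].
  have [vlt|vge] := ltP (v h) 0; last by rewrite lexx ltW.
  have /andP[zx xs] := xz h.
  rewrite divr_ge0 ?subr_ge0 ?oppr_ge0 ?(ltW vlt)//= ler_pdivrMr ?oppr_gt0//.
  have : s' h <= z h.
    have ss : s' h <= s h by rewrite gerDl pmulr_rle0// ltW.
    by rewrite /z (min_idPr ss) le_max lexx orbT.
  by rewrite /s'; lra.
apply/funext => h; rewrite /rayc /advance.
have [vlt|vge] := ltP (v h) 0.
  rewrite (rc_velo rc) (rc_pos rc) scalerA -addrA -scalerDl.
  by rewrite invrN mulrN mulNr divfK ?lt_eqF// opprB subrKC.
rewrite scale0r addr0 (rc_pos rc); move: vge; rewrite le_eqVlt => /predU1P[v0|/xout -> //].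
have := xz h; rewrite z_in_move ?(esym v0)//; rewrite /s' -?v0 ?mulr0 ?addr0 ?(rc_ge0 rc)//.
by move=> xx; congr (_ + _ *: _); lra.
Qed.

Let meet_between h : exists2 t : R, 0 <= t <= 1 & Z h = Q h + t *: (next P d h - Q h).
Proof.
rewrite nextE /Z /rayc; have [c0|c0] := ltP (s' h) 0.
  by exists 0; rewrite ?lexx ?ler01// z_cross// !scale0r.
apply: between_ray; rewrite z_ge0 /z.
by rewrite ge_max c0 ge_min lexx orbT.
Qed.

(** Let [Y] have radial coordinates [y]. The join of [Y] and [Z] lies in the box
    spanned by the step, so its objective is at least [H P]; by submodularity
    the objective of the meet of [Y] and [Z] is then at most
    [H Y + H Z - H P], and this meet lies between [Q] and the next
    configuration. *)
Lemma excess_step kappa : boxed P d -> H Z <= H (next P d) ->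
  excess Q kappa P -> excess Q kappa (next P d).
Proof.
move=> [_ _ bx] HZ [Y [Ybt HY]].
have /choice[t tP] : forall h, exists t : R, 0 <= t <= 1 /\ Y h = Q h + t *: (P h - Q h).
  by move=> h; have [t] := Ybt h; exists t.
pose y h := t h * s h.
have YE : Y = rayc Q w y.
  apply/funext => h; have [_ ->] := tP h.
  by rewrite (rc_pos rc) [Q h + _ - _]addrC addKr scalerA.
have y_le h : 0 <= y h <= s h.
  have [/andP[t0 t1] _] := tP h; rewrite mulr_ge0 ?(rc_ge0 rc)//=.
  by rewrite -[leRHS]mul1r ler_wpM2r// (rc_ge0 rc).
have y_in h : 0 <= y h <= rho.
  by have := y_le h; have := s_in h; lra.
have := submodular gd (rc_dir rc) (rc_path rc) y_in z_in.
set A := rayc Q w (fun h => Num.min _ _); set B := rayc Q w (fun h => Num.max _ _).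
have yzr h : 0 <= Num.max (y h) (z h) <= rho by rewrite /Num.max; case: ifP.
have [h v0|h|t' t'd BE] := box_point yzr.
- by rewrite z_out//; apply/max_idPr; case/andP: (y_le h).
- rewrite le_max lexx orbT ge_max z_le andbT; by case/andP: (y_le h).
have HB : H P <= H B by rewrite /B BE; exact: bx.
rewrite -YE => sub; exists A; split=> [h|]; last by rewrite -/Z in sub; lra.
rewrite /A /rayc nextE; have [c0|c0] := ltP (s' h) 0.
  exists 0; rewrite ?lexx ?ler01// z_cross// !scale0r (min_idPr _) ?scale0r//.
  by case/andP: (y_in h).
apply: between_ray; rewrite le_min z_ge0 ?andbT; case/andP: (y_in h) => -> _ /=.
by rewrite ge_min /z ge_max c0 ge_min lexx /= !orbT.
Qed.

(** If no sensor goes through its place in [Q], then [Z] is the meet of [P] and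
    of the next configuration, and their join lies in the box of the step. *)
Lemma meet_boxed : boxed P d -> (forall h, 0 <= s' h) -> H Z <= H (next P d).
Proof.
move=> [_ _ bx] nc.
have s'_in h : 0 <= s' h <= rho.
  by rewrite nc; have := s'_lt h; rewrite ger0_norm// => /ltW.
have := submodular gd (rc_dir rc) (rc_path rc) s_in s'_in.
have -> : rayc Q w (fun h => Num.min (s h) (s' h)) = Z.
  apply/funext => h; rewrite /Z /rayc /z; congr (_ + _ *: _).
  by rewrite (max_idPr _)// le_min (rc_ge0 rc) nc.
have -> : rayc Q w s' = next P d by apply/funext => h; rewrite nextE.
rewrite -PE; set B := rayc Q w _.
suff : H P <= H B by lra.
have -> : B = advance P (fun h => if 0 < v h then d else 0).
  apply/funext => h; rewrite /B /rayc /advance (rc_velo rc) (rc_pos rc) scalerA -addrA -scalerDl.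
  congr (_ + _ *: _); case: ltP => v0.
    by apply/max_idPr; rewrite lerDl mulr_ge0// ltW.
  by rewrite mul0r addr0; apply/max_idPl; rewrite gerDl pmulr_rle0.
by apply: bx => h; case: ltP => _; rewrite lexx (ltW d0).
Qed.

(** The remainder of the Taylor estimate at [Q h] for a sensor that goes through
    it. *)
Definition loss h : R := if s' h < 0 then K * s' h ^+ 2 else 0.

Let loss_ge0 h : 0 <= loss h.
Proof.
rewrite /loss; case: ltP => // _; rewrite mulr_ge0 ?sqr_ge0// ltW//; exact: K_gt0.
Qed.

Hypothesis nextN : on (next P d).

Let cross_path h : s' h < 0 -> path_in N (Q h) (- w h) rho.
Proof.
move=> c0; have [w' [w'W]] := (good_star gd h).1 _ (nextN h) (ltW (near' h)).
have nE : nrm (next P d h - Q h) = - s' h.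
  by rewrite nextE nrm_ray ?(rc_dir rc)// ltr0_norm.
rewrite nE nextE => /addrI ww pth.
have : - s' h *: (- w h) = - s' h *: w' by rewrite scalerN scaleNr opprK.
by move=> /dir_inj -> //; rewrite oppr_gt0.
Qed.

Let nextNE h : next P d h = Q h + (- s' h) *: (- w h).
Proof. by rewrite nextE scalerN scaleNr opprK. Qed.

(** [Z] stops the sensors that move inwards and leaves the others at [P]. If a
    label is served better at [Z] than by its owner at [P], then this owner
    brings no gain, and the sensor that serves the label at [Z] keeps its
    utility up to [loss]: this is an error of second order because a utility
    that decreases on both sides of [Q h] has derivative zero there. *)
Lemma label_step b : b \in C ->
  util b (Z (owner Z b)) + (util b (next P d (owner P b)) - util b (Z (owner P b)))
    <= util b (next P d (owner (next P d) b)) + \sum_h loss h.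
Proof.
move=> bC; set o := owner P b; set i := owner Z b.
have best X k := best_util X k bC.
have loss_le h : loss h <= \sum_h loss h.
  by rewrite (bigD1 h)//= lerDl sumr_ge0.
have loss0 : 0 <= \sum_h loss h by rewrite sumr_ge0.
have [Zoi|Zoi] := leP (util b (Z i)) (util b (Z o)).
  by have := best (next P d) o; lra.
have Pnear h : nrm (P h - Q h) <= rho.
  by rewrite (rc_pos rc) nrm_ray ?(rc_dir rc)// ger0_norm; case/andP: (s_in h).
have Qo j : util b (Q j) <= util b (Q o) := good_best gd j bC Pon Pnear.
have Po j : util b (P j) <= util b (P o) := best P j.
have mono h := good_mono gd h bC (rc_dir rc h).
have s0 h := rc_ge0 rc h; have sr h := ltW (rc_lt rc h).
have Zb h : (util b (Q h) <= util b (Z h) <= util b (P h)) \/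
            (util b (P h) <= util b (Z h) <= util b (Q h)).
  rewrite (rc_pos rc) /Z /rayc; have [up|dn] := mono h; [left|right].
    have := up 0 (z h) (lexx _) (z_ge0 h) (le_trans (z_le h) (sr h)).
    by rewrite scale0r addr0 => ->; exact: up.
  have := dn 0 (z h) (lexx _) (z_ge0 h) (le_trans (z_le h) (sr h)).
  by rewrite scale0r addr0 andbC => ->; exact: dn.
have QP h : (forall x y, 0 <= x -> x <= y -> y <= rho ->
    util b (Q h + x *: w h) <= util b (Q h + y *: w h)) -> util b (Q h) <= util b (P h).
  by move=> up; have := up 0 (s h) (lexx _) (s0 h) (sr h); rewrite scale0r addr0 -(rc_pos rc).
have PQ h : (forall x y, 0 <= x -> x <= y -> y <= rho ->
    util b (Q h + y *: w h) <= util b (Q h + x *: w h)) -> util b (P h) <= util b (Q h).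
  by move=> dn; have := dn 0 (s h) (lexx _) (s0 h) (sr h); rewrite scale0r addr0 -(rc_pos rc).
have s'r h : s' h <= rho by rewrite (le_trans (ler_norm _))// ltW// s'_lt.
have outE h : 0 < v h -> Z h = P h by move=> v0; rewrite /Z /rayc z_out// -(rc_pos rc).
have inE h : v h <= 0 -> 0 <= s' h -> Z h = next P d h.
  by move=> v0 c0; rewrite /Z /rayc z_in_move// nextE.
have crE h : s' h < 0 -> Z h = Q h.
  by move=> c0; rewrite /Z /rayc z_cross// scale0r addr0.
(* The owner at [P] does not gain on its way out. *)
have noA : util b (next P d o) <= util b (Z o).
  rewrite leNgt; apply/negP => lt.
  have [v0|v0] := ltP 0 (v o).
    have ss : s o <= s' o by rewrite lerDl mulr_ge0// ltW.
    have [up|dn] := mono o; last first.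
      have := dn _ _ (s0 o) ss (s'r o); rewrite -(rc_pos rc) -nextE -(outE _ v0).
      by rewrite leNgt lt.
    have := QP _ up; have := outE _ v0 => ZP.
    by case: (Zb i) => ?; have := Qo i; have := Po i; rewrite -ZP; lra.
  have [c0|c0] := ltP (s' o) 0; last by move: lt; rewrite inE// ltxx.
  have ZQ := crE _ c0.
  have vlt : v o < 0.
    rewrite lt_neqAle v0 andbT; apply/eqP => v00; move: c0; rewrite /s' v00 mulr0 addr0.
    by rewrite ltNge s0.
  pose t : R := s o / (s o - s' o).
  have den : 0 < s o - s' o by have := s0 o; lra.
  have t01 : 0 <= t <= 1.
    by rewrite divr_ge0 ?(ltW den)//= ler_pdivrMr// mul1r; lra.
  have := util_quasiconcave (P o) (next P d o) bC t01.
  have -> : P o + t *: (next P d o - P o) = Q o.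
    rewrite nextE (rc_pos rc) opprD addrACA subrr add0r -scalerBl scalerA -addrA -scalerDl.
    have -> : s o + t * (s' o - s o) = 0.
      by rewrite -opprB mulrN divfK ?subrr// gt_eqF.
    by rewrite scale0r addr0.
  rewrite ge_min => /orP[PQo|]; last by rewrite -ZQ leNgt lt.
  by case: (Zb i) => ?; have := Qo i; have := Po i; rewrite ZQ in Zoi; lra.
(* The owner at the meet loses at most the amount of a maximum that it leaves. *)
suff : util b (Z i) - loss i <= util b (next P d i).
  by have := best (next P d) i; have := loss_le i; lra.
have [v0|v0] := ltP 0 (v i).
  have ss : s i <= s' i by rewrite lerDl mulr_ge0// ltW.
  have ZP := outE _ v0.
  have [up|dn] := mono i.
    have := up _ _ (s0 i) ss (s'r i); rewrite -(rc_pos rc) -nextE -ZP.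
    by have := loss_ge0 i; lra.
  have := PQ _ dn; rewrite -ZP => hh.
  by case: (Zb o) => ?; have := Qo i; have := Po i; rewrite -ZP; lra.
have [c0|c0] := ltP (s' i) 0; last first.
  by rewrite inE//; have := loss_ge0 i; lra.
have ZQ := crE _ c0; have pN := cross_path c0.
have ns'0 : 0 <= - s' i by rewrite oppr_ge0 ltW.
have ns'r : - s' i <= rho by have := s'_lt i; rewrite ltr0_norm// => /ltW.
have [up|dn] := good_mono gd i bC (dirsN (rc_dir rc i)).
  have := up 0 (- s' i) (lexx _) ns'0 ns'r.
  by rewrite scale0r addr0 -nextNE -ZQ; have := loss_ge0 i; lra.
have [up'|dn'] := mono i.
  have := QP _ up'; rewrite -ZQ => hh.
  by case: (Zb o) => ?; have := Qo i; have := Po i; rewrite -ZQ; lra.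
have D1 := nonincr_dutil bC (dirsN (rc_dir rc i)) (good_rho gd) pN dn.
have D2 := nonincr_dutil bC (rc_dir rc i) (good_rho gd) (rc_path rc i) dn'.
have D0 : dutil b (Q i) (- w i) = 0 by move: D1; rewrite dutilN => D1; lra.
have := util_taylor bC (dirsN (rc_dir rc i)) ns'0 (path_in_sub pN ns'r).
by rewrite -nextNE D0 mulr0 subr0 -ZQ sqrrN /loss c0 ler_norml; lra.
Qed.

(** A lower bound, net of [loss], of the gain contributed by a sensor that moves
    outwards or goes through its place in [Q]. *)
Definition push h : R :=
  if 0 < v h then d / 2 * v h ^+ 2 else if s' h < 0 then c / 8 * - s' h else 0.

Lemma push_ge0 h : 0 <= push h.
Proof.
rewrite /push; have c0 := good_c gd; case: ltP => _.
  by rewrite mulr_ge0 ?sqr_ge0// divr_ge0// ltW.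
by case: ltP => // ?; rewrite mulr_ge0//; [rewrite divr_ge0// ltW|rewrite oppr_ge0 ltW].
Qed.

(** Sensors that go through their place in [Q] do it at a speed bounded below,
    which outweighs the second-order loss of [label_step]. *)
Lemma meet_safe : safe P d -> H Z + \sum_h push h <= H (next P d).
Proof.
move=> sf; have c0 := good_c gd; have K0 := K_gt0 S.
have labs : H Z + (\sum_h gain (cell P h) (next P d h) - \sum_h gain (cell P h) (Z h))
    <= H (next P d) + (size C)%:R * \sum_h loss h.
  rewrite -(partition_owner P (fun b h => util b (next P d h))).
  rewrite -(partition_owner P (fun b h => util b (Z h))) /objective -sumrB -big_split/=.
  have -> : (size C)%:R * \sum_h loss h = \sum_(b <- C) \sum_h loss h.
    by rewrite big_const_seq count_predT iter_addr_0 mulr_natl.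
  rewrite -big_split /= big_seq [leRHS]big_seq; apply: ler_sum => b bC.
  exact: label_step.
suff : \sum_h push h + (size C)%:R * \sum_h loss h <=
    \sum_h gain (cell P h) (next P d h) - \sum_h gain (cell P h) (Z h) by lra.
rewrite mulr_sumr -sumrB -big_split /=; apply: ler_sum => h _.
have [v0|v0] := ltP 0 (v h).
  have s'0 : 0 <= s' h by rewrite addr_ge0 ?(rc_ge0 rc)// mulr_ge0// ltW.
  rewrite /push v0 /loss ltNge s'0 /= mulr0 addr0.
  have -> : Z h = P h + 0 *: velo P h.
    by rewrite scale0r addr0 /Z /rayc z_out// -(rc_pos rc).
  have := safe_gain h Pon sf (lexx 0) (ltW d0) (lexx d); rewrite subr0.
  by rewrite {1}(rc_velo rc) nrm_dir ?(rc_dir rc)// gtr0_norm.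
have [cr|cr] := ltP (s' h) 0; last first.
  rewrite /push /loss !ltNge v0 cr /= mulr0 addr0.
  by rewrite /Z /rayc z_in_move// -nextE subrr.
rewrite /push /loss cr ltNge v0 /=.
have vlt : v h < 0.
  rewrite lt_neqAle v0 andbT; apply/eqP => v00; move: cr; rewrite /s' v00 mulr0 addr0.
  by rewrite ltNge (rc_ge0 rc).
pose t : R := s h / - v h.
have tv : t * v h = - s h by rewrite /t invrN mulrN mulNr divfK// lt_eqF.
have t0 : 0 <= t by rewrite divr_ge0 ?(rc_ge0 rc)// oppr_ge0.
have td : t <= d.
  by rewrite ler_pdivrMr ?oppr_gt0//; move: cr; rewrite /s'; lra.
have ZQ : Z h = P h + t *: velo P h.
  rewrite /Z /rayc z_cross// scale0r (rc_velo rc) {1}(rc_pos rc) scalerA tv.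
  by rewrite -addrA -scalerDl subrr scale0r.
have QE : P h + t *: velo P h = Q h by rewrite -ZQ /Z /rayc z_cross// scale0r addr0.
have big : c / 2 <= - v h.
  have := @safe_slope R m S P d h (- w h) (- v h) t Pon sf (dirsN (rc_dir rc h)).
  rewrite (rc_velo rc) scalerN scaleNr opprK t0 td => /(_ erefl isT).
  rewrite -(rc_velo rc) QE slopeN [X in _ - X]slopeN (rc_slope rc); last by right; rewrite lt_eqF.
  rewrite normrN (ltr0_norm vlt) -slopeN => sl.
  have := @good_gap _ _ _ _ _ _ gd (cell P h) h (- w h) (dirsN (rc_dir rc h)).
  by move: sl; rewrite ler_norml; lra.
rewrite ZQ; apply: le_trans (safe_gain h Pon sf t0 td (lexx d)).
rewrite (rc_velo rc) nrm_dir ?(rc_dir rc)// (ltr0_norm vlt).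
have dt : (d - t) * - v h = - s' h by rewrite /s'; lra.
have -> : (d - t) / 2 * (- v h) ^+ 2 = - s' h * - v h / 2 by rewrite -dt expr2; lra.
have ns' : 0 < - s' h by rewrite oppr_gt0.
have ns'r : - s' h <= rho by have := s'_lt h; rewrite ltr0_norm// => /ltW.
have g1 := good_small1 gd.
have a1 : - s' h * (c / 2) <= - s' h * - v h by rewrite ler_pM2l.
have a2 : (size C)%:R * K * (- s' h * - s' h) <= (size C)%:R * K * (rho * - s' h).
  by apply: ler_wpM2l; [rewrite mulr_ge0// ltW|rewrite ler_pM2r].
have a3 : 8 * (size C)%:R * K * rho * - s' h <= c * - s' h by rewrite ler_pM2r.
by rewrite expr2; lra.
Qed.

Lemma excess_safe kappa : safe P d -> excess Q kappa P -> excess Q kappa (next P d).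
Proof.
move=> sf; apply: excess_step; first exact: safe_boxed.
by apply: le_trans (meet_safe sf); rewrite lerDl sumr_ge0// => h _; exact: push_ge0.
Qed.

(** The excess is the gain of the sensor [h] over [Z]. *)
Lemma excess_outward h : safe P d -> 0 < v h \/ s' h < 0 ->
  exists2 kappa, 0 < kappa & excess Q kappa (next P d).
Proof.
move=> sf out; have c0 := good_c gd.
exists (push h).
  rewrite /push; have [v0|v0] := ltP 0 (v h); first by rewrite mulr_gt0 ?exprn_gt0 ?divr_gt0.
  case: out => [|cr]; first by rewrite ltNge v0.
  by rewrite cr mulr_gt0 ?divr_gt0// oppr_gt0.
exists Z; split; first exact: meet_between.
rewrite lerBrDr; apply: le_trans (meet_safe sf); rewrite lerD2l.
by rewrite (bigD1 h)//= lerDl sumr_ge0// => i _; exact: push_ge0.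
Qed.

Lemma excess_boxed kappa : boxed P d -> (forall h, 0 <= s' h) ->
  excess Q kappa P -> excess Q kappa (next P d).
Proof. by move=> bx nc; apply: excess_step => //; exact: meet_boxed. Qed.

(** If no sensor moved away from [Q] quickly after the step, then the slopes of
    the new cells would bound the gain of the outward motions by a quantity
    too small for the sensor that moved quickly before it. *)
Lemma fast_next : safe P d -> (exists2 h, 0 < v h & c / 2 <= v h) -> fast Q c (next P d).
Proof.
move=> sf [h0 vh0 fasth0]; apply: contrapT => nf.
have c0 := good_c gd; have K0 := K_gt0 S; have rho0 := good_rho gd.
have flat h x u : u \in W -> path_in N (Q h) u rho -> 0 < x -> x < rho ->
    next P d h = Q h + x *: u -> slope (cell (next P d) h) (Q h) u <= 0.
  move=> uW pth x0 xr nE; rewrite leNgt; apply/negP => /(good_gap gd uW) big.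
  apply: nf; have [u2 [v2 [u2W nE2 _ Dv2 [sl _]]]] :=
    ray_form Qon nextN rho0 (good_star gd h) (near' h).
  have nx : nrm (next P d h - Q h) = x by rewrite nE nrm_ray// gtr0_norm.
  have uu : u2 = u.
    move: nE2; rewrite nx {1}nE => /addrI e; exact: esym (dir_inj x0 e).
  subst u2; exists h, u, v2; split=> //.
  have {}sl : slope (cell (next P d) h) (next P d h) u = v2.
    apply: sl; left => e; move: nx; rewrite e subrr nrm0 => x00.
    by rewrite x00 ltxx in x0.
  have := slope_lip (cell (next P d) h) uW (ltW x0) (path_in_sub pth (ltW xr)).
  rewrite -nE sl ler_norml; have := good_small2 gd.
  have : K * x <= K * rho by rewrite ler_pM2l// ltW.
  by lra.
have incr h x0 x u : u \in W -> path_in N (Q h) u rho -> 0 <= x0 -> x0 <= x ->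
    x <= rho -> slope (cell (next P d) h) (Q h) u <= 0 ->
    gain (cell (next P d) h) (Q h + x *: u) - gain (cell (next P d) h) (Q h + x0 *: u)
      <= K * rho * (x - x0).
  move=> uW pth x00 x0x xr sl.
  have -> : Q h + x *: u = Q h + x0 *: u + (x - x0) *: u.
    by rewrite -addrA -scalerDl subrKC.
  apply: gain_le => //; first by rewrite subr_ge0.
    by apply: path_in_sub (path_in_shift pth x00) _; lra.
  move=> y yx; rewrite -addrA -scalerDl.
  have := @slope_lip R m S (cell (next P d) h) (Q h) u (x0 + y) uW.
  have xy0 : 0 <= x0 + y by lra.
  have xyr : x0 + y <= rho by lra.
  move=> /(_ xy0 (path_in_sub pth xyr)); rewrite ler_norml.
  have : K * (x0 + y) <= K * rho by rewrite ler_pM2l.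
  by lra.
have speed h : `|v h| <= @maxspeed R m S.
  have [->|v0] := eqVneq (v h) 0; first by rewrite normr0 mulr_ge0// ltW// spd_gt0.
  by rewrite -(rc_slope rc); [rewrite slope_le ?(rc_dir rc)|right].
have B0 : 0 <= @maxspeed R m S by exact: le_trans (speed h0).
have up : H (next P d) - H Z <= \sum_(h < m) K * rho * (d * @maxspeed R m S).
  apply: (@le_trans _ _ (\sum_h (gain (cell (next P d) h) (next P d h) -
      gain (cell (next P d) h) (Z h)))).
    by rewrite sumrB -objectiveE lerD2l lerN2 objective_ge.
  apply: ler_sum => h _.
  have dB : d * `|v h| <= d * @maxspeed R m S by rewrite ler_pM2l.
  have Kr : 0 <= K * rho by rewrite mulr_ge0// ltW.
  have s0 := rc_ge0 rc h; have s'r := s'_lt h.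
  have [v0|v0] := ltP 0 (v h).
    have s'0 : 0 < s' h by rewrite ltr_wpDl// mulr_gt0.
    rewrite gtr0_norm// in s'r; rewrite gtr0_norm// in dB.
    have ss : s h <= s' h by rewrite lerDl mulr_ge0// ltW.
    have sl := flat h _ _ (rc_dir rc h) (rc_path rc h) s'0 s'r (nextE h).
    have := incr h _ _ _ (rc_dir rc h) (rc_path rc h) s0 ss (ltW s'r) sl.
    rewrite -nextE /Z /rayc z_out// => /le_trans; apply.
    by rewrite ler_wpM2l// /s'; lra.
  have [cr|cr] := ltP (s' h) 0; last first.
    by rewrite /Z /rayc z_in_move// -nextE subrr mulr_ge0// mulr_ge0// ltW.
  have ns' : 0 < - s' h by rewrite oppr_gt0.
  rewrite ltr0_norm// in s'r; rewrite ler0_norm// in dB.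
  have sl := flat h _ _ (dirsN (rc_dir rc h)) (cross_path cr) ns' s'r (nextNE h).
  have := incr h _ _ _ (dirsN (rc_dir rc h)) (cross_path cr) (lexx 0) (ltW ns') (ltW s'r) sl.
  rewrite -nextNE /Z /rayc z_cross// !scale0r addr0 subr0 => /le_trans; apply.
  by rewrite ler_wpM2l// /s'; lra.
have low : d / 2 * (c / 2) ^+ 2 <= H (next P d) - H Z.
  have := meet_safe sf; rewrite (bigD1 h0)//= {1}/push vh0.
  have : 0 <= \sum_(i | i != h0) push i by rewrite sumr_ge0// => i _; exact: push_ge0.
  have : d / 2 * (c / 2) ^+ 2 <= d / 2 * v h0 ^+ 2.
    have c2 : 0 <= c / 2 by rewrite divr_ge0// ltW.
    by rewrite ler_pM2l ?divr_gt0// !expr2 ler_pM.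
  by lra.
have := le_trans low up; rewrite sumr_const card_ord -[X in _ <= X]mulr_natl.
have := good_small3 gd => g3.
have : d * (16 * m%:R * K * @maxspeed R m S * rho) <= d * c ^+ 2 by rewrite ler_pM2l.
have : 0 < d * c ^+ 2 by rewrite mulr_gt0// exprn_gt0.
by rewrite expr2; lra.
Qed.

End Fixed.
End Step.

(** * Sequences of full steps *)

Section Trajectories.
Context {R : realType} {m : nat} {S : ascent_system R m}.
Notation E := (space S).
Notation conf := ('I_m -> E).
Notation N := (pts S).
Notation C := (labels S).
Notation H := (@objective R m S).
Implicit Types (P X Y Z Q : conf) (p q : E) (a : pred (label S)).
Implicit Types (c d e r rho kappa : R).

Lemma safe_next_on P d : on P -> safe P d -> on (next P d).
Proof. by move=> Pon sf; exact: boxed_on (safe_boxed Pon sf). Qed.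

Lemma safe_gt0 P d : safe P d -> 0 < d.
Proof. by case=> /andP[]. Qed.

(** [fast_next] in terms of [fast] instead of ray coordinates. *)
Lemma fast_step Q rho c P d : on Q -> on P -> good Q rho c -> near Q rho P ->
  safe P d -> near Q rho (next P d) -> fast Q c P -> fast Q c (next P d).
Proof.
move=> Qon Pon gd nr sf nr' [h [w0 [v0 [w0W Pw0 Dv0 v0big]]]].
have [w [v rc]] := ray_coords_ex Qon Pon gd nr.
have c0 := good_c gd; have v0_gt0 : 0 < v0 by lra.
apply: (fast_next Qon Pon gd rc (safe_gt0 sf) nr' (safe_next_on Pon sf) sf).
suff vv : v h = v0 by exists h; rewrite vv.
have nv : `|v h| = v0.
  by rewrite -(nrm_dir _ (rc_dir rc h)) -(rc_velo rc) Dv0 nrm_dir// gtr0_norm.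
have [s0|s0] := eqVneq (nrm (P h - Q h)) 0.
  by rewrite -nv ger0_norm// (rc_out rc s0).
have sgt : 0 < nrm (P h - Q h) by rewrite lt_neqAle eq_sym s0 nrm_ge0.
have ww : w h = w0.
  by apply: (dir_inj sgt); apply: (addrI (Q h)); rewrite -(rc_pos rc) -Pw0.
have /eqP : (v h - v0) *: w0 = 0 by rewrite scalerBl -Dv0 -ww -(rc_velo rc) subrr.
rewrite scaler_eq0 subr_eq0 => /orP[/eqP//|/eqP w00].
by have := dirs_unit w0W; rewrite w00 nrm0 => /eqP; rewrite eq_sym oner_eq0.
Qed.

(** The speed of a sensor at its place in [Q] is a slope at [Q], hence at least
    [c] by [good_gap]. *)
Lemma landed_fast Q rho c P h : on P -> good Q rho c -> P h = Q h ->
  velo P h != 0 -> fast Q c P.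
Proof.
move=> Pon gd PQ D0; have [/eqP|[w [v [wW v0 _ Dv sl]]]] := velo_spec h Pon.
  by rewrite (negPf D0).
exists h, w, v; split=> //; first by rewrite PQ subrr nrm0 scale0r addr0.
have : c <= slope (cell P h) (Q h) w by apply: (good_gap gd) => //; rewrite -PQ -[slope _ _ _]sl.
by rewrite -PQ -[slope _ _ _]sl; have := good_c gd; lra.
Qed.

Lemma objective_near Q rho P M : on Q -> on P -> (forall h, is_star (Q h) rho) ->
  (forall h, nrm (P h - Q h) <= M) -> M <= rho ->
  `|H P - H Q| <= (size C)%:R * (spd S * M).
Proof.
move=> Qon Pon st PM Mr; have sp0 := ltW (spd_gt0 S).
rewrite /H -sumrB.
have -> : (size C)%:R * (spd S * M) = \sum_(b <- C) spd S * M.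
  by rewrite big_const_seq count_predT iter_addr_0 mulr_natl.
apply: le_trans (ler_norm_sum _ _ _) _.
rewrite big_seq [leRHS]big_seq; apply: ler_sum => b bC.
have ub i : `|util b (P i) - util b (Q i)| <= spd S * M.
  apply: le_trans (util_near Qon Pon (st i) bC (le_trans (PM i) Mr)) _.
  by rewrite ler_wpM2l.
have := ub (owner P b); have := ub (owner Q b).
have := best_util P (owner Q b) bC; have := best_util Q (owner P b) bC.
by rewrite !ler_norml; lra.
Qed.

(** Both configurations that define the excess are as close to [Q] as [P]. *)
Lemma excess_small Q rho c kappa P M : on Q -> on P -> good Q rho c ->
  (forall h, nrm (P h - Q h) <= M) -> M < rho -> excess Q kappa P ->
  kappa <= 2 * (size C)%:R * spd S * M.
Proof.
move=> Qon Pon gd PM Mr [Y [Ybt HY]].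
have [w [v rc]] := ray_coords_ex Qon Pon gd (fun h => le_lt_trans (PM h) Mr).
have YE h : exists2 t : R, 0 <= t <= nrm (P h - Q h) & Y h = Q h + t *: w h.
  have [t /andP[t0 t1] ->] := Ybt h; exists (t * nrm (P h - Q h)).
    by rewrite mulr_ge0 ?nrm_ge0//= -[leRHS]mul1r ler_wpM2r// nrm_ge0.
  by rewrite {1}(rc_pos rc) [Q h + _ - _]addrC addKr scalerA.
have Yon : on Y.
  by move=> h; have [t tP ->] := YE h; apply: (rc_path rc); have := rc_lt rc h; lra.
have YM h : nrm (Y h - Q h) <= M.
  have [t tP ->] := YE h; rewrite nrm_ray ?(rc_dir rc)// ger0_norm; last by lra.
  by have := PM h; lra.
have := objective_near Qon Pon (good_star gd) PM (ltW Mr).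
have := objective_near Qon Yon (good_star gd) YM (ltW Mr).
by rewrite !ler_norml; lra.
Qed.

Lemma almost_maximal (u : nat -> R) B om : (forall n, u n <= B) -> 0 < om ->
  exists k0, forall k, u k <= u k0 + om.
Proof.
move=> uB om0; have hs : has_sup [set u n | n in setT].
  by split; [exists (u 0%N), 0%N|exists B => _ [n _ <-]].
have [_ [k0 _ <-] k0P] := sup_adherent om0 hs.
have uk k : u k <= sup [set u n | n in setT] by apply: ub_le_sup; [case: hs|exists k].
by exists k0 => k; have := uk k; lra.
Qed.

Section FullSteps.
Variables (x : nat -> conf) (dl : nat -> R).
Hypothesis x0on : on (x 0).
Hypothesis xS : forall k, x k.+1 = next (x k) (dl k).
Hypothesis xfull : forall k, full (x k) (dl k).

Lemma full_on k : on (x k).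
Proof.
by elim: k => // k IH; rewrite xS; case: (xfull k) => sf _; exact: safe_next_on.
Qed.

Lemma full_reach k j : reach (x k) 0 (x (k + j)).
Proof.
elim: j => [|j IH]; first by rewrite addn0; exact: reach_refl.
by rewrite addnS xS; apply: reach_safe => //; case: (xfull (k + j)).
Qed.

(** Full steps have length zero as far as boxed steps are concerned, and their
    gains are summable; so [confined] keeps the sequence near a cluster point. *)
Lemma full_cvg : exists2 Q, on Q & forall b, 0 < b -> exists k0, forall k, (k0 <= k)%N ->
  forall h, nrm (x k h - Q h) <= b.
Proof.
have [Q [Qon Qcl]] := pts_seq_cluster (fun k => full_on k).
exists Q => // b b0; have [e [om [lam [e0 om0 lam0 conf]]]] := confined Qon b0.
have [B HB] := objective_bounded S.
have [k0 k0P] : exists k0, forall k, H (x k) <= H (x k0) + om.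
  by apply: (@almost_maximal (fun k => H (x k)) B) => // n; exact/HB/full_on.
have [k1 k01 k1e] := Qcl e k0 e0.
exists k1 => k k1k h; rewrite -(subnKC k1k).
apply: (conf (x k1) 0) => //; [exact: full_on|exact: full_reach| |exact: ltW|].
  by move=> i; exact/ltW/k1e.
have := k0P (k1 + (k - k1))%N.
by have [_ _] := reach_facts (full_on k0) (full_reach k0 (k1 - k0)); rewrite subnKC//; lra.
Qed.

(** Along full steps the velocities have arbitrarily small values. The steps
    converge, hence near the limit they have no excess over it, so they only
    approach it; each sensor then reaches a stop at most once, and the other
    steps have the length [tau]. *)
Lemma full_velo_small e : 0 < e -> exists k, forall h, nrm (velo (x k) h) <= e.
Proof.
move=> e0; have [Q Qon cvg] := full_cvg.
have [c [rho rho0 gdr]] := good_ex Qon; have gd := gdr _ rho0 (lexx _).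
have [k0 k0P] := cvg (rho / 2) (divr_gt0 rho0 (ltr0n _ 2)).
have nr k : (k0 <= k)%N -> near Q rho (x k).
  by move=> kk h; apply: le_lt_trans (k0P k kk h) _; lra.
(* An excess would persist up to the limit, where it vanishes. *)
have noexc kappa k : 0 < kappa -> (k0 <= k)%N -> ~ excess Q kappa (x k).
  move=> kap0 kk exc.
  have {}exc j : excess Q kappa (x (k + j)).
    elim: j => [|j IH]; first by rewrite addn0.
    have kj : (k0 <= k + j)%N by rewrite (leq_trans kk)// leq_addr.
    have [w [v rc]] := ray_coords_ex Qon (full_on _) gd (nr _ kj).
    have [sf _] := xfull (k + j); rewrite addnS xS.
    apply: (excess_safe (full_on _) gd rc (safe_gt0 sf)) => //.
      by rewrite -xS; apply: nr; exact: leqW.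
    exact: safe_next_on (full_on _) sf.
  pose D := 2 * (size C)%:R * spd S + 1 : R.
  have D0 : 0 < D by rewrite ltr_wpDl// !mulr_ge0// ltW// spd_gt0.
  pose M := Num.min (rho / 2) (kappa / 2 / D).
  have M0 : 0 < M by rewrite lt_min !divr_gt0.
  have MD : M * D <= kappa / 2 by rewrite -ler_pdivlMr// ge_min lexx orbT.
  have Mr : M < rho by rewrite gt_min; apply/orP; left; lra.
  have [k1 k1P] := cvg M M0.
  have := excess_small Qon (full_on (k + k1)) gd (k1P _ (leq_addl _ _)) Mr (exc k1).
  by rewrite /D in MD; lra.
pose inwards k := forall h, nrm (x k h - Q h) = 0 -> velo (x k) h = 0.
have inw k : (k0 <= k)%N -> inwards k.
  move=> kk h s0; have [w [v rc]] := ray_coords_ex Qon (full_on _) gd (nr _ kk).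
  have [sf _] := xfull k.
  rewrite (rc_velo rc); have [v0|v0] := ltP 0 (v h); last first.
    by rewrite (le_anti (_ : v h <= 0 <= v h)) ?scale0r// v0 (rc_out rc s0).
  have nx : near Q rho (next (x k) (dl k)) by rewrite -xS; apply: nr; exact: leqW.
  have [kap kap0 exc] := excess_outward (full_on _) gd rc (safe_gt0 sf) nx
    (safe_next_on (full_on _) sf) sf (or_introl v0).
  by exfalso; apply: (noexc kap k.+1 kap0 (leqW kk)); rewrite xS.
pose L k : {set 'I_m} := finset (fun h => x k h == Q h).
have atQ k h : (x k h == Q h) = (nrm (x k h - Q h) == 0).
  rewrite -subr_eq0; apply/eqP/eqP => [->|]; [exact: nrm0|exact: nrm_eq0].
(* The sensors at their places in [Q] stay there, as [inw] shows. *)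
have Lsub k : (k0 <= k)%N -> L k \subset L k.+1.
  move=> kk; apply/fintype.subsetP => h; rewrite !inE => /[dup] /eqP xQ.
  rewrite atQ => /eqP /(inw _ kk) D0.
  by rewrite xS /next /advance D0 scaler0 addr0 xQ.
have hitL k : (k0 <= k)%N -> dl k <> tau S -> (#|L k| < #|L k.+1|)%N.
  move=> kk dt; have [sf [//|[h [D0 nst]]]] := xfull k.
  apply: proper_card; apply/properP; split; first exact: Lsub.
  exists h; rewrite inE; last first.
    by apply/negP => /[dup] /eqP xQ; rewrite atQ => /eqP /(inw _ kk) D00; rewrite D00 eqxx in D0.
  have := (good_star gd h).2 _ nst; rewrite -xS => ->//.
  by apply: ltW; apply: nr; exact: leqW.
(* Each shorter step brings a new sensor to its place in [Q], a stop. *)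
have tau_step k : (k0 <= k)%N -> exists2 j, (k <= j)%N & dl j = tau S.
  move=> kk; apply: contrapT => nex.
  have grow j : (j <= #|L (k + j)|)%N.
    elim: j => // j IH; apply: leq_ltn_trans IH _; rewrite addnS; apply: hitL.
      by rewrite (leq_trans kk)// leq_addr.
    by move=> dt; apply: nex; exists (k + j)%N => //; exact: leq_addr.
  have := grow m.+1; rewrite leqNgt => /negP; apply; rewrite ltnS.
  by rewrite (leq_trans (max_card _))// card_ord.
have t0 := tau_gt0 S.
have [k1 k1P] := cvg (e * tau S / 2) (divr_gt0 (mulr_gt0 e0 t0) (ltr0n _ 2)).
have [j kj jt] := tau_step (maxn k0 k1) (leq_maxl _ _).
have k1j : (k1 <= j)%N by exact: leq_trans (leq_maxr _ _) kj.
exists j => h; rewrite -(ler_pM2l t0) -(next_dist (x j) h (ltW t0)) -{1}jt -xS.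
have -> : x j.+1 h - x j h = (x j.+1 h - Q h) + (Q h - x j h) by rewrite addrA subrK.
apply: le_trans (nrmD _ _) _; rewrite (nrmB_sym (Q h)).
by have := k1P j k1j h; have := k1P j.+1 (leqW k1j) h; lra.
Qed.

End FullSteps.

Lemma full_choice : exists F : conf -> R, forall P, on P -> full P (F P).
Proof.
have /choice[F FP] : forall P, exists d, on P -> full P d.
  move=> P; have [Pon|nP] := pselect (on P); last by exists 0.
  by have [d dP] := full_ex Pon; exists d.
by exists F.
Qed.

(** A fast outward motion would persist along full steps, in contradiction with
    [full_velo_small]. *)
Lemma not_fast Q rho c P : on Q -> on P -> good Q rho c ->
  (forall X, reach P 0 X -> near Q rho X) -> ~ fast Q c P.
Proof.
move=> Qon Pon gd conf fP; have [F FP] := full_choice.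
pose x k := iter k (fun X => next X (F X)) P.
have xon k : on (x k).
  by elim: k => // k IH; have [sf _] := FP _ IH; exact: safe_next_on.
have xfull k : full (x k) (F (x k)) by exact: FP.
have xreach k : reach P 0 (x k) by have := @full_reach x _ (fun=> erefl) xfull 0 k.
have xfast k : fast Q c (x k).
  elim: k => // k IH; have [sf _] := xfull k.
  apply: (fast_step Qon (xon k) gd) => //; first exact: conf.
  exact: (conf (x k.+1)).
have c0 := good_c gd.
have [k kP] := @full_velo_small x _ Pon (fun=> erefl) xfull (c / 4) (divr_gt0 c0 (ltr0n _ 4)).
have [h [w [v [wW _ Dv vbig]]]] := xfast k.
have := kP h; rewrite Dv nrm_dir// => /(le_trans (ler_norm _)); lra.
Qed.

End Trajectories.

(** * Reaching a configuration at rest *)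

Section Reachability.
Context {R : realType} {m : nat} {S : ascent_system R m}.
Notation E := (space S).
Notation conf := ('I_m -> E).
Notation N := (pts S).
Notation C := (labels S).
Notation H := (@objective R m S).
Implicit Types (P X Y Z Q : conf).
Implicit Types (c d e r rho kappa k lam : R).

(** The total length of the boxed steps is paid by the gain. *)
Definition leadsto k P X := exists2 c, reach P c X & c <= k * (H X - H P).

Lemma leadsto_refl k P : leadsto k P P.
Proof. by exists 0; [exact: reach_refl|rewrite subrr mulr0]. Qed.

Lemma leadsto_trans k P X Y : leadsto k P X -> leadsto k X Y -> leadsto k P Y.
Proof.
move=> [c PX cX] [c' XY c'Y]; exists (c + c'); first exact: reach_trans PX XY.
by lra.
Qed.

Variable F : conf -> R.
Hypothesis FP : forall P, on P -> full P (F P).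

(** Sequences that make a full step and then gain almost as much as they can. *)
Definition terminal k (y : nat -> conf) := forall n, [/\ on (y n),
  leadsto k (next (y n) (F (y n))) (y n.+1) &
  forall X, leadsto k (y n.+1) X -> H X <= H (y n.+1) + n.+1%:R^-1].

Definition cluster (y : nat -> conf) Q := on Q /\ forall e n0, 0 < e ->
  exists2 n, (n0 <= n)%N & forall h, nrm (y n h - Q h) < e.

(** After each full step take a nearly optimal configuration among those that it
    leads to. *)
Lemma terminal_ex k P : on P -> exists y, y 0%N = P /\ terminal k y.
Proof.
move=> Pon; have [B HB] := objective_bounded S.
have /choice[G GP] : forall nY : nat * conf, exists Y', on nY.2 -> [/\ on Y',
    leadsto k (next nY.2 (F nY.2)) Y' &
    forall X, leadsto k Y' X -> H X <= H Y' + nY.1.+1%:R^-1].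
  move=> [n Y] /=; have [Yon|nY] := pselect (on Y); last by exists Y.
  have [sf _] := FP Yon; set Y1 := next Y (F Y).
  have Y1on : on Y1 by exact: safe_next_on.
  have hs : has_sup [set H X | X in leadsto k Y1].
    split; first by exists (H Y1), Y1 => //; exact: leadsto_refl.
    by exists B => _ [X [c rX _] <-]; apply: HB; case: (reach_facts Y1on rX).
  have n0 : (0 : R) < n.+1%:R^-1 by rewrite invr_gt0 ltr0n.
  have [_ [Y' lY' <-] Y'P] := sup_adherent n0 hs.
  exists Y' => _; split=> //; first by case: lY' => c rY' _; case: (reach_facts Y1on rY').
  move=> X lX; have : H X <= sup [set H X | X in leadsto k Y1].
    by apply: ub_le_sup; [case: hs|exists X => //; exact: leadsto_trans lX].
  by move=> /le_trans; apply; rewrite -lerBlDr; exact: ltW.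
pose y := fix y n := if n is n'.+1 then G (n', y n') else P.
have yon n : on (y n) by elim: n => // n IH; case: (GP (n, y n) IH).
exists y; split=> // n; split=> //; by case: (GP (n, y n) (yon n)).
Qed.

Section Terminal.
Variables (k : R) (y : nat -> conf) (Q : conf).
Hypotheses (k0 : 0 < k) (ter : terminal k y) (clu : cluster y Q).

Let yon n : on (y n). Proof. by case: (ter n). Qed.
Let Qon : on Q. Proof. by case: clu. Qed.

Lemma terminal_step n : exists2 c, reach (next (y n) (F (y n))) c (y n.+1) &
  c <= k * (H (y n.+1) - H (y n)).
Proof.
have [_ [c r cle] _] := ter n; exists c => //; apply: le_trans cle _.
have [sf _] := FP (yon n); have := boxed_le (safe_boxed (yon n) sf).
by rewrite ler_pM2l// lerD2l lerN2.
Qed.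

Lemma reach_full n : reach (y n) 0 (next (y n) (F (y n))).
Proof. by apply: reach_safe; [exact: reach_refl|case: (FP (yon n))]. Qed.

Lemma terminal_leadsto n j : leadsto k (y n) (y (n + j)%N).
Proof.
elim: j => [|j IH]; first by rewrite addn0; exact: leadsto_refl.
apply: leadsto_trans IH _; rewrite addnS; have [c r cle] := terminal_step (n + j).
by exists c => //; rewrite -(add0r c); exact: reach_trans (reach_full _) r.
Qed.

(** The configuration [y n] is optimal up to [1 / n]. *)
Lemma terminal_gain e : 0 < e -> exists n0, forall n X, (n0 <= n)%N ->
  leadsto k (y n) X -> H X - H (y n) <= e.
Proof.
move=> e0; have [n0 n0e] : exists n0 : nat, n0.+1%:R^-1 <= e.
  have ie : 0 < e^-1 by rewrite invr_gt0.
  exists (Num.bound e^-1); rewrite -[leRHS]invrK lef_pV2 ?posrE// ?ltr0n//.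
  by apply: le_trans (ltW (archi_boundP (ltW ie))) _; rewrite ler_nat.
exists n0.+1 => -[//|n] X nn lX; have [_ _ /(_ X lX) HX] := ter n.
rewrite lerBlDl; apply: le_trans HX _; rewrite lerD2l; apply: le_trans n0e.
by rewrite lef_pV2 ?posrE ?ltr0n// ler_nat.
Qed.

Lemma terminal_confined_from b : 0 < b -> exists e lam n0, [/\ 0 < e, 0 < lam &
  forall n, (n0 <= n)%N -> (forall h, nrm (y n h - Q h) <= e) ->
  forall c X, reach (y n) c X -> c <= lam -> forall h, nrm (X h - Q h) <= b].
Proof.
move=> b0; have [e [om [lam [e0 om0 lam0 conf]]]] := confined Qon b0.
have [n0 n0P] := terminal_gain om0.
exists e, (Num.min lam (k * om)), n0; split=> //; first by rewrite lt_min lam0 mulr_gt0.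
move=> n nn ye c X rX; rewrite le_min => /andP[cl ck].
apply: (conf (y n) c) => //; rewrite leNgt; apply/negP => big.
have : leadsto k (y n) X.
  by exists c => //; apply: le_trans ck _; rewrite ler_pM2l// ltW.
by move=> /(n0P n X nn); lra.
Qed.

(** From a term of the sequence close to [Q], all the later ones are reached with
    small gain and hence small length. *)
Lemma terminal_cvg b : 0 < b -> exists n0, forall n, (n0 <= n)%N ->
  forall h, nrm (y n h - Q h) <= b.
Proof.
move=> b0; have [e [lam [n0 [e0 lam0 conf]]]] := terminal_confined_from b0.
have [n1 n1P] := terminal_gain (divr_gt0 lam0 k0).
have [_ /(_ e (maxn n0 n1) e0)[n2 n2n n2e]] := clu.
move: n2n; rewrite geq_max => /andP[n02 n12].
exists n2 => n n2n; rewrite -(subnKC n2n).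
have [c r cle] := terminal_leadsto n2 (n - n2).
apply: (conf n2 n02 _ c) => // [h|]; first exact/ltW/n2e.
apply: le_trans cle _; rewrite mulrC -ler_pdivlMr//.
by apply: n1P => //; exact: terminal_leadsto.
Qed.

Lemma terminal_confined b : 0 < b -> exists lam n0, 0 < lam /\
  forall n, (n0 <= n)%N -> forall c X, reach (y n) c X -> c <= lam ->
  forall h, nrm (X h - Q h) <= b.
Proof.
move=> b0; have [e [lam [n0 [e0 lam0 conf]]]] := terminal_confined_from b0.
have [n1 n1P] := terminal_cvg e0.
exists lam, (maxn n0 n1); split=> // n; rewrite geq_max => /andP[n0n n1n].
by apply: conf => //; exact: n1P.
Qed.

End Terminal.

(** Sensors that are at their place in [Q] stay there in a confined region:
    otherwise they would leave it quickly. *)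
Lemma landed_stay Q rho c0 Y L (A : {set 'I_m}) : on Q -> on Y -> good Q rho c0 ->
  (forall c X, reach Y c X -> c <= L -> near Q rho X) ->
  (forall h, h \in A -> Y h = Q h) ->
  forall c X, reach Y c X -> c <= L -> forall h, h \in A -> X h = Q h /\ velo X h = 0.
Proof.
move=> Qon Yon gd conf YA.
have rest c X h : reach Y c X -> c <= L -> X h = Q h -> velo X h = 0.
  move=> rX cL XQ; have [Xon _ _] := reach_facts Yon rX.
  apply/eqP/negPn/negP => D0; apply: (@not_fast R m S Q rho c0 X Qon Xon gd).
    move=> X' rX'; apply: (conf c) => //; rewrite -[c]addr0; exact: reach_trans rX rX'.
  exact: landed_fast gd XQ D0.
suff stay c X : reach Y c X -> c <= L -> forall h, h \in A -> X h = Q h.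
  move=> c X rX cL h hA; have XQ := stay c X rX cL h hA.
  by split=> //; exact: rest rX cL XQ.
elim=> {c X} [|c X d rX IH sf|c X d rX IH bx] cL h hA; first exact: YA.
  have XQ := IH cL h hA.
  by rewrite /next /advance (rest c X h rX cL XQ) scaler0 addr0.
have len : 0 <= length X d by apply: length_ge0; case: bx => /ltW.
have cL' : c <= L by lra.
have XQ := IH cL' h hA.
by rewrite /next /advance (rest c X h rX cL' XQ) scaler0 addr0.
Qed.

Lemma boxed_sub P d d' : boxed P d -> 0 < d' -> d' <= d -> boxed P d'.
Proof.
move=> [d0 pth bx] d'0 d'd; split=> // [h|t td]; first exact: path_in_sub (pth h) d'd.
by apply: bx => h; have := td h; lra.
Qed.

Lemma length_le P d d' : d' <= d -> length P d' <= length P d.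
Proof. by move=> dd; rewrite ler_wpM2r// sumr_ge0// => h _; exact: nrm_ge0. Qed.

Section Landing.
Variables (k : R) (y : nat -> conf) (Q : conf) (A : {set 'I_m}).
Hypotheses (k0 : 0 < k) (ter : terminal k y) (clu : cluster y Q).
Hypothesis yA : forall n h, h \in A -> y n h = Q h.
Hypothesis noncrit : forall n, exists h, velo (y n) h <> 0.

Let yon n : on (y n). Proof. by case: (ter n). Qed.
Let Qon : on Q. Proof. by case: clu. Qed.

(** Either a boxed step makes a sensor pass through its place in [Q], and it can be
    stopped there, or nothing near the limit has an excess over it; then any
    displacement towards [Q] is a boxed step. *)
Lemma landing lam : 0 < lam -> forall n0, exists n c X, [/\ (n0 <= n)%N,
  reach (y n) c X, c <= lam, (forall h, h \in A -> X h = Q h) &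
  exists2 h, h \notin A & X h = Q h].
Proof.
move=> lam0 n0; apply: contrapT => noland.
have [c0 [rho rho0 gdr]] := good_ex Qon; have gd := gdr _ rho0 (lexx _).
have r2 : 0 < rho / 2 by rewrite divr_gt0.
have [lam1 [n1 [lam1_gt0 conf]]] := terminal_confined k0 ter clu r2.
pose l := Num.min lam lam1.
have l0 : 0 < l by rewrite lt_min lam0.
have [ll ll1] : l <= lam /\ l <= lam1 by rewrite !ge_min !lexx orbT.
have [n2 n2P] := terminal_gain ter (divr_gt0 l0 k0).
pose n3 := maxn n0 (maxn n1 n2).
have n3P n : (n3 <= n)%N -> [/\ (n0 <= n)%N, (n1 <= n)%N & (n2 <= n)%N].
  by rewrite !geq_max => /andP[-> /andP[-> ->]].
have nr n c X : (n3 <= n)%N -> reach (y n) c X -> c <= l -> near Q rho X.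
  move=> /n3P[_ n1n _] rX cl h; apply: le_lt_trans (conf n n1n c X rX (le_trans cl ll1) h) _.
  by lra.
have stay n c X h : (n3 <= n)%N -> reach (y n) c X -> c <= l -> h \in A ->
    X h = Q h /\ velo X h = 0.
  move=> nn rX cl hA; apply: (landed_stay Qon (yon n) gd _ (yA n) rX cl hA).
  by move=> c' X' rX' cl'; exact: nr rX' cl'.
have away n c X h : (n3 <= n)%N -> reach (y n) c X -> c <= l -> h \notin A -> X h <> Q h.
  move=> nn rX cl hA XQ; apply: noland; exists n, c, X; split=> //.
  - by case: (n3P n nn).
  - exact: le_trans cl ll.
  - by move=> h' h'A; case: (stay n c X h' nn rX cl h'A).
  - by exists h.
(* A boxed step that goes through a place in [Q] would land if cut short there. *)
have exc_reach n c1 Y kappa : (n3 <= n)%N -> reach (y n) c1 Y -> excess Q kappa Y ->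
    forall c2 X, reach Y c2 X -> c1 + c2 <= l -> excess Q kappa X.
  move=> nn rY eY c2 X; have [Yon c10 _] := reach_facts (yon n) rY.
  elim=> {c2 X} [//|c2 X d rX IH sf|c2 X d rX IH bx] cl.
    have [Xon _ _] := reach_facts Yon rX; have rX' := reach_trans rY rX.
    have [w [v rc]] := ray_coords_ex Qon Xon gd (nr n _ X nn rX' cl).
    apply: (excess_safe Xon gd rc (safe_gt0 sf)) => //.
    - exact: nr nn (reach_safe rX' sf) cl.
    - exact: safe_next_on.
    - exact: IH.
  have d0 : 0 < d by case: bx.
  have len := length_ge0 X (ltW d0).
  have cl' : c1 + c2 <= l by lra.
  have [Xon _ _] := reach_facts Yon rX; have rX' := reach_trans rY rX.
  have [w [v rc]] := ray_coords_ex Qon Xon gd (nr n _ X nn rX' cl').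
  have rN := reach_boxed rX' bx; rewrite -addrA in rN.
  apply: (excess_boxed gd rc d0 (nr n _ _ nn rN cl) bx); last exact: IH.
  move=> h; rewrite leNgt; apply/negP => cross.
  have s0 := rc_ge0 rc h.
  have vlt : v h < 0.
    rewrite ltNge; apply/negP => v0; move: cross; rewrite ltNge => /negP; apply.
    by rewrite addr_ge0// mulr_ge0// ltW.
  have sgt : 0 < nrm (X h - Q h).
    rewrite lt_neqAle s0 andbT eq_sym; apply/eqP => /(rc_out rc).
    by rewrite leNgt vlt.
  pose t : R := nrm (X h - Q h) / - v h.
  have t0 : 0 < t by rewrite divr_gt0// oppr_gt0.
  have td : t <= d by rewrite ler_pdivrMr ?oppr_gt0//; lra.
  have bt := boxed_sub bx t0 td.
  have hA : h \notin A.
    apply/negP => hA; case: (stay n _ X h nn rX' cl' hA) => _ D0.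
    have := rc_velo rc h; rewrite D0 => /esym/eqP; rewrite scaler_eq0 lt_eqF//= => /eqP w0.
    by have := dirs_unit (rc_dir rc h); rewrite w0 nrm0 => /eqP; rewrite eq_sym oner_eq0.
  apply: (away n _ _ h nn (reach_boxed rX' bt) _ hA).
    by have := length_le X td; lra.
  rewrite /next /advance (rc_velo rc) {1}(rc_pos rc) scalerA -addrA -scalerDl.
  rewrite /t invrN mulrN mulNr divfK ?lt_eqF// subrr scale0r addr0//.
have step_cost n : (n3 <= n)%N -> exists2 c, reach (next (y n) (F (y n))) c (y n.+1) & c <= l.
  move=> nn; have [c r cle] := terminal_step k0 ter n; exists c => //.
  apply: le_trans cle _; rewrite mulrC -ler_pdivlMr//; have [_ _ n2n] := n3P n nn.
  by apply: n2P => //; have := terminal_leadsto k0 ter n 1; rewrite addn1.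
(* An excess would persist up to the limit, where it vanishes. *)
have noexc kappa n : 0 < kappa -> (n3 <= n)%N -> ~ excess Q kappa (y n).
  move=> kap0 nn exc.
  have {}exc j : excess Q kappa (y (n + j)%N).
    elim: j => [|j IH]; first by rewrite addn0.
    have nj : (n3 <= n + j)%N by rewrite (leq_trans nn)// leq_addr.
    have [c r cl] := step_cost _ nj; rewrite addnS.
    apply: (exc_reach (n + j)%N 0 (y (n + j)%N) kappa nj (reach_refl _) IH c).
      by rewrite -(add0r c); apply: reach_trans r; exact: reach_full.
    by rewrite add0r.
  pose D := 2 * (size C)%:R * spd S + 1 : R.
  have D0 : 0 < D by rewrite ltr_wpDl// !mulr_ge0// ltW// spd_gt0.
  pose M := Num.min (rho / 2) (kappa / 2 / D).
  have M0 : 0 < M by rewrite lt_min !divr_gt0.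
  have MD : M * D <= kappa / 2 by rewrite -ler_pdivlMr// ge_min lexx orbT.
  have Mr : M < rho by rewrite gt_min; apply/orP; left; lra.
  have [k1 k1P] := terminal_cvg k0 ter clu M0.
  have := excess_small Qon (yon _) gd (k1P _ (leq_addl n k1)) Mr (exc k1).
  by rewrite /D in MD; lra.
pose M := Num.min (rho / 2) (l / (m%:R + 1)).
have m1 : 0 < m%:R + 1 :> R by rewrite ltr_wpDl.
have M0 : 0 < M by rewrite lt_min !divr_gt0.
have Ml : M * (m%:R + 1) <= l by rewrite -ler_pdivlMr// ge_min lexx orbT.
have [n4 n4P] := terminal_cvg k0 ter clu M0.
pose n := maxn n3 n4; have nn : (n3 <= n)%N by exact: leq_maxl.
have yM := n4P n (leq_maxr _ _).
have rn : reach (y n) 0 (y n) by exact: reach_refl.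
have [w [v rc]] := ray_coords_ex Qon (yon n) gd (nr n 0 (y n) nn rn (ltW l0)).
have [sf _] := FP (yon n).
(* An outward motion would create an excess. *)
have out h : v h <= 0.
  rewrite leNgt; apply/negP => v0.
  have rf := reach_full ter n.
  have [kap kap0 exc] := excess_outward (yon n) gd rc (safe_gt0 sf)
    (nr n _ _ nn rf (ltW l0)) (safe_next_on (yon n) sf) sf (or_introl v0).
  have [c r cl] := step_cost n nn.
  apply: (noexc kap n.+1 kap0 (leqW nn)).
  by apply: (exc_reach n 0 _ kap nn rf exc c) => //; rewrite add0r.
have s_gt0 h : v h < 0 -> 0 < nrm (y n h - Q h).
  move=> vlt; rewrite lt_neqAle nrm_ge0 andbT eq_sym; apply/eqP => /(rc_out rc).
  by rewrite leNgt vlt.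
(* The times at which the sensors that move arrive at their places in [Q]. *)
pose ts : seq R := [seq nrm (y n h - Q h) / - v h | h <- enum 'I_m & v h < 0].
have in_ts h : v h < 0 -> nrm (y n h - Q h) / - v h \in ts.
  by move=> vlt; apply/mapP; exists h => //; rewrite mem_filter vlt mem_enum.
have [h0 D0] := noncrit n.
have vh0 : v h0 < 0.
  rewrite lt_neqAle out andbT; apply/eqP => v0; apply: D0.
  by rewrite (rc_velo rc) v0 scale0r.
case: {-1}ts (erefl ts) => [|x0 s' es]; first by move=> es; have := in_ts _ vh0; rewrite es.
have [t] := min_of_seq x0 s'; rewrite -es => /mapP[h1 + tE] tmin.
rewrite mem_filter => /andP[vh1 _].
have t0 : 0 < t by rewrite tE divr_gt0 ?s_gt0// oppr_gt0.
have tv h : t * - v h <= nrm (y n h - Q h).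
  have := out h; rewrite le_eqVlt => /predU1P[->|vlt].
    by rewrite oppr0 mulr0 nrm_ge0.
  by rewrite -ler_pdivlMr ?oppr_gt0//; exact/tmin/in_ts.
have posE (x : R) h : y n h + x *: velo (y n) h = Q h + (nrm (y n h - Q h) + x * v h) *: w h.
  by rewrite (rc_velo rc) {1}(rc_pos rc) scalerA -addrA -scalerDl.
have coord (x : R) h : 0 <= x <= t -> 0 <= nrm (y n h - Q h) + x * v h <= nrm (y n h - Q h).
  move=> /andP[x0' xt]; have := tv h.
  have : x * - v h <= t * - v h by rewrite ler_wpM2r// oppr_ge0.
  have : 0 <= x * - v h by rewrite mulr_ge0// oppr_ge0.
  by lra.
(* A smaller value of [H] in the box would be an excess of [y n]. *)
have bx : boxed (y n) t.
  split=> // [h x xt|x xt].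
    rewrite posE; apply: (rc_path rc); have := rc_lt rc h; have := coord x h xt.
    by lra.
  rewrite leNgt; apply/negP => lt.
  apply: (noexc (H (y n) - H (advance (y n) x)) n); rewrite ?subr_gt0//.
  exists (advance (y n) x); split; last by rewrite subKr.
  move=> h; rewrite /advance posE.
  have /(between_ray (Q h) (w h))[u u01 uE] := coord _ h (xt h).
  by exists u; rewrite // uE -(rc_pos rc).
have cost : 0 + length (y n) t <= l.
  rewrite add0r /length mulr_sumr; apply: le_trans Ml.
  apply: (@le_trans _ _ (\sum_(h < m) M)); last first.
    by rewrite sumr_const card_ord -mulr_natr; lra.
  apply: ler_sum => h _; apply: le_trans (yM h).
  by rewrite (rc_velo rc) nrm_dir ?(rc_dir rc)// ler0_norm ?out.
have rX := reach_boxed rn bx.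
apply: (away n _ _ h1 nn rX cost).
  apply/negP => h1A; have := s_gt0 _ vh1.
  by rewrite yA// subrr nrm0 ltxx.
by rewrite /next /advance posE tE invrN mulrN mulNr divfK ?lt_eqF// subrr scale0r addr0.
Qed.

End Landing.

Section NoCritical.
Variable P0 : conf.
Hypothesis P0on : on P0.
Hypothesis nc : forall c X, reach P0 c X -> exists h, velo X h <> 0.

(** Induction on the number of sensors that have not landed: after a
    landing, a new sequence that is terminal for a smaller constant keeps the landed
    sensors in place. *)
Lemma no_terminal l : forall k y Q (A : {set 'I_m}), 0 < k -> terminal k y ->
  (exists c, reach P0 c (y 0%N)) -> cluster y Q -> (forall n h, h \in A -> y n h = Q h) ->
  (#|~: A| <= l)%N -> False.
Proof.
elim: l => [|l IH] k y Q A k0 ter [c00 r0] clu yA Al.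
all: have yon n : on (y n) by case: (ter n).
all: have ry n : exists c, reach P0 c (y n) by
  have [c r _] := terminal_leadsto k0 ter 0 n; exists (c00 + c); exact: reach_trans r.
all: have noncrit n : exists h, velo (y n) h <> 0 by have [c /nc] := ry n.
  have [n [c [X [_ _ _ _ [h hA _]]]]] := landing k0 ter clu yA noncrit ltr01 0.
  by have := Al; rewrite leqn0 cards_eq0 => /eqP/setP/(_ h); rewrite !inE hA.
have Qon : on Q by case: clu.
have [g [rho rho0 gdr]] := good_ex Qon; have gd := gdr _ rho0 (lexx _).
have r2 : 0 < rho / 2 by rewrite divr_gt0.
have [lam [n1 [lam0 conf]]] := terminal_confined k0 ter clu r2.
have [n2 n2P] := terminal_gain ter (divr_gt0 lam0 k0).
have lam2 : 0 < lam / 2 by rewrite divr_gt0.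
have [n [c1 [X [nn rX c1l XA [h hA Xh]]]]] := landing k0 ter clu yA noncrit lam2 (maxn n1 n2).
move: nn; rewrite geq_max => /andP[n1n n2n].
have [Xon c10 HX] := reach_facts (yon n) rX.
have k2 : 0 < k / 2 by rewrite divr_gt0.
have [z [z0 zter]] := terminal_ex (k / 2) Xon.
have zon i : on (z i) by case: (zter i).
have zl i : leadsto (k / 2) X (z i) by have := terminal_leadsto k2 zter 0 i; rewrite z0.
pose A' := h |: A.
have XA' i : i \in A' -> X i = Q i by rewrite !inE => /predU1P[->//|/XA].
(* A total length [c1 + c2 > lam] would imply [c1 <= c2], and so
   [c1 + c2 <= 2 * c2] would be paid at the rate [k]: this is why [k] is halved. *)
have zA i j : j \in A' -> z i j = Q j.
  move=> jA; have [c2 r2' c2l] := zl i.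
  have cl : c1 + c2 <= lam.
    have rz := reach_trans rX r2'; rewrite leNgt; apply/negP => big.
    have lz : leadsto k (y n) (z i).
      exists (c1 + c2) => //.
      have : k * (H (y n)) <= k * H X by rewrite ler_pM2l.
      by lra.
    have := n2P n _ n2n lz; rewrite ler_pdivlMr// => gl.
    have : k * (H (y n)) <= k * H X by rewrite ler_pM2l.
    by lra.
  have nrX c X' : reach X c X' -> c <= lam - c1 -> near Q rho X'.
    move=> rX' cl' j'.
    by apply: le_lt_trans (conf n n1n _ X' (reach_trans rX rX') _ j') _; lra.
  have c2l' : c2 <= lam - c1 by lra.
  by have [] := landed_stay Qon Xon gd nrX XA' r2' c2l' jA.
have [Q' [Q'on Q'cl]] := pts_seq_cluster zon.
have Q'A j : j \in A' -> Q' j = Q j.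
  move=> jA; apply/eqP; rewrite -subr_eq0; apply/eqP/nrm_eq0/eqP.
  rewrite eq_le nrm_ge0 andbT leNgt; apply/negP => pos.
  have [i _ /(_ j)] := Q'cl _ 0%N pos.
  by rewrite zA// nrmB_sym ltxx.
apply: (IH (k / 2) z Q' A' k2 zter _ _ _ _) => //.
- have [c r] := ry n; exists (c + c1); rewrite z0; exact: reach_trans r rX.
- by move=> i j jA; rewrite zA// Q'A.
have /proper_card/leq_trans/(_ Al) : ~: A' \proper ~: A.
  apply/fintype.properP; split; last by exists h; rewrite !inE// eqxx.
  by apply/fintype.subsetP => i; rewrite !inE negb_or => /andP[].
by [].
Qed.

End NoCritical.
End Reachability.

(** Otherwise there would be a terminal sequence with a cluster point, against
    [no_terminal] with no landed sensor. *)
Theorem critical_reachable (R : realType) (m : nat) (S : ascent_system R m)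
    (P : 'I_m -> space S) : on P ->
  exists c X, reach P c X /\ forall h, velo X h = 0.
Proof.
move=> Pon; apply: contrapT => nex; have [F FP] := @full_choice R m S.
have nc c X : reach P c X -> exists h, velo X h <> 0.
  by move=> rX; apply/existsNP => allr; apply: nex; exists c, X.
have [y [y0 ter]] := terminal_ex FP 1 Pon.
have yon n : on (y n) by case: (ter n).
have [Q [Qon Qcl]] := pts_seq_cluster yon.
have start : exists c, reach P c (y 0%N) by exists 0; rewrite y0; exact: reach_refl.
apply: (no_terminal FP nc ltr01 ter start (conj Qon Qcl) (A := finset.set0)) => //.
by move=> n h; rewrite inE.
Qed.

(** * The Euclidean plane *)

Section Euclid.
Context {R : realType}.
Implicit Types (u v w x y : 'rV[R]_2) (t : R).

Lemma dotE u v : dot u v = u 0 0 * v 0 0 + u 0 1 * v 0 1.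
Proof.
rewrite /dot !big_ord_recl big_ord0 addr0.
by have -> : lift ord0 ord0 = 1 :> 'I_2 by exact/val_inj.
Qed.

Lemma dotC u v : dot u v = dot v u.
Proof. by rewrite !dotE; ring. Qed.

Lemma dotDl u v w : dot (u + v) w = dot u w + dot v w.
Proof. by rewrite !dotE !mxE; ring. Qed.

Lemma dotZl t u v : dot (t *: u) v = t * dot u v.
Proof. by rewrite !dotE !mxE; ring. Qed.

Lemma dotZr t u v : dot u (t *: v) = t * dot u v.
Proof. by rewrite !dotE !mxE; ring. Qed.

Lemma dotDr u v w : dot u (v + w) = dot u v + dot u w.
Proof. by rewrite !dotE !mxE; ring. Qed.

Lemma dotNr u v : dot u (- v) = - dot u v.
Proof. by rewrite !dotE !mxE; ring. Qed.

Lemma dotNl u v : dot (- u) v = - dot u v.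
Proof. by rewrite !dotE !mxE; ring. Qed.

Lemma dot_ge0 u : 0 <= dot u u.
Proof. by rewrite dotE addr_ge0// -expr2 sqr_ge0. Qed.

Lemma enorm_ge0 u : 0 <= enorm u.
Proof. exact: sqrtr_ge0. Qed.

Lemma enorm_sqr u : enorm u ^+ 2 = dot u u.
Proof. by rewrite sqr_sqrtr// dot_ge0. Qed.

Lemma enormZ t u : enorm (t *: u) = `|t| * enorm u.
Proof.
by rewrite /enorm dotZl dotZr mulrA -expr2 sqrtrM ?sqr_ge0// sqrtr_sqr.
Qed.

Lemma enorm_eq0 u : enorm u = 0 -> u = 0.
Proof.
move=> u0; have : dot u u = 0 by rewrite -enorm_sqr u0 expr0n.
rewrite dotE -!expr2 => /eqP; rewrite paddr_eq0 ?sqr_ge0// !sqrf_eq0.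
move=> /andP[/eqP a /eqP b]; apply/rowP => i; rewrite mxE.
by case: i => [[|[|//]] ?]; [rewrite -[RHS]a|rewrite -[RHS]b]; congr (u _ _); exact/val_inj.
Qed.

Lemma enormN u : enorm (- u) = enorm u.
Proof. by rewrite -scaleN1r enormZ normrN1 mul1r. Qed.

Lemma dot_le u v : `|dot u v| <= enorm u * enorm v.
Proof.
rewrite -ler_sqr ?nnegrE ?mulr_ge0 ?enorm_ge0//.
rewrite exprMn !enorm_sqr real_normK ?num_real// !dotE.
have := sqr_ge0 (u 0 0 * v 0 1 - u 0 1 * v 0 0).
by rewrite !expr2; lra.
Qed.

Lemma enormD u v : enorm (u + v) <= enorm u + enorm v.
Proof.
rewrite -ler_sqr ?nnegrE ?addr_ge0 ?enorm_ge0//.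
rewrite sqrrD !enorm_sqr dotDl !dotDr (dotC v u).
by have := le_trans (ler_norm _) (dot_le u v); lra.
Qed.

Lemma dot_subZ t u w : dot w w = 1 ->
  dot (t *: w - u) (t *: w - u) = t ^+ 2 - 2 * t * dot u w + dot u u.
Proof.
by move=> w1; rewrite !(dotDl, dotDr, dotNl, dotNr, dotZl, dotZr) w1 (dotC w); ring.
Qed.

End Euclid.

(** * Local structure of a network *)

Section Geometry.
Context {R : realType} (N : network R).
Notation edge := ('I_(nverts N) * 'I_(nverts N))%type.
Implicit Types (e : edge) (p q w : 'rV[R]_2) (s t rho : R).
Notation len := edge_length.
Notation dir := edge_dir.

Lemma edge_length_gt0 e : e \in edges N -> 0 < len e.
Proof.
move=> eN; rewrite lt_neqAle enorm_ge0 andbT eq_sym; apply/eqP => /enorm_eq0/eqP.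
by rewrite subr_eq0 => /eqP/(@vertex_inj _ N)/esym/eqP; rewrite (negPf (edges_neq eN)).
Qed.

Lemma edge_dir_unit e : e \in edges N -> enorm (dir e) = 1.
Proof.
move=> eN; have l0 := edge_length_gt0 eN.
by rewrite enormZ ger0_norm ?invr_ge0 ?ltW// mulVf// gt_eqF.
Qed.

Lemma edge_diff e : e \in edges N -> vertex e.2 - vertex e.1 = len e *: dir e.
Proof. by move=> eN; rewrite scalerA mulfV ?scale1r// gt_eqF// edge_length_gt0. Qed.

Lemma edge_end e : e \in edges N -> vertex e.1 + len e *: dir e = vertex e.2.
Proof. by move=> eN; rewrite -edge_diff// subrKC. Qed.

Lemma edge_segmP e p : e \in edges N ->
  edge_segm e p <-> exists2 s, 0 <= s <= len e & p = vertex e.1 + s *: dir e.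
Proof.
move=> eN; have l0 := edge_length_gt0 eN; split=> [[t [/andP[t0 t1] ->]]|[s /andP[s0 s1] ->]].
  exists (t * len e); last by rewrite edge_diff// scalerA.
  by rewrite mulr_ge0 ?(ltW l0)//= ger_pMl.
exists (s / len e); split; last by rewrite edge_diff// scalerA divfK// gt_eqF.
by rewrite divr_ge0 ?(ltW l0)//= ler_pdivrMr// mul1r.
Qed.

Lemma edge_open_segmP e p : e \in edges N ->
  edge_open_segm e p <-> exists2 s, 0 < s < len e & p = vertex e.1 + s *: dir e.
Proof.
move=> eN; have l0 := edge_length_gt0 eN; split=> [[t [/andP[t0 t1] ->]]|[s /andP[s0 s1] ->]].
  exists (t * len e); last by rewrite edge_diff// scalerA.
  by rewrite mulr_gt0//= gtr_pMl.
exists (s / len e); split; last by rewrite edge_diff// scalerA divfK// gt_eqF.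
by rewrite divr_gt0//= ltr_pdivrMr// mul1r.
Qed.

Lemma edge_segm_on e p : e \in edges N -> edge_segm e p -> on_network N p.
Proof. by move=> eN ep; right; exists e. Qed.

Lemma on_networkP p : on_network N p <-> exists2 e, e \in edges N & edge_segm e p.
Proof.
split=> [[[i _ <-]|[e eN ep]]|[e eN ep]]; [|by exists e|exact: edge_segm_on ep].
have [e [eN ie]] := vertex_covered i; exists e => //; apply/edge_segmP => //.
have l0 := edge_length_gt0 eN; case: ie => ->.
  by exists 0; rewrite ?lexx ?ltW// scale0r addr0.
by exists (len e); rewrite ?lexx ?ltW// edge_end.
Qed.

Definition ndirs : seq 'rV[R]_2 :=
  [seq dir e | e <- enum (edges N)] ++ [seq - dir e | e <- enum (edges N)].

Definition nstops : seq 'rV[R]_2 := [seq vertex i | i <- enum 'I_(nverts N)].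

Lemma ndirsP w : w \in ndirs -> exists2 e, e \in edges N & w = dir e \/ w = - dir e.
Proof.
by rewrite mem_cat => /orP[] /mapP[e]; rewrite mem_enum => eN ->; exists e => //; [left|right].
Qed.

Lemma mem_ndirs e w : e \in edges N -> w = dir e \/ w = - dir e -> w \in ndirs.
Proof.
move=> eN ew; rewrite mem_cat; apply/orP; case: ew => ->; [left|right];
  by apply/mapP; exists e; rewrite ?mem_enum.
Qed.

Lemma nstopsP p : reflect (vertices N p) (p \in nstops).
Proof.
apply: (iffP mapP) => [[i _ ->]|[i _ <-]]; first by exists i.
by exists i; rewrite ?mem_enum.
Qed.

Lemma ndirs_unit w : w \in ndirs -> enorm w = 1.
Proof. by move=> /ndirsP[e eN [] ->]; rewrite ?enormN edge_dir_unit. Qed.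

(** The part of the edge [e] near [q] consists of the rays from [q] along [e]. *)
Definition near_edge e q rho := forall p, edge_segm e p -> enorm (p - q) <= rho ->
  exists2 w, w = dir e \/ w = - dir e &
    p = q + enorm (p - q) *: w /\ forall t, 0 <= t <= rho -> edge_segm e (q + t *: w).

Lemma near_edge_on e q s : e \in edges N -> 0 <= s <= len e ->
  q = vertex e.1 + s *: dir e -> exists2 rho, 0 < rho & near_edge e q rho.
Proof.
move=> eN /andP[s0 sl] qE; have l0 := edge_length_gt0 eN.
(* On the side of an end of the edge at [q] any positive radius will do. *)
pose r1 := if 0 < s then s else len e; pose r2 := if s < len e then len e - s else len e.
have r10 : 0 < r1 by rewrite /r1; case: ifP.
have r20 : 0 < r2 by rewrite /r2; case: ifP => // sl'; rewrite subr_gt0.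
exists (Num.min r1 r2); first by rewrite lt_min r10.
move=> p /(edge_segmP _ eN)[x /andP[x0 xl] pE]; rewrite le_min => /andP[d1 d2].
have pq : p - q = (x - s) *: dir e.
  by rewrite pE qE opprD addrACA subrr add0r scalerBl.
have nE : enorm (p - q) = `|x - s| by rewrite pq enormZ edge_dir_unit// mulr1.
have on1 y : 0 <= y <= len e -> edge_segm e (vertex e.1 + y *: dir e).
  by move=> yl; apply/edge_segmP => //; exists y.
have up : s <= x -> s < len e -> exists2 w, w = dir e \/ w = - dir e &
    p = q + enorm (p - q) *: w /\ forall t, 0 <= t <= Num.min r1 r2 -> edge_segm e (q + t *: w).
  move=> sx sl'; exists (dir e); first by left.
  rewrite nE ger0_norm ?subr_ge0// -pq subrKC; split=> // t; rewrite le_min => /and3P[t0 _ t2].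
  by rewrite qE -addrA -scalerDl; apply: on1; rewrite /r2 sl' in t2; lra.
have dn : x <= s -> 0 < s -> exists2 w, w = dir e \/ w = - dir e &
    p = q + enorm (p - q) *: w /\ forall t, 0 <= t <= Num.min r1 r2 -> edge_segm e (q + t *: w).
  move=> xs s0'; exists (- dir e); first by right.
  rewrite nE ler0_norm ?subr_le0// scalerN scaleNr opprK -pq subrKC; split=> // t.
  rewrite le_min => /and3P[t0 t1 _].
  rewrite qE scalerN -addrA -scalerBl; apply: on1; rewrite /r1 s0' in t1; lra.
have [sx|xs] := leP s x; last by apply: dn; lra.
have [sl'|sl'] := ltP s (len e); first exact: up.
by apply: dn; lra.
Qed.

(** A point outside a segment has a positive distance to it: the squared distance
    to [vertex e.1 + s *: dir e] is [(s - a) ^+ 2 + B], where [a] is the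
    coordinate of the foot of the perpendicular and [B] the squared distance to
    the line. *)
Lemma near_edge_off e q : e \in edges N -> ~ edge_segm e q ->
  exists2 rho, 0 < rho & near_edge e q rho.
Proof.
move=> eN qn; have l0 := edge_length_gt0 eN.
suff [rho rho0 far] : exists2 rho, 0 < rho &
    forall s, 0 <= s <= len e -> rho < enorm (vertex e.1 + s *: dir e - q).
  exists rho => // p /(edge_segmP _ eN)[s sl ->].
  by rewrite leNgt far.
pose a := dot (q - vertex e.1) (dir e).
pose B := dot (q - vertex e.1) (q - vertex e.1) - a ^+ 2.
have d1 : dot (dir e) (dir e) = 1 by rewrite -enorm_sqr edge_dir_unit// expr1n.
have sq s : enorm (vertex e.1 + s *: dir e - q) ^+ 2 = (s - a) ^+ 2 + B.
  have -> : vertex e.1 + s *: dir e - q = s *: dir e - (q - vertex e.1).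
    by apply/rowP => i; rewrite !mxE; ring.
  by rewrite enorm_sqr dot_subZ// -/a /B; ring.
have B0 : 0 <= B.
  by have := sq a; rewrite subrr expr0n add0r => <-; exact: sqr_ge0.
have lt_of rho s : 0 < rho -> rho ^+ 2 < (s - a) ^+ 2 + B ->
    rho < enorm (vertex e.1 + s *: dir e - q).
  by move=> rho0; rewrite -sq ltr_sqr// nnegrE ?enorm_ge0// ltW.
have [Bgt|Ble] := ltP 0 B.
  exists (Num.sqrt B / 2); first by rewrite divr_gt0// sqrtr_gt0.
  move=> s _; apply: lt_of; first by rewrite divr_gt0// sqrtr_gt0.
  by rewrite exprMn sqr_sqrtr// exprVn; have := sqr_ge0 (s - a); lra.
have {B0 Ble}B0 : B = 0 by lra.
have qE : q = vertex e.1 + a *: dir e.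
  apply/esym/eqP; rewrite -subr_eq0; apply/eqP/enorm_eq0/eqP.
  by rewrite -sqrf_eq0 sq B0 subrr expr0n addr0.
have [a0|a0] := ltP a 0.
  exists (- a / 2); first by lra.
  move=> s sl; apply: lt_of; first by lra.
  by rewrite B0 addr0 ltr_sqr ?nnegrE; lra.
have [al|al] := leP a (len e).
  by exfalso; apply: qn; apply/edge_segmP => //; exists a => //; rewrite a0.
exists ((a - len e) / 2); first by lra.
move=> s sl; apply: lt_of; first by lra.
by rewrite B0 addr0 -[ltRHS]sqrrN ltr_sqr ?nnegrE; lra.
Qed.

End Geometry.

(** * Motion along a network *)

Section Star.
Context {R : realType} (N : network R).
Notation edge := ('I_(nverts N) * 'I_(nverts N))%type.
Implicit Types (e : edge) (p q w : 'rV[R]_2) (s t rho : R).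
Notation len := edge_length.
Notation dir := edge_dir.

Lemma near_edge_sub e q rho rho' : near_edge e q rho -> rho' <= rho -> near_edge e q rho'.
Proof.
move=> st rr p ep pq; have [w wd [pE seg]] := st p ep (le_trans pq rr).
by exists w => //; split=> // t /andP[t0 tr]; apply: seg; rewrite t0 (le_trans tr).
Qed.

Lemma near_edge_ex e q : e \in edges N -> exists2 rho, 0 < rho & near_edge e q rho.
Proof.
move=> eN; have [/(edge_segmP _ eN)[s sl qE]|] := pselect (edge_segm e q).
  exact: near_edge_on eN sl qE.
exact: near_edge_off.
Qed.

Lemma network_star q : on_network N q -> exists2 rho, 0 < rho &
  (forall p, on_network N p -> enorm (p - q) <= rho -> exists e w,
    [/\ e \in edges N, w = dir e \/ w = - dir e, p = q + enorm (p - q) *: w &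
        forall t, 0 <= t <= rho -> edge_segm e (q + t *: w)]) /\
  (forall v, v \in nstops N -> enorm (v - q) <= rho -> v = q).
Proof.
move=> qN.
have [e e' r0 _ rr near|e|r1 r10 P1] := @small_forall_seq R _ (enum (edges N))
  (fun e rho => near_edge e q rho).
- exact: near_edge_sub near rr.
- by rewrite mem_enum; exact: near_edge_ex.
have [i e e' _ ee ne vq|i _|r2 r20 P2] := @small_forall_seq R _ (enum 'I_(nverts N))
  (fun i rho => enorm (vertex i - q) <= rho -> vertex i = q).
- by apply: ne; exact: le_trans vq ee.
- have [->|vq] := eqVneq (vertex i) q; first by exists 1.
  have d0 : 0 < enorm (vertex i - q).
    rewrite lt_neqAle enorm_ge0 andbT eq_sym; apply/eqP => /enorm_eq0/eqP.
    by rewrite subr_eq0 (negPf vq).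
  by exists (enorm (vertex i - q) / 2); [rewrite divr_gt0|move=> le; exfalso; lra].
exists (Num.min r1 r2); first by rewrite lt_min r10.
split=> [p /on_networkP[e eN ep]|v /nstopsP[i _ <-]]; rewrite le_min => /andP[d1 d2].
  have [|w wd [pE seg]] := P1 e _ p ep d1; first by rewrite mem_enum.
  exists e, w; split=> // t; rewrite le_min => /and3P[t0 t1 _].
  by apply: seg; rewrite t0.
by apply: P2 => //; rewrite mem_enum.
Qed.

(** By [network_star], an ingoing direction is that of an edge through [q]. *)
Lemma ingoing_edge q w : on_network N q -> w \in ndirs N -> ingoing (on_network N) q w ->
  exists e rho, [/\ e \in edges N, w = dir e \/ w = - dir e, 0 < rho &
    forall t, 0 <= t <= rho -> edge_segm e (q + t *: w)].
Proof.
move=> qN wd [x x0 px]; have [rho rho0 [st _]] := network_star qN.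
have m0 : 0 < Num.min x rho by rewrite lt_min x0.
have mx : Num.min x rho <= x by rewrite ge_min lexx.
have mr : Num.min x rho <= rho by rewrite ge_min lexx orbT.
have Np : on_network N (q + Num.min x rho *: w) by apply: px; rewrite (ltW m0).
have nE : enorm (q + Num.min x rho *: w - q) = Num.min x rho.
  by rewrite addrC addKr enormZ (ndirs_unit wd) mulr1 gtr0_norm.
have := st _ Np; rewrite nE => /(_ mr)[e [w' [eN w'd /addrI ww seg]]].
have {}ww : w = w' by apply: (scalerI (_ : Num.min x rho != 0)) ww; rewrite gt_eqF.
by subst w'; exists e, rho.
Qed.

(** Follow the edge of [ingoing_edge] to its end. *)
Lemma network_run q w : on_network N q -> w \in ndirs N -> ingoing (on_network N) q w ->
  exists T, [/\ 0 < T, q + T *: w \in nstops N & path_in (on_network N) q w T].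
Proof.
move=> qN wd /(ingoing_edge qN wd)[e [rho [eN wE rho0 seg]]].
have on1 y : 0 <= y <= len e -> on_network N (vertex e.1 + y *: dir e).
  by move=> yl; apply: (edge_segm_on eN); apply/edge_segmP => //; exists y.
have coord t s s' : vertex e.1 + s *: dir e + t *: dir e = vertex e.1 + s' *: dir e -> s' = s + t.
  rewrite -addrA -scalerDl => /addrI/eqP; rewrite -subr_eq0 -scalerBl scaler_eq0 subr_eq0.
  move=> /orP[/eqP->//|/eqP d0]; have := edge_dir_unit eN.
  by rewrite d0 -(scale0r 0) enormZ normr0 mul0r => /eqP; rewrite eq_sym oner_eq0.
have /(edge_segmP _ eN)[s /andP[s0 sl] qE] : edge_segm e q.
  by have := seg 0; rewrite scale0r addr0 lexx ltW//; apply.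
have /(edge_segmP _ eN)[s' /andP[s'0 s'l] q'E] : edge_segm e (q + rho *: w).
  by apply: seg; rewrite lexx ltW.
case: wE => wE; rewrite wE in q'E *.
  have s'E := coord rho s s'; rewrite -qE in s'E; have {}s'E := s'E q'E.
  exists (len e - s); split; first by lra.
    apply/nstopsP; exists e.2 => //.
    by rewrite qE -addrA -scalerDl subrKC edge_end.
  by move=> t tl; rewrite qE -addrA -scalerDl; apply: on1; lra.
have s'E := coord (- rho) s s'; rewrite -qE scaleNr -scalerN in s'E; have {}s'E := s'E q'E.
exists s; split; first by lra.
  apply/nstopsP; exists e.1 => //.
  by rewrite qE scalerN addrK.
by move=> t tl; rewrite qE scalerN -addrA -scalerBl; apply: on1; lra.
Qed.

Lemma open_of_segm e q : e \in edges N -> edge_segm e q -> ~ vertices N q ->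
  edge_open_segm e q.
Proof.
move=> eN /(edge_segmP _ eN)[s /andP[s0 sl] qE] nv; apply/edge_open_segmP => //.
exists s => //; rewrite !lt_neqAle s0 sl !andbT; apply/andP; split; apply/eqP => sE; apply: nv.
  by exists e.1 => //; rewrite qE -sE scale0r addr0.
by exists e.2 => //; rewrite qE sE edge_end.
Qed.

Lemma open_ingoing e q w : e \in edges N -> edge_open_segm e q ->
  w = dir e \/ w = - dir e -> ingoing (on_network N) q w.
Proof.
move=> eN /(edge_open_segmP _ eN)[s /andP[s0 sl] qE] wE.
have m0 : 0 < Num.min s (len e - s) by rewrite lt_min s0 subr_gt0.
exists (Num.min s (len e - s)) => // t; rewrite le_min => /and3P[t0 t1 t2].
apply: (edge_segm_on eN); apply/edge_segmP => //; case: wE => ->.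
  by exists (s + t); [lra|rewrite qE -addrA -scalerDl].
by exists (s - t); [lra|rewrite qE scalerN -addrA -scalerBl].
Qed.

Section Deriv.
Variables (r : R) (phi : 'rV[R]_2 -> R) (f : R -> R) (m : nat) (P : 'I_m -> 'rV[R]_2) (h : 'I_m).
Hypothesis Pon : on_network N (P h).
Let grad := coverage_grad N r phi f P h.

Lemma edge_deriv_dir e w : w = dir e \/ w = - dir e ->
  edge_deriv r phi f P h e = dot grad w *: w.
Proof. by case=> ->; rewrite // dotNr scalerN scaleNr opprK. Qed.

Lemma edge_deriv_pos e : edge_deriv r phi f P h e <> 0 -> exists w v,
  [/\ w = dir e \/ w = - dir e, 0 < v, edge_deriv r phi f P h e = v *: w & v = dot grad w].
Proof.
move=> D0; have [v0|v0|v0] := ltgtP 0 (dot grad (dir e)).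
- by exists (dir e), (dot grad (dir e)); split=> //; left.
- exists (- dir e), (dot grad (- dir e)); split; [by right| | |by []].
    by rewrite dotNr oppr_gt0.
  by apply: edge_deriv_dir; right.
- by exfalso; apply: D0; rewrite (edge_deriv_dir (or_introl erefl)) -v0 scale0r.
Qed.

Lemma network_deriv_inside d w : is_network_deriv N r phi f P h d -> P h \notin nstops N ->
  w \in ndirs N -> ingoing (on_network N) (P h) w -> d = dot grad w *: w.
Proof.
move=> [dop _ _] /nstopsP nv wd /(ingoing_edge Pon wd)[e [rho [eN wE rho0 seg]]].
have es : edge_segm e (P h).
  by have := seg 0; rewrite scale0r addr0 lexx ltW//; apply.
by rewrite (dop e eN nv (open_of_segm eN es nv)) (edge_deriv_dir wE).
Qed.

(** [S_v] is defined by the displacement [D_w H], which may be the opposite of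
    the direction of the edge; the sign is absorbed by the choice of [w], and a
    displacement that stays in the network for some time means that [w] is
    ingoing. *)
Lemma network_deriv_spec d : is_network_deriv N r phi f P h d -> d = 0 \/ exists w v,
  [/\ w \in ndirs N, 0 < v, ingoing (on_network N) (P h) w, d = v *: w & v = dot grad w].
Proof.
move=> [dop dv d0]; have [|d_neq0] := pselect (d = 0); first by left.
right; have [vP|nv] := pselect (vertices N (P h)); last first.
  have /on_networkP[e eN es] := Pon; have eo := open_of_segm eN es nv.
  have dE := dop e eN nv eo; rewrite dE in d_neq0 *.
  have [w [v [wE v0 DE vE]]] := edge_deriv_pos d_neq0.
  by exists w, v; split=> //; [exact: mem_ndirs eN wE|exact: open_ingoing eN eo wE].
have [fne|nfne] := pselect (exists e, feasible_edges r phi f P h e); last first.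
  by case: d_neq0; apply: d0 => //; apply/seteqP; split=> // e fe; case: nfne; exists e.
have [e [[eN _ [x [x0 px]]] dE _]] := dv vP fne.
rewrite dE in d_neq0 *; have [w [v [wE v0 DE vE]]] := edge_deriv_pos d_neq0.
exists w, v; split=> //; first exact: mem_ndirs eN wE.
exists (x * v); first by rewrite mulr_gt0.
move=> t /andP[t0 tx]; have := px (t / v); rewrite DE scalerA divfK ?gt_eqF//; apply.
by rewrite divr_ge0 ?(ltW v0)//= ler_pdivrMr.
Qed.

End Deriv.
End Star.

(** * Derivatives on the half-line *)

Section HalfLine.
Context {R : realType}.
Implicit Types (g f : R -> R) (x y z e d : R).

Lemma halfline_quotient g g' x e : halfline_deriv g g' -> 0 <= x -> 0 < e ->
  exists2 d, 0 < d & forall y, 0 <= y -> y != x -> `|y - x| < d ->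
    `|g' x - (g y - g x) / (y - x)| < e.
Proof.
move=> /(_ x) gg x0 e0; have /cvgrPdist_lt/(_ e e0) := gg x0.
move=> /nbhs_ballP[d /= d0 bd]; exists d => // y y0 yx yd.
by apply: bd => //=; rewrite /ball/= distrC.
Qed.

Lemma halfline_is_derive g g' x : halfline_deriv g g' -> 0 < x -> is_derive x 1 g (g' x).
Proof.
move=> gg x0.
have lim : (fun h : R => h^-1 *: ((g \o shift x) (h *: (1 : R)) - g x)) @ 0^' --> g' x.
  apply/cvgrPdist_lt => e e0; have [d d0 dP] := halfline_quotient gg (ltW x0) e0.
  apply/nbhs_ballP; exists (Num.min d x); first by rewrite /= lt_min d0.
  move=> h /=; rewrite /ball/= sub0r normrN lt_min => /andP[hd hx] h0.
  have := dP (h + x); rewrite addrK /shift /= [h *: 1]mulr1 [_ *: _]mulrC.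
  apply=> //.
    by move: hx; rewrite ltr_norml; lra.
  by rewrite -subr_eq0 addrK.
by apply: DeriveDef; [apply/cvg_ex; exists (g' x)|exact: cvg_lim].
Qed.

(** Real induction: consider the supremum of the points up to which the function
    is bounded. *)
Lemma locally_bounded_segment g M : 0 <= M ->
  (forall x, 0 <= x -> exists B, \forall y \near within [set y | 0 <= y] (nbhs x), `|g y| <= B) ->
  exists B, forall x, 0 <= x <= M -> `|g x| <= B.
Proof.
move=> M0 loc.
have {}loc x : 0 <= x -> exists d B, 0 < d /\ forall y, 0 <= y -> `|y - x| < d -> `|g y| <= B.
  move=> /loc[B /nbhs_ballP[d /= d0 bd]]; exists d, B; split=> // y y0 yd.
  by apply: bd => //; rewrite /ball/= distrC.
pose A := [set x | 0 <= x <= M /\ exists B, forall y, 0 <= y <= x -> `|g y| <= B].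
have A0 : A 0.
  split; first by rewrite lexx.
  by exists `|g 0| => y y0; have -> : y = 0 by lra.
have hs : has_sup A by split; [exists 0|exists M => x [/andP[]]].
have s0 : 0 <= sup A by apply: ub_le_sup => //; case: hs.
have sM : sup A <= M by apply: ge_sup => [|x [/andP[]]]//; exists 0.
have [d [B [d0 bd]]] := loc _ s0.
have [x [/andP[x0 xM] [B' B'P]] xs] := sup_adherent d0 hs.
pose z := Num.min M (sup A + d / 2).
have zA : A z.
  have z0 : 0 <= z by rewrite le_min M0; lra.
  split; first by rewrite z0 ge_min lexx.
  exists (Num.max B B') => y /andP[y0 yz]; rewrite le_max.
  have [yx|xy] := leP y x; first by rewrite B'P ?orbT// y0.
  rewrite bd// ltr_norml; move: yz; rewrite le_min => /andP[_ ys].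
  by apply/andP; split; lra.
have zs : z <= sup A by apply: ub_le_sup => //; case: hs.
have zM : z = M.
  by move: zs; rewrite /z /Num.min; case: ltP => //; lra.
by move: zA; rewrite zM => -[_ [B'' B''P]]; exists B''.
Qed.

(** The mean value theorem away from [0]. At [0] the one-sided derivative
    replaces it on a first short interval. *)
Lemma halfline_lipschitz g g' M : 0 <= M -> halfline_deriv g g' ->
  (forall x, 0 <= x -> exists B, \forall y \near within [set y | 0 <= y] (nbhs x), `|g' y| <= B) ->
  exists2 L, 0 < L & forall x y, 0 <= x <= M -> 0 <= y <= M -> `|g x - g y| <= L * `|x - y|.
Proof.
move=> M0 gg /(locally_bounded_segment M0)[B BP].
have B0 : 0 <= B by apply: le_trans (BP 0 _); rewrite ?normr_ge0 ?lexx.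
pose L := B + `|g' 0| + 1.
have n0 := normr_ge0 (g' 0); have L0 : 0 < L by rewrite /L; lra.
exists L => //.
have inner x y : 0 < x -> x < y -> y <= M -> `|g x - g y| <= L * (y - x).
  move=> x0 xy yM.
  have [z|z|z + zE] := @MVT R g g' x y xy.
  - by rewrite in_itv => /andP[xz _]; apply: halfline_is_derive => //; exact: lt_trans xz.
  - apply: continuous_in_subspaceT => t; rewrite inE/= in_itv/= => /andP[xt _].
    have t0 : 0 < t by exact: lt_le_trans xt.
    have [+ _] := halfline_is_derive gg t0.
    by move=> /derivable1_diffP; exact: differentiable_continuous.
  rewrite in_itv/= => /andP[xz zy]; rewrite distrC zE normrM (gtr0_norm (_ : 0 < y - x)) ?subr_gt0//.
  rewrite ler_pM2r ?subr_gt0//; have : `|g' z| <= B by apply: BP; lra.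
  by rewrite /L; lra.
have origin y : 0 < y -> y <= M -> `|g 0 - g y| <= L * y.
  move=> y0 yM; have [d d0 dP] := halfline_quotient gg (lexx 0) (ltr01 : 0 < 1 :> R).
  pose z := Num.min (d / 2) (y / 2).
  have z0 : 0 < z by rewrite lt_min !divr_gt0.
  have zd : z <= d / 2 by rewrite ge_min lexx.
  have zy : z <= y / 2 by rewrite ge_min lexx orbT.
  have : `|g z - g 0| <= L * z.
    have := dP z (ltW z0) (lt0r_neq0 z0); rewrite subr0 gtr0_norm// => /(_ _)/wrap[]; first lra.
    move=> q; have : `|(g z - g 0) / z| <= `|g' 0| + 1.
      have := ler_normB (g' 0) (g' 0 - (g z - g 0) / z); rewrite subKr.
      by lra.
    rewrite normrM normfV (gtr0_norm z0) ler_pdivrMr// => /le_trans; apply.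
    by rewrite ler_pM2r// /L; lra.
  have := inner z y z0 _ yM; rewrite -[z < y]/(z < y) => /(_ _)/wrap[]; first lra.
  move=> h1 h2; have : `|g 0 - g y| <= `|g z - g 0| + `|g z - g y|.
    by rewrite (distrC (g z) (g 0)); have := ler_normD (g 0 - g z) (g z - g y); rewrite addrA subrK.
  by lra.
move=> x y; wlog xy : x y / x < y => [wl|].
  have [xy|yx|->] := ltgtP x y; first exact: wl.
    by move=> xM yM; rewrite distrC (distrC x); exact: wl.
  by rewrite !subrr normr0 mulr0.
move=> /andP[x0 xM] /andP[y0 yM]; rewrite distrC (distrC x) (gtr0_norm (_ : 0 < y - x)) ?subr_gt0//.
rewrite distrC; move: x0; rewrite le_eqVlt => /predU1P[x0|x0]; last exact: inner.
by rewrite -x0 subr0; apply: origin => //; rewrite x0.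
Qed.

End HalfLine.

(** * The utility of a sensor along a line *)

Section Utility.
Context {R : realType}.
Implicit Types (b p q w x y : 'rV[R]_2) (t : R).

Lemma line_is_derive (F : 'rV[R]_2 -> R^o) p w t : differentiable F (p + t *: w) ->
  is_derive t 1 (fun t : R => F (p + t *: w) : R) ('D_w F (p + t *: w)).
Proof.
move=> dF; have /(@diff_derivable _ _ _ _ _ w) := dF.
have E : (fun h : R => h^-1 *: (((fun t : R => F (p + t *: w) : R) \o shift t) (h *: (1 : R)) - F (p + t *: w)))
   = (fun h : R => h^-1 *: ((F \o shift (p + t *: w)) (h *: w) - F (p + t *: w))).
  apply/funext => h /=; congr (_ *: (F _ - _)).
  by rewrite [h *: 1]mulr1 scalerDl addrC addrAC addrA.
by rewrite /derivable => dw; apply: DeriveDef; rewrite /derivable /derive E.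
Qed.

(** The partial derivatives form the gradient because of differentiability. *)
Lemma perf_grad_dot (f : R -> R) b p w :
  differentiable (fun q : 'rV[R]_2 => f (enorm (b - q)) : R^o) p ->
  dot (perf_grad f b p) w = 'D_w (fun q : 'rV[R]_2 => f (enorm (b - q)) : R^o) p.
Proof.
move=> dF; rewrite deriveE// {2}(row_sum_delta w) linear_sum /dot.
by apply: eq_bigr => j _; rewrite linearZ/= mxE deriveE// mulrC.
Qed.

Lemma enorm_line b p w t : enorm w = 1 ->
  enorm (b - (p + t *: w)) =
  Num.sqrt (dot (b - p) (b - p) - 2 * t * dot (b - p) w + t ^+ 2).
Proof.
move=> w1; rewrite /enorm; congr Num.sqrt.
have d1 : dot w w = 1 by rewrite -enorm_sqr w1 expr1n.
have -> : b - (p + t *: w) = - (t *: w - (b - p)).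
  by apply/rowP => i; rewrite !mxE; ring.
by rewrite dotNl dotNr opprK dot_subZ//; ring.
Qed.

(** The chain rule for [t |-> f (Num.sqrt (poly t))], where [poly] is the squared
    distance along the line. *)
Lemma derive_away (f f1 : R -> R) b p w : halfline_deriv f f1 -> enorm w = 1 -> b != p ->
  differentiable (fun q : 'rV[R]_2 => f (enorm (b - q)) : R^o) p ->
  'D_w (fun q : 'rV[R]_2 => f (enorm (b - q)) : R^o) p =
    - (f1 (enorm (b - p)) / enorm (b - p)) * dot (b - p) w.
Proof.
move=> hf w1 bp dF; set x := b - p; set F := fun q : 'rV[R]_2 => _.
have r0 : 0 < enorm x.
  rewrite lt_neqAle enorm_ge0 andbT eq_sym; apply/eqP => /enorm_eq0/eqP.
  by rewrite subr_eq0 (negPf bp).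
have p0 : p = p + 0 *: w by rewrite scale0r addr0.
have dF0 : differentiable F (p + 0 *: w) by rewrite -p0.
have D1 := line_is_derive dF0; rewrite -p0 in D1.
pose poly t := dot x x - 2 * t * dot x w + t ^+ 2.
have poly0 : poly 0 = enorm x ^+ 2 by rewrite /poly enorm_sqr; ring.
have Dpoly : is_derive (0 : R) 1 poly (- 2 * dot x w).
  rewrite /poly; apply: is_derive_eq.
  rewrite /GRing.scale /=; ring.
have Dsqrt : is_derive (poly 0) 1 Num.sqrt (2 * enorm x)^-1.
  have := @is_derive1_sqrt R (poly 0); rewrite poly0 sqrtr_sqr (gtr0_norm r0).
  by apply; rewrite exprn_gt0.
have Ds : is_derive (0 : R) 1 (Num.sqrt \o poly) ((2 * enorm x)^-1 * (- 2 * dot x w)).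
  exact: is_derive1_comp.
have Df : is_derive ((Num.sqrt \o poly) 0) 1 f (f1 (enorm x)).
  rewrite /= poly0 sqrtr_sqr (gtr0_norm r0); exact: halfline_is_derive.
have D2 : is_derive (0 : R) 1 (f \o (Num.sqrt \o poly))
    (f1 (enorm x) * ((2 * enorm x)^-1 * (- 2 * dot x w))) by exact: is_derive1_comp.
have E : (fun t : R => F (p + t *: w) : R) = f \o (Num.sqrt \o poly).
  by apply/funext => t; rewrite /F enorm_line.
rewrite E in D1; have := @derive_val _ _ _ _ _ _ _ D1.
rewrite (@derive_val _ _ _ _ _ _ _ D2) => <-.
by rewrite invfM; field; rewrite gt_eqF.
Qed.

(** At [b] itself the utility is even along the line, so both its derivative and
    the one-sided derivative of [f] at [0] vanish. *)
Lemma derive_center (f f1 : R -> R) b w : halfline_deriv f f1 -> enorm w = 1 ->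
  differentiable (fun q : 'rV[R]_2 => f (enorm (b - q)) : R^o) b ->
  f1 0 = 0 /\ 'D_w (fun q : 'rV[R]_2 => f (enorm (b - q)) : R^o) b = 0.
Proof.
move=> hf w1 dF; set F := fun q : 'rV[R]_2 => _.
have p0 : b = b + 0 *: w by rewrite scale0r addr0.
have dF0 : differentiable F (b + 0 *: w) by rewrite -p0.
have := line_is_derive dF0; rewrite -p0; set D := 'D_w F b.
have -> : (fun t : R => F (b + t *: w) : R) = (fun t : R => f `|t|).
  by apply/funext => t; rewrite /F opprD addrA subrr sub0r enormN enormZ w1 mulr1.
move=> [dv vE].
have lim : (fun h : R => h^-1 *: (((fun t : R => f `|t|) \o shift 0) (h *: (1 : R)) - f `|0 : R|)) @ 0^' --> D.
  by rewrite -vE; exact: dv.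
have key e : 0 < e -> `|f1 0| < e /\ `|D| < e.
  move=> e0; have e4 : 0 < e / 4 by rewrite divr_gt0.
  have [d d0 dP] := halfline_quotient hf (lexx 0) e4.
  have /cvgrPdist_lt/(_ _ e4)/nbhs_ballP[d' /= d'0 dP'] := lim.
  pose h := Num.min (d / 2) (d' / 2).
  have h0 : 0 < h by rewrite lt_min !divr_gt0.
  have hd : h <= d / 2 by rewrite ge_min lexx.
  have hd' : h <= d' / 2 by rewrite ge_min lexx orbT.
  have := dP h (ltW h0) (lt0r_neq0 h0); rewrite subr0 gtr0_norm// => /(_ _)/wrap[]; first lra.
  have := dP' h; rewrite /ball/= sub0r normrN gtr0_norm// => /(_ _ (lt0r_neq0 h0))/wrap[]; first lra.
  have := dP' (- h); rewrite /ball/= sub0r opprK gtr0_norm// oppr_eq0 => /(_ _ (lt0r_neq0 h0))/wrap[]; first lra.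
  rewrite /shift /= !addr0 normr0 ![_ *: 1]mulr1 normrN (gtr0_norm h0) invrN.
  rewrite /GRing.scale /= mulNr [h^-1 * _]mulrC.
  by rewrite !ltr_norml; lra.
have z (u : R) : (forall e, 0 < e -> `|u| < e) -> u = 0.
  move=> ue; apply/eqP; rewrite -normr_eq0 eq_le normr_ge0 andbT leNgt; apply/negP => u0.
  by have := ue _ u0; rewrite ltxx.
by split; apply: z => e /key[].
Qed.

(** The field [x |-> (f1 `|x| / `|x|) *: x] is Lipschitz. Its part that depends on
    the radius is so because [f1] is; and changing the direction of [x] costs at
    most [f1 `|x| / `|x|], which is bounded because [f1 0 = 0]. *)
Lemma radial_lipschitz (f1 : R -> R) L M x y w : 0 < L -> f1 0 = 0 ->
  (forall s t, 0 <= s <= M -> 0 <= t <= M -> `|f1 s - f1 t| <= L * `|s - t|) ->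
  enorm w = 1 -> enorm x <= M -> enorm y <= M ->
  `|- (f1 (enorm x) / enorm x) * dot x w - - (f1 (enorm y) / enorm y) * dot y w|
    <= 3 * L * enorm (x - y).
Proof.
move=> L0 f10 lip w1 xM yM; have x0 := enorm_ge0 x; have y0 := enorm_ge0 y.
have dw u : `|dot u w| <= enorm u by have := dot_le u w; rewrite w1 mulr1.
have M0 : 0 <= M by exact: le_trans xM.
have f1L s : 0 <= s <= M -> `|f1 s| <= L * s.
  move=> sM; have := lip s 0 sM; rewrite lexx M0 f10 !subr0 => /(_ isT).
  by rewrite (@ger0_norm _ s)//; case/andP: sM.
have d0 := enorm_ge0 (x - y).
have dN : `|enorm x - enorm y| <= enorm (x - y).
  rewrite ler_norml; have := enormD (x - y) y; have := enormD (y - x) x.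
  by rewrite !subrK -(enormN (y - x)) opprB; lra.
have rad u : enorm u <= M -> `|f1 (enorm u) / enorm u * dot u w| <= L * enorm u.
  move=> uM; have u0 := enorm_ge0 u; rewrite !normrM.
  have [->|un] := eqVneq (enorm u) 0; first by rewrite invr0 normr0 mulr0 mul0r mulr0.
  have ugt : 0 < enorm u by rewrite lt_neqAle eq_sym un.
  by rewrite normfV (gtr0_norm ugt) mulrAC ler_pdivrMr// ler_pM// f1L// u0 uM.
rewrite !mulNr opprK addrC.
have [x00|xn] := eqVneq (enorm x) 0.
  rewrite x00 invr0 mulr0 mul0r subr0; apply: le_trans (rad y yM) _.
  by move: dN; rewrite x00 sub0r normrN ger0_norm// => dN; nra.
have [y00|yn] := eqVneq (enorm y) 0.
  rewrite y00 invr0 mulr0 mul0r sub0r normrN; apply: le_trans (rad x xM) _.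
  by move: dN; rewrite y00 subr0 ger0_norm// => dN; nra.
have xgt : 0 < enorm x by rewrite lt_neqAle eq_sym xn.
have ygt : 0 < enorm y by rewrite lt_neqAle eq_sym yn.
set a := enorm x in dN xM x0 xn xgt *; set c := enorm y in dN yM y0 yn ygt *.
have -> : f1 c / c * dot y w - f1 a / a * dot x w =
    f1 a / a * dot (y - x) w + (f1 c / c - f1 a / a) * dot y w.
  by rewrite dotDl dotNl; ring.
have A1 : `|f1 a / a * dot (y - x) w| <= L * enorm (x - y).
  rewrite !normrM normfV (gtr0_norm xgt) -(enormN (x - y)) opprB.
  rewrite ler_pM ?divr_ge0 ?normr_ge0 ?(ltW xgt)//.
  by rewrite ler_pdivrMr// f1L// x0 xM.
have A2 : `|(f1 c / c - f1 a / a) * dot y w| <= 2 * L * enorm (x - y).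
  apply: (@le_trans _ _ (`|f1 c / c - f1 a / a| * c)).
    by rewrite normrM ler_wpM2l.
  rewrite -[X in _ * X <= _](gtr0_norm ygt) -normrM mulrBl divfK//.
  have -> : f1 c - f1 a / a * c = (f1 c - f1 a) + f1 a / a * (a - c).
    by field.
  apply: le_trans (ler_normD _ _) _.
  have B1 : `|f1 c - f1 a| <= L * enorm (x - y).
    apply: le_trans (lip _ _ _ _) _; rewrite ?y0 ?x0//.
    by rewrite ler_pM2l// distrC.
  have B2 : `|f1 a / a * (a - c)| <= L * enorm (x - y).
    by rewrite normrM ler_pM// normrM normfV (gtr0_norm xgt) ler_pdivrMr// f1L// x0 xM.
  by lra.
by apply: le_trans (ler_normD _ _) _; lra.
Qed.

End Utility.

(** * Lexicographic Voronoi cells *)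

Section Voronoi.
Context {R : realType} {m : nat} (i0 : 'I_m).
Implicit Types (P : 'I_m -> 'rV[R]_2) (b : 'rV[R]_2) (i j : 'I_m).

Definition wins P b i :=
  [forall j : 'I_m, enorm (b - P i) <= enorm (b - P j)] &&
  [forall j : 'I_m, (j < i)%N ==> (enorm (b - P i) < enorm (b - P j))].

(** By [wins_ex] and [wins_inj] each [b] lies in exactly one cell. *)
Definition winner P b := odflt i0 [pick i | wins P b i].

(** The smallest index among those of the closest sensors. *)
Lemma wins_ex P b : exists i, wins P b i.
Proof.
have [i _ imin] := Order.TotalTheory.arg_minP (fun i => enorm (b - P i)) (erefl : xpredT i0).
have [j /eqP dj jmin] := @arg_minnP _ i (fun j => enorm (b - P j) == enorm (b - P i)) val (eqxx _).
exists j; apply/andP; split; apply/forallP => k; first by rewrite dj imin.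
apply/implyP => kj; rewrite dj lt_neqAle imin// andbT eq_sym.
by apply/negP => /jmin; rewrite leqNgt kj.
Qed.

Lemma wins_inj P b i j : wins P b i -> wins P b j -> i = j.
Proof.
move=> /andP[/forallP i1 /forallP i2] /andP[/forallP j1 /forallP j2]; apply/val_inj.
have [ij|ji|//] := ltngtP i j.
  by have := j2 i; rewrite ij /= ltNge i1.
by have := i2 j; rewrite ji /= ltNge j1.
Qed.

Lemma winsE P b i : wins P b i = (winner P b == i).
Proof.
rewrite /winner; case: pickP => [j wj|no] /=; last by have [j] := wins_ex P b; rewrite no.
by apply/idP/eqP => [/(wins_inj wj)|<-].
Qed.

Lemma winner_closest P b i : enorm (b - P (winner P b)) <= enorm (b - P i).
Proof.
by have := eqxx (winner P b); rewrite -winsE => /andP[/forallP].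
Qed.

Lemma voronoiE (N : network R) r P i :
  voronoi N r P i = [seq b <- collapsed N r | winner P b == i].
Proof. by apply: eq_filter => b; rewrite -winsE. Qed.

End Voronoi.

(** * Boundedness and compactness of a network *)

Section Bounded.
Context {R : realType} (N : network R) (r : R).

Lemma collapsed_on b : b \in collapsed N r -> on_network N b.
Proof.
rewrite mem_undup => /allpairsPdep[e [i [eN iP ->]]]; rewrite mem_enum in eN.
apply: (edge_segm_on eN); set k := edge_parts r e in iP *.
move: iP; rewrite mem_iota add1n ltnS => /andP[i1 ik].
have k0 : 0 < k%:R :> R by rewrite ltr0n (leq_trans i1).
have ir : 1 <= i%:R :> R by rewrite ler1n.
have ikr : i%:R <= k%:R :> R by rewrite ler_nat.
exists ((i%:R - 2^-1) / k%:R); split.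
  by rewrite divr_ge0 ?ler_pdivrMr//; lra.
by apply/rowP => l; rewrite /barycenter/= !mxE; field; rewrite gt_eqF.
Qed.

Lemma network_bounded : exists2 B, 0 < B & forall p, on_network N p -> enorm p <= B.
Proof.
pose F (e : 'I_(nverts N) * 'I_(nverts N)) := enorm (vertex e.1) + edge_length e.
have F0 e : 0 <= F e by rewrite addr_ge0 ?enorm_ge0.
exists (\sum_(e in edges N) F e + 1); first by rewrite ltr_wpDl// sumr_ge0.
move=> p /on_networkP[e eN [t [/andP[t0 t1] ->]]].
apply: (@le_trans _ _ (F e)).
  apply: le_trans (enormD _ _) _; rewrite lerD2l enormZ ger0_norm//.
  by rewrite ler_piMl// enorm_ge0.
by rewrite (bigD1 e)//= -addrA lerDl addr_ge0// sumr_ge0.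
Qed.

Lemma network_diameter : exists2 M, 0 < M &
  forall p q, on_network N p -> on_network N q -> enorm (p - q) <= M.
Proof.
have [B B0 le] := network_bounded; exists (B + B); first by rewrite addr_gt0.
move=> p q /le pB /le qB; apply: le_trans (enormD _ _) _.
by rewrite enormN lerD.
Qed.

End Bounded.

Section Compact.
Context {R : realType} (N : network R) {m : nat}.

(** Along an ultrafilter on the indices every coordinate converges, and no
    subsequence has to be extracted sensor by sensor. *)
Lemma network_cluster (y : nat -> 'I_m -> 'rV[R]_2) : (forall n h, on_network N (y n h)) ->
  exists q : 'I_m -> 'rV[R]_2, (forall h, on_network N (q h)) /\
    forall e n0, 0 < e -> exists2 n, (n0 <= n)%N & forall h, enorm (y n h - q h) < e.
Proof.
move=> yN; have [G [UG sub]] := ultraFilterLemma (eventually_filter : ProperFilter \oo).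
have near_one h : exists q, on_network N q /\
    forall e, 0 < e -> G [set n | enorm (y n h - q) < e].
  have ex n : exists et : ('I_(nverts N) * 'I_(nverts N)) * R,
    [/\ et.1 \in edges N, 0 <= et.2 <= 1 &
        y n h = vertex et.1.1 + et.2 *: (vertex et.1.2 - vertex et.1.1)].
    by have /on_networkP[e eN [t [t01 yE]]] := yN n h; exists (e, t).
  have [s sP] := choice ex.
  have [e [eN Ge]] : exists e, e \in edges N /\ G [set n | (s n).1 = e].
    apply: contrapT => no.
    have Gn e : G [set n | (s n).1 <> e].
      have [eN|eN] := boolP (e \in edges N); last first.
        by apply: filterS filterT => n _ /= se; case: (sP n); rewrite se (negPf eN).
      have [|//] := in_ultra_setVsetC [set n | (s n).1 = e] UG.
      by move=> Ge; case: no; exists e.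
    have : G (fun n => forall e, (s n).1 <> e) by exact: filter_forall.
    by move=> /filter_ex[n /(_ (s n).1)].
  have s01 : ((fun n => (s n).2) @ G) `[0, 1]%classic.
    by apply: (@filterS _ G _ setT) filterT => n _ /=; rewrite in_itv/=; case: (sP n).
  have [t [t01 tcl]] := @segment_compact R 0 1 _ _ s01.
  exists (vertex e.1 + t *: (vertex e.2 - vertex e.1)); split.
    by apply: (edge_segm_on eN); exists t; split => //; move: t01; rewrite /= in_itv.
  move=> x x0; set l := enorm (vertex e.2 - vertex e.1).
  have l1 : 0 < l + 1 by rewrite ltr_wpDl ?enorm_ge0.
  have Gt : G [set n | `|t - (s n).2| < x / (l + 1)].
    have [//|Gc] := in_ultra_setVsetC [set n | `|t - (s n).2| < x / (l + 1)] UG.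
    have xl := divr_gt0 x0 l1.
    by have [u [/= nu tu]] := tcl (~` ball t (x / (l + 1))) _ Gc (nbhsx_ballx t _ xl).
  apply: filterS (filterI Ge Gt) => n [/= se st].
  have [_ _ ->] := sP n; rewrite se opprD addrACA subrr add0r -scalerBl enormZ -/l distrC.
  apply: (@le_lt_trans _ _ (`|t - (s n).2| * (l + 1))); last by rewrite -ltr_pdivlMr.
  by rewrite ler_wpM2l// lerDl.
have [q qP] := choice near_one; exists q; split=> [h|e n0 e0]; first by case: (qP h).
have Gall : G (fun n => forall h, enorm (y n h - q h) < e).
  by apply: filter_forall => h; case: (qP h) => _; exact.
have Gn0 : G [set n | (n0 <= n)%N] by apply: sub; exact: nbhs_infty_ge.
by have [n [/= n0n yn]] := filter_ex (filterI Gn0 Gall); exists n.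
Qed.
End Compact.

(** * Performance functions *)

Section Performance.
Context {R : realType}.
Variables (phi : 'rV[R]_2 -> R) (f : R -> R).
Implicit Types (b p q w : 'rV[R]_2) (s t : R).

Definition perf b p := f (enorm (b - p)) * phi b.
Definition dperf b p w := dot (phi b *: perf_grad f b p) w.

Lemma dperfE b p w : dperf b p w = phi b * dot (perf_grad f b p) w.
Proof. exact: dotZl. Qed.

Lemma dperfN b p w : dperf b p (- w) = - dperf b p w.
Proof. exact: dotNr. Qed.

Section Decreasing.
Hypothesis f_nonincreasing : forall x y : R, 0 <= x -> x <= y -> f y <= f x.
Variable b : 'rV[R]_2.
Hypothesis phi_ge0 : 0 <= phi b.

Lemma perf_le p q : enorm (b - q) <= enorm (b - p) -> perf b p <= perf b q.
Proof. by move=> pq; rewrite ler_wpM2r// f_nonincreasing// enorm_ge0. Qed.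

(** The distance to [b] is convex along the segment. *)
Lemma perf_quasiconcave p q t : 0 <= t <= 1 ->
  Num.min (perf b p) (perf b q) <= perf b (p + t *: (q - p)).
Proof.
move=> /andP[t0 t1].
have dt : enorm (b - (p + t *: (q - p))) <= (1 - t) * enorm (b - p) + t * enorm (b - q).
  have -> : b - (p + t *: (q - p)) = (1 - t) *: (b - p) + t *: (b - q).
    by apply/rowP => i; rewrite !mxE; ring.
  apply: le_trans (enormD _ _) _; rewrite !enormZ !ger0_norm// subr_ge0//.
rewrite ge_min; have [pq|/ltW qp] := leP (enorm (b - q)) (enorm (b - p)).
  by rewrite perf_le//; nra.
by rewrite (perf_le (p := q)) ?orbT//; nra.
Qed.

(** The squared distance to [b] is a convex quadratic function along a ray; it is
    monotone up to its vertex, or everywhere if the vertex lies behind. *)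
Lemma perf_monotone q w : enorm w = 1 -> exists2 rho, 0 < rho &
  (forall s t, 0 <= s -> s <= t -> t <= rho -> perf b (q + s *: w) <= perf b (q + t *: w)) \/
  (forall s t, 0 <= s -> s <= t -> t <= rho -> perf b (q + t *: w) <= perf b (q + s *: w)).
Proof.
move=> w1; pose beta := dot (b - q) w; pose D := dot (b - q) (b - q).
have le s t : - (2 * s * beta) + s ^+ 2 <= - (2 * t * beta) + t ^+ 2 ->
    enorm (b - (q + s *: w)) <= enorm (b - (q + t *: w)).
  by move=> st; rewrite !enorm_line// ler_wsqrtr// -/beta; lra.
have [b0|b0] := ltP 0 beta; [exists beta => //; left|exists 1 => //; right] => s t s0 st t1;
  apply: perf_le; apply: le; rewrite !expr2; nra.
Qed.

End Decreasing.

(** The mean value theorem on the line through [p]; the sum is differentiated one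
    label at a time. *)
Lemma perf_incr (C : seq 'rV[R]_2) p w T c : 0 <= T ->
  (forall b t, b \in C -> 0 <= t <= T ->
     differentiable (fun q : 'rV[R]_2 => f (enorm (b - q)) : R^o) (p + t *: w)) ->
  (forall t, 0 <= t <= T -> c <= \sum_(b <- C) dperf b (p + t *: w) w) ->
  c * T <= \sum_(b <- C) perf b (p + T *: w) - \sum_(b <- C) perf b p.
Proof.
move=> T0 dif sl.
pose F t := \sum_(b <- C) perf b (p + t *: w).
pose dF t := \sum_(b <- C) dperf b (p + t *: w) w.
have D t : 0 <= t <= T -> is_derive t 1 (F : R -> R) (dF t).
  move=> tT; rewrite /F /dF.
  have {}dif b : b \in C -> differentiable (fun q : 'rV[R]_2 => f (enorm (b - q)) : R^o) (p + t *: w).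
    by move=> bC; exact: dif.
  elim: C dif {F dF sl} => [|b C IH] dif.
    rewrite (_ : (fun t => _) = cst 0); last by apply/funext => s; rewrite big_nil.
    by rewrite big_nil; exact: is_derive_cst.
  rewrite (_ : (fun t => _) = (fun t => perf b (p + t *: w)) + (fun t => \sum_(b <- C) perf b (p + t *: w)));
    last by apply/funext => s; rewrite big_cons.
  rewrite big_cons; apply: is_deriveD; last first.
    by apply: IH => b' b'C; apply: dif; rewrite inE b'C orbT.
  have dfb := dif b (mem_head _ _).
  rewrite dperfE perf_grad_dot//; have := is_deriveZ (phi b) (line_is_derive dfb).
  suff -> : (fun t => perf b (p + t *: w)) =
    phi b \*: (fun t : R => f (enorm (b - (p + t *: w))) : R^o) by [].
  by apply/funext => s /=; rewrite /perf mulrC.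
have [|z|z + zE] := @MVT_segment R F dF 0 T T0.
- move=> z; rewrite in_itv/= => /andP[z0 zT]; apply: D; lra.
- apply: continuous_in_subspaceT => t; rewrite inE/= in_itv/= => tT.
  by have [+ _] := D t tT; move=> /derivable1_diffP; exact: differentiable_continuous.
rewrite in_itv/= => zT; move: zE; rewrite /F scale0r addr0 subr0 => ->.
by rewrite ler_wpM2r// sl.
Qed.

End Performance.

Section Constants.
Context {R : realType} (N : network R) (r : R) (phi : 'rV[R]_2 -> R) (f : R -> R).
Hypothesis phi_ge0 : forall b, b \in collapsed N r -> 0 <= phi b.
Hypothesis f_deriv2 : locally_bounded_deriv2 f.
Hypothesis f_grad : forall b p, b \in collapsed N r -> on_network N p ->
  differentiable (fun q : 'rV[R]_2 => f (enorm (b - q)) : R^o) p.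

Lemma phi_bounded : exists2 F, 0 < F & forall b, b \in collapsed N r -> phi b <= F.
Proof.
have F0 : 0 <= \sum_(b <- collapsed N r) `|phi b| by rewrite sumr_ge0.
exists (\sum_(b <- collapsed N r) `|phi b| + 1); first by rewrite ltr_wpDl.
move=> b bC; rewrite (big_rem b)//= -addrA; apply: le_trans (ler_norm _) _.
by rewrite lerDl addr_ge0// sumr_ge0.
Qed.

(** [u_b] is radial, so [radial_lipschitz] gives the Lipschitz constant of its
    derivatives; comparison with the center gives their bound. *)
Lemma dperf_constants : exists lip spd, [/\ 0 < lip, 0 < spd,
  forall b p w T, b \in collapsed N r -> w \in ndirs N -> 0 <= T ->
    path_in (on_network N) p w T ->
    `|dperf phi f b (p + T *: w) w - dperf phi f b p w| <= lip * T &
  forall b p w, b \in collapsed N r -> on_network N p -> w \in ndirs N ->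
    `|dperf phi f b p w| <= spd].
Proof.
have [f1 [f2 [ff1 f12 bd]]] := f_deriv2.
have [M M0 diam] := network_diameter N.
have [L L0 lipL] := halfline_lipschitz (ltW M0) f12 bd.
have [F F0 phiF] := phi_bounded.
have dE b p w : b \in collapsed N r -> on_network N p -> w \in ndirs N ->
    f1 0 = 0 /\ dot (perf_grad f b p) w = - (f1 (enorm (b - p)) / enorm (b - p)) * dot (b - p) w.
  move=> bC pN wN; have w1 := ndirs_unit wN; have bN := collapsed_on bC.
  have [f10 Db] := derive_center ff1 w1 (f_grad bC bN); split=> //.
  rewrite perf_grad_dot; last exact: f_grad.
  have [->|pb] := eqVneq p b; last by rewrite (derive_away ff1) 1?eq_sym//; exact: f_grad.
  by rewrite Db subrr dotE !mxE !mul0r addr0 mulr0.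
exists (F * (3 * L)), (F * (3 * L * M)); have L3 : 0 < 3 * L by rewrite mulr_gt0.
split; first exact: mulr_gt0.
- by rewrite !mulr_gt0.
- move=> b p w T bC wN T0 pw.
  have pN : on_network N p by have := pw 0; rewrite scale0r addr0; apply; rewrite lexx.
  have qN : on_network N (p + T *: w) by apply: pw; rewrite T0 lexx.
  have [f10 Ep] := dE b p w bC pN wN; have [_ Eq] := dE b _ w bC qN wN.
  rewrite !dperfE -mulrBr normrM ger0_norm ?phi_ge0// -mulrA ler_pM ?phi_ge0 ?phiF//.
  have bN := collapsed_on bC; have w1 := ndirs_unit wN.
  rewrite Ep Eq; apply: le_trans (radial_lipschitz L0 f10 lipL w1 (diam _ _ bN qN) (diam _ _ bN pN)) _.
  have -> : b - (p + T *: w) - (b - p) = - (T *: w) by apply/rowP => i; rewrite !mxE; ring.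
  by rewrite enormN enormZ w1 mulr1 ger0_norm.
- move=> b p w bC pN wN; have [f10 Ep] := dE b p w bC pN wN.
  rewrite dperfE normrM ger0_norm ?phi_ge0// ler_pM ?phi_ge0 ?phiF//.
  have bN := collapsed_on bC; have w1 := ndirs_unit wN.
  have n0 : enorm (0 : 'rV[R]_2) = 0 by rewrite -(scale0r 0) enormZ normr0 mul0r.
  have := @radial_lipschitz R f1 L M (b - p) 0 w L0 f10 lipL w1 (diam _ _ bN pN).
  rewrite n0 subr0 invr0 mulr0 oppr0 mul0r subr0 -Ep => /(_ (ltW M0))/le_trans; apply.
  by rewrite ler_pM2l ?mulr_gt0// diam.
Qed.
End Constants.

(** * Runs that end at rest *)

Section Run.
Context {R : realType} {m : nat} {S : ascent_system R m}.
Notation conf := ('I_m -> space S).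
Implicit Types (P X : conf) (d : nat -> R).

Fixpoint run d P k := if k is k'.+1 then next (run d P k') (d k') else P.

Lemma eq_run d d' P n : (forall k, (k < n)%N -> d k = d' k) -> run d P n = run d' P n.
Proof.
elim: n => //= n IH dd; rewrite dd// IH// => k kn; apply: dd; exact: ltnW.
Qed.

(** Both kinds of steps are boxed, and from here on only this is used. *)
Lemma reach_run P c X : on P -> reach P c X -> exists n d,
  [/\ forall k, 0 < d k, run d P n = X & forall k, (k < n)%N -> boxed (run d P k) (d k)].
Proof.
move=> Pon; elim=> {c X} [|c X e PX IH sf|c X e PX IH bx]; first by exists 0%N, (fun=> 1).
all: have {}bx : boxed X e by
  [exact: bx|apply: safe_boxed sf; have [] := reach_facts Pon PX].
all: have [n [d [d0 dX db]]] := IH; exists n.+1, (fun k => if (k < n)%N then d k else e).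
all: have dE k : (k <= n)%N -> run (fun k => if (k < n)%N then d k else e) P k = run d P k by
  move=> kn; apply: eq_run => j jk; rewrite (leq_trans jk kn).
all: split=> [k||k]; [by case: ifP => // _; case: bx|by rewrite /= ltnn dE// dX|].
all: rewrite ltnS => kn; rewrite dE//; case: ifP => [|/negbT]; first exact: db.
all: by rewrite -leqNgt => nk; rewrite (_ : k = n) ?dX//; apply/eqP; rewrite eqn_leq kn.
Qed.

Lemma run_at_rest P d n j : (forall h, velo (run d P n) h = 0) -> run d P (n + j) = run d P n.
Proof.
move=> v0; elim: j => [|j IH]; first by rewrite addn0.
by rewrite addnS /= IH; apply/funext => h; rewrite /next /advance v0 scaler0 addr0.
Qed.

Theorem run_to_rest P : on P -> exists n d, [/\ forall k, 0 < d k,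
  forall k, on (run d P k), forall k, objective (run d P k) <= objective (run d P k.+1) &
  forall k, (n <= k)%N -> forall h, velo (run d P k) h = 0].
Proof.
move=> Pon; have [c [X [PX X0]]] := critical_reachable Pon.
have [n [d [d0 dX db]]] := reach_run Pon PX; exists n, d.
have rest k : (n <= k)%N -> run d P k = X.
  by move=> nk; rewrite -(subnKC nk) run_at_rest dX.
have dn k : on (run d P k).
  elim: k => // k IH; have [kn|nk] := ltnP k n; first by apply: boxed_on; [|exact: db].
  by rewrite rest 1?ltnW// -(rest k).
split=> // [k|k nk h]; last by rewrite rest.
have [kn|nk] := ltnP k n; first by apply: boxed_le; exact: db.
by rewrite !rest// ltnW.
Qed.

End Run.

(** * A network as an ascent system *)

Section Instance.
Context {R : realType} (N : network R) (r : R) (phi : 'rV[R]_2 -> R) (f : R -> R) {m : nat}.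
Hypothesis phi_ge0 : forall b, b \in collapsed N r -> 0 <= phi b.
Hypothesis f_nonincreasing : forall x y : R, 0 <= x -> x <= y -> f y <= f x.
Hypothesis f_grad : forall b p, b \in collapsed N r -> on_network N p ->
  differentiable (fun q : 'rV[R]_2 => f (enorm (b - q)) : R^o) p.
Variable Dt : ('I_m -> 'rV[R]_2) -> 'I_m -> 'rV[R]_2.
Hypothesis Dt_deriv : network_deriv N r phi f Dt.
Variables (i0 : 'I_m) (lip spd : R).
Hypothesis lip_gt0 : 0 < lip.
Hypothesis spd_gt0 : 0 < spd.
Notation C := (collapsed N r).
Notation util := (perf phi f).
Notation dutil := (dperf phi f).
Hypothesis dutil_lip : forall b p w T, b \in C -> w \in ndirs N -> 0 <= T ->
  path_in (on_network N) p w T -> `|dutil b (p + T *: w) w - dutil b p w| <= lip * T.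
Hypothesis dutil_le : forall b p w, b \in C -> on_network N p -> w \in ndirs N ->
  `|dutil b p w| <= spd.

Lemma ndirsN w : w \in ndirs N -> - w \in ndirs N.
Proof.
by move=> /ndirsP[e eN [] ->]; apply: (mem_ndirs eN); [right|left; rewrite opprK].
Qed.

Lemma network_star_dirs q : on_network N q -> exists2 rho, 0 < rho &
  (forall p, on_network N p -> enorm (p - q) <= rho -> exists w,
     [/\ w \in ndirs N, p = q + enorm (p - q) *: w & path_in (on_network N) q w rho]) /\
  (forall v, v \in nstops N -> enorm (v - q) <= rho -> v = q).
Proof.
move=> /network_star[rho rho0 [st sv]]; exists rho => //; split=> // p pN pq.
have [e [w [eN wE pE seg]]] := st p pN pq; exists w; split=> //; first exact: mem_ndirs eN wE.
by move=> t /seg; exact: edge_segm_on.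
Qed.

Lemma network_util_incr (a : pred 'rV[R]_2) p w T c : w \in ndirs N -> 0 <= T ->
  path_in (on_network N) p w T ->
  (forall t, 0 <= t <= T -> c <= \sum_(b <- C | a b) dutil b (p + t *: w) w) ->
  c * T <= \sum_(b <- C | a b) util b (p + T *: w) - \sum_(b <- C | a b) util b p.
Proof.
move=> wN T0 pw sl; rewrite -!(big_filter C a); apply: perf_incr => // [b t|t tT].
  by rewrite mem_filter => /andP[_ bC] tT; apply: f_grad => //; exact: pw.
by rewrite big_filter; exact: sl.
Qed.

Lemma network_util_bounded : exists B, forall b p, b \in C -> on_network N p -> util b p <= B.
Proof.
have [F F0 phiF] := phi_bounded N r phi; exists (`|f 0| * F) => b p bC _.
apply: (@le_trans _ _ (`|f 0| * phi b)); last by rewrite ler_wpM2l// phiF.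
rewrite ler_wpM2r ?phi_ge0//; apply: le_trans (ler_norm _).
by apply: f_nonincreasing; rewrite ?lexx ?enorm_ge0.
Qed.

Lemma coverage_grad_dot P h w : dot (coverage_grad N r phi f P h) w =
  \sum_(b <- C | winner i0 P b == h) dutil b (P h) w.
Proof.
rewrite /coverage_grad (voronoiE i0) big_filter.
by apply: (big_morph (fun v => dot v w) (fun u v => dotDl u v w)); rewrite dotE !mxE !mul0r addr0.
Qed.

Lemma network_velo_spec P h : (forall i, on_network N (P i)) -> Dt P h = 0 \/
  exists w v, [/\ w \in ndirs N, 0 < v, ingoing (on_network N) (P h) w, Dt P h = v *: w &
    v = \sum_(b <- C | winner i0 P b == h) dutil b (P h) w].
Proof.
move=> Pon; have [|[w [v [wN v0 ig DE vE]]]] := network_deriv_spec (Pon h) (Dt_deriv h Pon).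
  by left.
by right; exists w, v; split; rewrite // -coverage_grad_dot.
Qed.

Lemma network_velo_inside P h w : (forall i, on_network N (P i)) ->
  P h \notin nstops N -> w \in ndirs N -> ingoing (on_network N) (P h) w ->
  Dt P h = (\sum_(b <- C | winner i0 P b == h) dutil b (P h) w) *: w.
Proof.
move=> Pon nst wN ig; rewrite -coverage_grad_dot.
exact: (network_deriv_inside (Pon h) (Dt_deriv h Pon)).
Qed.

Definition network_system : ascent_system R m :=
  @AscentSystem R m 'rV[R]_2 enorm (on_network N) (nstops N) (ndirs N)
    'rV[R]_2 C util dutil (winner i0) Dt lip spd
    (undup_uniq _) (@enormD R) (@enormZ R) (@enorm_eq0 R) (@ndirs_unit R N) ndirsN
    network_star_dirs (@network_run R N) (@network_cluster R N m)
    lip_gt0 spd_gt0 dutil_lip (@dperfN R phi f) dutil_le network_util_incr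
    network_util_bounded
    (fun b p q t bC => @perf_quasiconcave R phi f f_nonincreasing b (phi_ge0 bC) p q t)
    (fun b q w bC wN => @perf_monotone R phi f f_nonincreasing b (phi_ge0 bC) q w (ndirs_unit wN))
    (fun P b i bC => perf_le f_nonincreasing (phi_ge0 bC) (winner_closest i0 P b i))
    network_velo_spec network_velo_inside.

Lemma coverage_objective P : coverage N r phi f P = objective (S := network_system) P.
Proof.
rewrite (@objectiveE R m network_system); apply: eq_bigr => i _.
by rewrite (voronoiE i0) big_filter.
Qed.

End Instance.

Section Distance.
Context {R : realType} {m : nat}.

Lemma dist_to_mem (A : set ('I_m -> 'rV[R]_2)) P : A P -> dist_to A P = 0%E.
Proof.
move=> AP; apply/eqP; rewrite eq_le; apply/andP; split.
  apply: ereal_inf_lbound; exists P => //; congr (_%:E).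
  rewrite /conf_dist big1 ?sqrtr0// => h _; rewrite subrr.
  by rewrite -(scale0r 0) enormZ normr0 mul0r expr0n.
by apply: le_ereal_inf_tmp => _ [Q _ <-]; rewrite lee_fin sqrtr_ge0.
Qed.

End Distance.

Theorem theorem15 (R : realType) (N : network R) (r : R) (r_gt0 : 0 < r)
    (phi : 'rV[R]_2 -> R)
    (phi_ge0 : forall b, b \in collapsed N r -> 0 <= phi b)
    (f : R -> R)
    (f_nonincreasing : forall x y : R, 0 <= x -> x <= y -> f y <= f x)
    (f_C1 : C1_halfline f)
    (f_deriv2 : locally_bounded_deriv2 f)
    (f_grad : forall b p, b \in collapsed N r -> on_network N p ->
       differentiable (fun q : 'rV[R]_2 => f (enorm (b - q)) : R^o) p)
    (m : nat)
    (Dt : ('I_m -> 'rV[R]_2) -> 'I_m -> 'rV[R]_2)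
    (Dt_deriv : network_deriv N r phi f Dt)
    (P0 : 'I_m -> 'rV[R]_2)
    (P0_on : on_network_conf N P0)
    (P0_nondegenerate : injective P0) :
  exists (delta : nat -> R) (P : nat -> 'I_m -> 'rV[R]_2),
    [/\ forall k, 0 < delta k,
        P 0%N = P0 /\
          (forall k h, P k.+1 h = P k h + delta k *: Dt (P k) h),
        (forall k, on_network_conf N (P k)) /\
          (exists M : R, forall k h, enorm (P k h) <= M),
        (forall k, coverage N r phi f (P k) <= coverage N r phi f (P k.+1)) &
        dist_to (critical N Dt) (P k) @[k --> \oo] --> 0%E].
Proof.
suff [delta [P [d0 [PP0 Pstep] Pon incr [n rest]]]] : exists delta P, [/\
    forall k, 0 < delta k,
    P 0%N = P0 /\ (forall k h, P k.+1 h = P k h + delta k *: Dt (P k) h),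
    forall k, on_network_conf N (P k),
    forall k, coverage N r phi f (P k) <= coverage N r phi f (P k.+1) &
    exists n : nat, forall k, (n <= k)%N -> forall h, Dt (P k) h = 0].
  have [B _ PB] := network_bounded N.
  exists delta, P; split=> //.
    by split=> //; exists B => k h; exact/PB/Pon.
  apply: cvg_near_cst; near=> k; apply: dist_to_mem; split=> //.
  by apply: rest; near: k; exact: nbhs_infty_ge.
have [i0 _|m0] := pickP (xpredT : pred 'I_m); last first.
  exists (fun=> 1), (fun=> P0); split=> //.
    by split=> // k h; have := m0 h.
  by exists 0%N => k _ h; have := m0 h.
have [lip [spd [lip0 spd0 dlip dle]]] := dperf_constants phi_ge0 f_deriv2 f_grad.
pose S := network_system phi_ge0 f_nonincreasing f_grad Dt_deriv i0 lip0 spd0 dlip dle.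
have [n [delta [d0 Pon incr rest]]] := @run_to_rest R m S P0 P0_on.
exists delta, (run (S := S) delta P0); split=> //; last by exists n.
by move=> k; rewrite !(coverage_objective phi_ge0 f_nonincreasing f_grad Dt_deriv i0 lip0 spd0 dlip dle).
Unshelve. all: by end_near.
Qed.
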